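(* Let $\delta=(\delta_{(1)},\dots,\delta_{(d)})\in\mathcal D$. (a) If $\mathcal J(\delta)=+\infty$, then $H(C)=-\infty$ for every copula $C\in\mathcal C_\delta$. (b) If $\mathcal J(\delta)<+\infty$, then $\delta\in\mathcal D^0$, $\sup_{C\in\mathcal C_\delta}H(C)>-\infty$, and the copula $C_\delta$ with density $c_\delta$ is the unique copula in $\mathcal C_\delta$ such that $H(C_\delta)=\max_{C\in\mathcal C_\delta}H(C)$.
   Context: $I=[0,1]$. A copula on $\mathbb R^d$ is the cdf of a random vector whose coordinates are each uniformly distributed on $I$. For a copula $C$ and a random vector $U$ with cdf $C$, let $U_{(1)}\le\dots\le U_{(d)}$ be its order statistics; the multidiagonal of $C$ is $\delta_C=(\delta_{(1)},\dots,\delta_{(d)})$ where $\delta_{(i)}(t)=\mathbb P(U_{(i)}\le t)$. $\mathcal D$ is the set of all multidiagonals of copulas on $\mathbb R^d$; for $\delta\in\mathcal D$, $\mathcal C_\delta$ is the set of copulas with multidiagonal $\delta$, and $\mathcal D^0$ is the set of $\delta\in\mathcal D$ such that $\mathcal C_\delta$ contains an absolutely continuous copula. Each $\delta_{(i)}$ is $d$-Lipschitz and nondecreasing, hence differentiable a.e. The entropy of a copula $C$ is $H(C)=-\int_{I^d}c\log c$ if $C$ has density $c$, and $-\infty$ otherwise. For $\delta\in\mathcal D$, $$\mathcal J(\delta)=\sum_{i=2}^d\int_I \delta_{(i)}'(t)\,\big|\log(\delta_{(i-1)}(t)-\delta_{(i)}(t))\big|\,dt.$$ Construction of $c_\delta$: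 set $\delta_{(0)}=1$. For $2\le i\le d$ let $\Psi_i^\delta=\{s\in(0,1):\delta_{(i-1)}(s)>\delta_{(i)}(s)\}$; let $\Psi_1^\delta=(0,d_1)$ with $d_1=\inf\{s\in I:\delta_{(1)}(s)=1\}$ and $\Psi_{d+1}^\delta=(g_{d+1},1)$ with $g_{d+1}=\sup\{s\in I:\delta_{(d)}(s)=0\}$. Each $\Psi_i^\delta$ is open and is the disjoint union of countably many open intervals (its connected components). For $1\le i\le d$ and $t$ in a component $(g,d')$ of $\Psi_i^\delta$, with a fixed reference point $m\in(g,d')$ (the midpoint, say; for $i=1$ one may take $m=0$; the choice does not affect $c_\delta$), define $K_i(t)=\int_m^t\frac{\delta_{(i)}'(s)}{\delta_{(i-1)}(s)-\delta_{(i)}(s)}ds$, and set $K_{d+1}=0$. For $1\le i\le d$ define $a_i(t)=K_i'(t)\,e^{K_{i+1}(t)-K_i(t)}\mathbf 1_{\Psi_i^\delta\cap\Psi_{i+1}^\delta}(t)$ for $t\in I$, where $K_i'(t)=\delta_{(i)}'(t)/(\delta_{(i-1)}(t)-\delta_{(i)}(t))$. For $u\in I^d$ with ordered coordinates $u_{(1)}\le\dots\le u_{(d)}$, let $L_\delta=\{u\in I^d:(u_{(i-1)},u_{(i)})\subset\Psi_i^\delta\text{ for all }2\le i\le d\}$ and $$c_\delta(u)=\frac1{d!}\mathbf 1_{L_\delta}(u)\prod_{i=1}^d a_i(u_{(i)}).$$ For $\delta\in\mathcal D^0$, $c_\delta$ is the density of a copula, denoted $C_\delta$. *)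

(* Defs.v *)
From HB Require Import structures.
From mathcomp Require Import all_boot all_order all_algebra.
From mathcomp Require Import all_classical all_reals all_analysis.
Unset Printing Implicit Defensive.
Import Order.TTheory GRing.Theory Num.Theory.
Import numFieldNormedType.Exports.
Local Open Scope classical_set_scope.
Local Open Scope ring_scope.

Section copula_defs.
Variable R : realType.

(* Iterated integral w.r.t. one-dimensional Lebesgue measure; by Tonelli this
   is the integral w.r.t. d-dimensional Lebesgue measure for nonnegative
   measurable integrands on R^d = d.-tuple R. *)
Fixpoint leb_int (n : nat) : (n.-tuple R -> \bar R) -> \bar R :=
  match n with
  | 0 => fun f => f [tuple]
  | n'.+1 => fun f =>
      (\int[@lebesgue_measure R]_x leb_int n' (fun t : n'.-tuple R => f [tuple of x :: t]))%E
  end.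

Definition unitI : set R := [set s | 0 <= s <= 1].
Definition cube (d : nat) : set (d.-tuple R) :=
  [set u | forall j : 'I_d, 0 <= tnth u j <= 1].

Definition cdf_of (d : nat) (P : probability (d.-tuple R) R) (u : d.-tuple R) : R :=
  fine (P [set x | forall j : 'I_d, tnth x j <= tnth u j]).

Definition uniform_marginals (d : nat) (P : probability (d.-tuple R) R) : Prop :=
  forall (j : 'I_d) (t : R),
    P [set x | tnth x j <= t] = (Num.min (Num.max t 0) 1)%:E.

Definition is_copula (d : nat) (C : d.-tuple R -> R) : Prop :=
  exists P : probability (d.-tuple R) R, uniform_marginals d P /\ C = cdf_of d P.

(* order statistics: u_(i) (1-indexed, 1 <= i <= d) *)
Definition ordstat (d : nat) (u : d.-tuple R) (i : nat) : R :=
  nth 0 (sort (fun a b : R => a <= b) (tval u)) i.-1.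

(* delta is the multidiagonal of the copula C (delta i = delta_(i), 1<=i<=d;
   values of delta at other indices are irrelevant) *)
Definition is_multidiag_of (d : nat) (C : d.-tuple R -> R) (delta : nat -> R -> R) : Prop :=
  exists P : probability (d.-tuple R) R,
    [/\ uniform_marginals d P, C = cdf_of d P &
        forall i, (1 <= i <= d)%N -> forall t : R,
          P [set x | ordstat d x i <= t] = (delta i t)%:E].

Definition in_D (d : nat) (delta : nat -> R -> R) : Prop :=
  exists C : d.-tuple R -> R, is_copula d C /\ is_multidiag_of d C delta.

Definition Cset (d : nat) (delta : nat -> R -> R) : set (d.-tuple R -> R) :=
  [set C | is_copula d C /\ is_multidiag_of d C delta].

Definition is_density (d : nat) (C : d.-tuple R -> R) (c : d.-tuple R -> R) : Prop :=
  [/\ forall u, 0 <= c u, measurable_fun setT c &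
      forall u : d.-tuple R,
        (C u)%:E = leb_int d (fun x => (\1_[set x | forall j : 'I_d, tnth x j <= tnth u j] x * c x)%:E)].

Definition in_D0 (d : nat) (delta : nat -> R -> R) : Prop :=
  exists C : d.-tuple R -> R, Cset d delta C /\ exists c, is_density d C c.

Definition ent_of (d : nat) (c : d.-tuple R -> R) : \bar R :=
  (- leb_int d (fun u => (\1_(cube d) u * Num.max (c u * ln (c u)) 0)%:E)
   + leb_int d (fun u => (\1_(cube d) u * Num.max (- (c u * ln (c u))) 0)%:E))%E.

Definition entropy (d : nat) (C : d.-tuple R -> R) : \bar R :=
  match pselect (exists c, is_density d C c) with
  | left h => ent_of d (projT1 (cid h))
  | right _ => -oo%E
  end.

Definition delta0 (delta : nat -> R -> R) (i : nat) (s : R) : R :=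
  if i == 0%N then 1 else delta i s.

(* integrand delta_(i)'(t) |log(delta_(i-1)(t) - delta_(i)(t))| with the
   convention 0 * oo = 0 (|log 0| = +oo) *)
Definition J_integrand (delta : nat -> R -> R) (i : nat) (t : R) : \bar R :=
  let D := delta (i.-1) t - delta i t in
  let dd := derive1 (delta i) t in
  if 0 < D then (dd * `|ln D|)%:E
  else if dd == 0 then 0%E else +oo%E.

Definition Jfun (d : nat) (delta : nat -> R -> R) : \bar R :=
  (\sum_(2 <= i < d.+1) \int[@lebesgue_measure R]_(t in unitI) J_integrand delta i t)%E.

Definition Psi (d : nat) (delta : nat -> R -> R) (i : nat) : set R :=
  if i == 1%N then
    [set s | 0 < s < inf [set s | 0 <= s <= 1 /\ delta 1%N s = 1]]
  else if i == d.+1 then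
    [set s | sup [set s | 0 <= s <= 1 /\ delta d s = 0] < s < 1]
  else [set s | 0 < s < 1 /\ delta (i.-1) s > delta i s].

(* endpoints of the connected component of the open set U containing t *)
Definition comp_lo (U : set R) (t : R) : R := inf [set a | [set s | a <= s <= t] `<=` U].
Definition comp_hi (U : set R) (t : R) : R := sup [set b | [set s | t <= s <= b] `<=` U].

Definition Kp (delta : nat -> R -> R) (i : nat) (t : R) : R :=
  derive1 (delta i) t / (delta0 delta (i.-1) t - delta i t).

(* K_i(t) = int_m^t K_i', m the midpoint of the component of Psi_i containing t
   for 2 <= i <= d, m = 0 for i = 1 (Psi_1 = (0,d_1)); K_{d+1} = 0 *)
Definition Kfun (d : nat) (delta : nat -> R -> R) (i : nat) (t : R) : R :=
  if i == d.+1 then 0 else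
  let U := Psi d delta i in
  let m := if i == 1%N then 0 else (comp_lo U t + comp_hi U t) / 2 in
  if m <= t then fine (\int[@lebesgue_measure R]_(s in [set s | (m <= s <= t)%R]) (Kp delta i s)%:E)%E
  else - fine (\int[@lebesgue_measure R]_(s in [set s | (t <= s <= m)%R]) (Kp delta i s)%:E)%E.

Definition afun (d : nat) (delta : nat -> R -> R) (i : nat) (t : R) : R :=
  Kp delta i t * expR (Kfun d delta i.+1 t - Kfun d delta i t)
  * \1_(Psi d delta i `&` Psi d delta i.+1) t.

Definition Lset (d : nat) (delta : nat -> R -> R) : set (d.-tuple R) :=
  [set u | cube d u /\
     forall i, (2 <= i <= d)%N ->
       [set s | ordstat d u i.-1 < s < ordstat d u i] `<=` Psi d delta i].

Definition c_delta (d : nat) (delta : nat -> R -> R) (u : d.-tuple R) : R :=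
  (d`!%:R)^-1 * \1_(Lset d delta) u * \prod_(1 <= i < d.+1) afun d delta i (ordstat d u i).

End copula_defs.

(* Main.v *)
(** For [U] with multidiagonal [delta] and order statistics [X_1 <= ... <= X_d],
    write [f_i] for the derivative of [delta_i], [D_i = delta_(i-1) - delta_i]
    and [h_i = f_i / D_i].  The sequence of order statistics attached to
    [c_delta] is the Markov chain that starts with density [f_1] and moves from
    [s] to the first point after [s] of a Poisson process of intensity [h_i].
    As [D_i' = f_(i-1) - h_i * D_i], this chain has the marginals [f_i], because
    [D_i] vanishes at the ends of each component of [Psi_i].

    On its support, [ln c_delta] is a sum of functions of the single order
    statistics and of the integrals of [h_i] over [[X_(i-1), X_i]].  The
    expectations of all these terms depend on [delta] only, so Gibbs' inequality
    compares every copula with multidiagonal [delta] to [c_delta], and the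
    maximal entropy is a constant of [delta] minus [J(delta)].  To bound the
    entropy without assuming [J(delta)] finite, [D_i] is replaced by
    [max (D_i, e)] in the comparison density, and [e] tends to [0].  Uniqueness
    is strict concavity of the entropy along the segment of the two densities. *)

From HB Require Import structures.
Require Import Defs.
From mathcomp Require Import all_boot all_order all_algebra fingroup perm.
From mathcomp Require Import all_classical all_reals all_analysis.
From mathcomp Require Import measurable_realfun ring lra zify.
Import Order.TTheory GRing.Theory Num.Theory.
Import numFieldNormedType.Exports.
Local Open Scope classical_set_scope.
Local Open Scope ring_scope.
Set Implicit Arguments.
Unset Strict Implicit.
Unset Printing Implicit Defensive.

(** Gibbs' inequality tolerates a comparison density of total mass below [1], and asks nothing of
    the multidiagonal of that density. This leaves room to truncate [D_i] at [e > 0], which bounds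
    the rates [h_i] by [d / e]. By monotone convergence the truncated bounds tend to one extended
    real [ent_max], equal to [-oo] exactly when [J(delta)] is infinite; so (a) and the maximality in
    (b) are the same inequality.

    Finiteness of [J(delta)] enters through its integrand being finite almost everywhere: [f_i] then
    vanishes almost everywhere outside [Psi_i], and the vanishing derivative at minima of [D_(i+1)]
    gives the same outside [Psi_(i+1)]. Hence the indicators in [c_delta] lose no mass.

    The identity [delta_1 + ... + delta_d = d t] on [[0, 1]] is used twice: it makes each [delta_i]
    Lipschitz, and it turns the symmetry of [c_delta] into uniform marginals. As [delta_i] has a
    derivative only almost everywhere, the differential equations appear in integrated form, on
    segments inside a component of [Psi_i], where [h_i] is bounded. *)

(** * Lebesgue measure on tuples *)

Section tuple_measure.
Variable R : realType.
Local Notation mu := (@lebesgue_measure R).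

Lemma measurable_tuple_cons (n : nat) :
  measurable_fun [set: R * n.-tuple R] (fun z => [the n.+1.-tuple R of z.1 :: z.2]).
Proof. exact: measurable_cons. Qed.

Section tuple_cons_measure.
Variables (n : nat) (nu : {sigma_finite_measure set (n.-tuple R) -> \bar R}).
Let c : measurableTypeR R * n.-tuple R -> n.+1.-tuple R := fun z => [the n.+1.-tuple R of z.1 :: z.2].
Let mc : measurable_fun setT c := @measurable_tuple_cons n.

Let m : {measure set (n.+1.-tuple R) -> \bar R}.
Proof. by refine (pushforward (mu \x nu)%E c : {measure set _ -> \bar R}); exact: mc. Defined.

Let sm : sigma_finite [set: n.+1.-tuple R] m.
Proof.
have /sigma_finiteP[F [TF ndF Foo]] := sigma_finiteT (@lebesgue_measure R).
have /sigma_finiteP[G [TG ndG Goo]] := sigma_finiteT nu.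
pose s : n.+1.-tuple R -> R * n.-tuple R := fun x => (thead x, [tuple of behead x]).
have ms : measurable_fun setT s.
  apply: measurable_fun_pair; first exact: measurable_tnth.
  exact: measurable_behead.
have sK z : s (c z) = z.
  case: z => x t; rewrite /s /c /= theadE; congr pair.
  by apply/val_inj.
(* The exhaustion of the product is carried over by [s], the inverse of [c]. Both exhaustions are
   nondecreasing, so one index, the maximum of two, serves both factors. *)
exists (fun k => s @^-1` (F k `*` G k)).
  rewrite predeqE => x; split => // _.
  have : [set: R] (s x).1 by []. rewrite TF => -[i _ Fi].
  have : [set: n.-tuple R] (s x).2 by []. rewrite TG => -[j _ Gj].
  exists (maxn i j) => //; split.
    by move: Fi; exact/subsetPset/ndF/leq_maxl.
  by move: Gj; exact/subsetPset/ndG/leq_maxr.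
move=> k; have [? ?] := Foo k; have [? ?] := Goo k; split.
  by rewrite -[X in measurable X]setTI; apply: ms => //; exact: measurableX.
change ((mu \x nu)%E (c @^-1` (s @^-1` (F k `*` G k))) < +oo)%E.
rewrite (_ : c @^-1` _ = F k `*` G k); last first.
  rewrite -comp_preimage (_ : s \o c = id) ?preimage_id//.
  by apply/funext => z; exact: sK.
by rewrite product_measure1E// lte_mul_pinfty// ge0_fin_numE.
Qed.
Let smm := Measure_isSigmaFinite.Build _ _ _ m sm.
Let ms : {sigma_finite_measure set (n.+1.-tuple R) -> \bar R} :=
  HB.pack_for (SigmaFiniteMeasure.type _ R) (Measure.sort m) smm.

(** The measure is the pushforward of the product of Lebesgue measure and [nu] under consing; the
    formula is then Tonelli's theorem. *)
Lemma leb_cons_exists :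
  exists nu' : {sigma_finite_measure set (n.+1.-tuple R) -> \bar R},
    forall f : n.+1.-tuple R -> \bar R, (forall x, (0 <= f x)%E) ->
      measurable_fun [set: n.+1.-tuple R] f ->
      (\int[nu']_x f x = \int[mu]_x \int[nu]_t f [tuple of x :: t])%E.
Proof.
exists ms => f f0 mf.
transitivity (\int[(mu \x nu)%E]_z (f \o c) z)%E.
  have := ge0_integral_pushforward mc (mu \x nu)%E measurableT mf
    (fun y _ => f0 y).
  by rewrite preimage_setT => <-.
rewrite fubini_tonelli1//; first exact: measurableT_comp.
by move=> x; exact: f0.
Qed.

End tuple_cons_measure.

Lemma measurable_fun_tuple_cons (n : nat) d (T : measurableType d)
  (f : n.+1.-tuple R -> T) (x : R) : measurable_fun setT f ->
  measurable_fun setT (fun t : n.-tuple R => f [tuple of x :: t]).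
Proof.
by move=> mf; apply: (measurableT_comp mf); exact: measurable_cons.
Qed.

Lemma lebn_exists (n : nat) :
  exists nu : {sigma_finite_measure set (n.-tuple R) -> \bar R},
    forall f : n.-tuple R -> \bar R, (forall x, (0 <= f x)%E) ->
      measurable_fun [set: n.-tuple R] f -> leb_int R n f = (\int[nu]_x f x)%E.
Proof.
elim: n => [|n [nu IH]].
  exists (@dirac _ (0.-tuple R) [tuple] R : {sigma_finite_measure set _ -> \bar R}).
  move=> f f0 mf /=; rewrite integral_dirac// diracE.
  by rewrite /= mem_set// mul1e.
have [nu' nu'E] := leb_cons_exists nu; exists nu' => f f0 mf.
rewrite nu'E//=; apply: eq_integral => x _.
by rewrite IH//; exact: measurable_fun_tuple_cons.
Qed.

(** [leb_int] is a bare iterated integral. A measure representing it on nonnegative measurable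
    functions gives access to convergence theorems, null sets and densities. *)
Definition lebn (n : nat) : {sigma_finite_measure set (n.-tuple R) -> \bar R} :=
  projT1 (cid (lebn_exists n)).

Lemma leb_intE (n : nat) (f : n.-tuple R -> \bar R) : (forall x, (0 <= f x)%E) ->
  measurable_fun [set: n.-tuple R] f -> leb_int R n f = (\int[lebn n]_x f x)%E.
Proof. by rewrite /lebn; case: cid => nu /= nuE; exact: nuE. Qed.

Lemma lebn_recl (n : nat) (f : n.+1.-tuple R -> \bar R) : (forall x, (0 <= f x)%E) ->
  measurable_fun [set: n.+1.-tuple R] f ->
  (\int[lebn n.+1]_x f x = \int[mu]_x \int[lebn n]_t f [tuple of x :: t])%E.
Proof.
move=> f0 mf; rewrite -leb_intE//=; apply: eq_integral => x _.
by rewrite leb_intE//; exact: measurable_fun_tuple_cons.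
Qed.

End tuple_measure.

(** * Tonelli's theorem and pushforward measures *)

Section tonelli.
Context (R : realType) d (T : measurableType d).
Variable nu : {sigma_finite_measure set T -> \bar R}.
Local Notation mu := (@lebesgue_measure R).
Variable f : R -> T -> \bar R.
Hypothesis mf : measurable_fun [set: R * T] (fun z => f z.1 z.2).
Hypothesis f0 : forall x y, (0 <= f x y)%E.

(** The same function, typed over [measurableTypeR R], the measurable type that carries Lebesgue
    measure. *)
Let f' := fun z : measurableTypeR R * T => f z.1 z.2.
Let mf' : measurable_fun setT f' := mf.
Let f'0 z : (0 <= f' z)%E.
Proof. exact: f0. Qed.

Lemma lebesgue_tonelli :
  (\int[mu]_x \int[nu]_y f x y = \int[nu]_y \int[mu]_x f x y)%E.
Proof. exact: (fubini_tonelli f' mf' f'0). Qed.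

Lemma measurable_fun_integral_snd :
  measurable_fun [set: R] (fun x => \int[nu]_y f x y)%E.
Proof. exact: (measurable_fun_fubini_tonelli_F f' mf' f'0). Qed.

Lemma measurable_fun_integral_fst :
  measurable_fun [set: T] (fun y => \int[mu]_x f x y)%E.
Proof. exact: (measurable_fun_fubini_tonelli_G f' mf' f'0). Qed.

End tonelli.

Lemma lebesgue_tonelliR (R : realType) (f : R -> R -> \bar R) :
  measurable_fun [set: R * R] (fun z => f z.1 z.2) -> (forall x y, (0 <= f x y)%E) ->
  (\int[@lebesgue_measure R]_x \int[@lebesgue_measure R]_y f x y =
   \int[@lebesgue_measure R]_y \int[@lebesgue_measure R]_x f x y)%E.
Proof.
move=> mf f0.
exact: (@lebesgue_tonelli R _ (measurableTypeR R) (@lebesgue_measure R) f mf f0).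
Qed.

Section image_measure.
Context d1 d2 (T1 : measurableType d1) (T2 : measurableType d2) (R : realType).
Variables (m : {measure set T1 -> \bar R}) (phi : T1 -> T2).
Hypothesis mphi : measurable_fun setT phi.

Definition image_measure : {measure set T2 -> \bar R}.
Proof. by refine (pushforward m phi : {measure set _ -> \bar R}); exact: mphi. Defined.

Lemma image_measureE A : image_measure A = m (phi @^-1` A).
Proof. by []. Qed.

Lemma ge0_integral_image_measure (f : T2 -> \bar R) : measurable_fun setT f ->
  (forall y, (0 <= f y)%E) ->
  (\int[image_measure]_y f y = \int[m]_x f (phi x))%E.
Proof.
move=> mf f0.
have := ge0_integral_pushforward mphi m measurableT mf (fun y _ => f0 y).
by rewrite preimage_setT.
Qed.

End image_measure.

(** * Permutation invariance and sorting *)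

Section tuple_symmetry.
Variable R : realType.
Local Notation mu := (@lebesgue_measure R).

Lemma measurable_fun_lerP d (T : measurableType d) (f : T -> R) :
  (forall r, measurable [set x | f x <= r]) -> measurable_fun setT f.
Proof.
move=> mf; apply: (measurability _ (RGenOInfty.measurableE R)).
move=> _ [_ [r ->] <-]; rewrite setTI.
rewrite (_ : f @^-1` _ = ~` [set x | f x <= r]); first exact: measurableC.
by apply/seteqP; split => x /=; rewrite in_itv/= andbT ltNge => /negP.
Qed.

(** A map into tuples is measurable as soon as its coordinates are; this is applied to the identity
    out of the sigma-algebra generated by [G]. *)
Lemma tuple_measurable_gen (n : nat) (G : set (set (n.-tuple R))) :
  G `<=` measurable ->
  (forall (i : 'I_n) A, measurable A -> <<s G >> ((fun x => tnth x i) @^-1` A)) ->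
  measurable = <<s G >>.
Proof.
move=> Gm Gt; apply/seteqP; split => [A mA|]; last first.
  apply: smallest_sub => //; exact: sigma_algebra_measurable.
have mid : @measurable_fun _ _ (g_sigma_algebraType G) (n.-tuple R) setT id.
  apply/measurable_fun_tnthP => i _ B mB; rewrite setTI; exact: Gt.
by have := mid measurableT _ mA; rewrite setTI preimage_id.
Qed.

Definition box (n : nat) (A : 'I_n -> set R) : set (n.-tuple R) :=
  [set x | forall i, A i (tnth x i)].

Lemma measurable_box (n : nat) (A : 'I_n -> set R) :
  (forall i, measurable (A i)) -> measurable (box A).
Proof.
move=> mA; rewrite (_ : box A = \bigcap_(i in setT) ((fun x => tnth x i) @^-1` A i)).
  apply: fin_bigcap_measurable => // i _.
  by rewrite -[X in measurable X]setTI; exact: measurable_tnth.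
by apply/seteqP; split => [x xA i _|x xA i]; [exact: xA|exact: (xA i)].
Qed.

Lemma lebn_box (n : nat) (A : 'I_n -> set R) : (forall i, measurable (A i)) ->
  (lebn R n : {measure set _ -> \bar R}) (box A) = (\prod_(i < n) mu (A i))%E.
Proof.
elim: n A => [|n IH] A mA.
  rewrite big_ord0 (_ : box A = setT); last by apply/seteqP; split => // x _ [].
  rewrite -[setT]setIT -integral_indic// -leb_intE//=.
    by rewrite indicE mem_set.
  exact/measurable_EFinP.
rewrite -[box A]setIT -integral_indic//; last exact: measurable_box.
rewrite lebn_recl//; last first.
  by apply/measurable_EFinP/measurable_indic; exact: measurable_box.
rewrite big_ord_recl.
have mB : measurable (box (fun i : 'I_n => A (lift ord0 i))) by exact: measurable_box.
have IHB : (\int[lebn R n]_t (\1_(box (fun i : 'I_n => A (lift ord0 i))) t)%:E =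
    \prod_(i < n) mu (A (lift ord0 i)))%E.
  by rewrite integral_indic// setIT IH.
under eq_integral => x _.
  under eq_integral => t _.
    rewrite (_ : _%:E = ((\1_(A ord0) x)%:E * (\1_(box (fun i : 'I_n => A (lift ord0 i))) t)%:E)%E); last first.
      rewrite -EFinM !indicE; congr (_%:E); rewrite -natrM mulnb; congr (nat_of_bool _)%:R.
      apply/idP/andP => [/[!inE] xtA|[/[!inE] xA tA i]].
        split; first by have := xtA ord0; rewrite tnth0.
        by move=> i; have := xtA (lift ord0 i); rewrite tnthS.
      by case: (unliftP ord0 i) => [j ->|->]; rewrite ?tnthS ?tnth0//; exact: tA.
    over.
  rewrite ge0_integralZl//=; last exact/measurable_EFinP/measurable_indic.
  rewrite IHB.
  over.
rewrite ge0_integralZr//=.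
- by rewrite (integral_indic mu measurableT (mA ord0)) setIT.
- by apply/measurable_EFinP/measurable_indic; exact: mA.
- by apply: prode_ge0.
Qed.

Definition boxes (n : nat) : set (set (n.-tuple R)) :=
  [set B | exists A : 'I_n -> set R, (forall i, measurable (A i)) /\ B = box A].

Arguments boxes : clear implicits.

Lemma boxes_gen (n : nat) : @measurable _ (n.-tuple R) = <<s boxes n >>.
Proof.
apply: tuple_measurable_gen => [_ [A [mA ->]]|i A mA]; first exact: measurable_box.
apply: sub_sigma_algebra; exists (fun j => if j == i then A else setT); split.
  by move=> j; case: ifP.
apply/seteqP; split => x /= xA.
  by move=> j; case: eqP => // ->.
by have := xA i; rewrite eqxx.
Qed.

Definition permt (n : nat) (s : {perm 'I_n}) (x : n.-tuple R) : n.-tuple R :=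
  [tuple tnth x (s i) | i < n].

Lemma measurable_permt (n : nat) (s : {perm 'I_n}) : measurable_fun setT (permt s).
Proof.
apply/measurable_fun_tnthP => i.
rewrite (_ : _ \o _ = (fun x : n.-tuple R => tnth x (s i))); first exact: measurable_tnth.
by apply/funext => x /=; rewrite tnth_mktuple.
Qed.

(** The image of the measure under a permutation has the same value on boxes, since a product of
    side lengths can be reindexed. Boxes form a generating pi-system exhausted by the cubes with
    sides [[- k, k]]. *)
Lemma lebn_permt (n : nat) (s : {perm 'I_n}) (f : n.-tuple R -> \bar R) :
  (forall x, (0 <= f x)%E) -> measurable_fun setT f ->
  (\int[lebn R n]_x f (permt s x) = \int[lebn R n]_x f x)%E.
Proof.
move=> f0 mf.
rewrite -(ge0_integral_image_measure (lebn R n) (measurable_permt s) mf)//.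
apply: eq_measure_integral => A mA _.
apply: (measure_unique (boxes n) (fun k => box (fun i : 'I_n => `[- k%:R, k%:R]%classic))) => //.
- exact: boxes_gen.
- move=> _ _ [A1 [mA1 ->]] [A2 [mA2 ->]]; exists (fun i => A1 i `&` A2 i); split.
    by move=> i; exact: measurableI.
  apply/seteqP; split => x /=; first by move=> [x1 x2] i; split; [exact: x1|exact: x2].
  by move=> x12; split => i; case: (x12 i).
- by move=> k; exists (fun i => `[- k%:R, k%:R]%classic).
- rewrite -subTset => x _.
  pose M := \sum_(i < n) `|tnth x i|.
  exists (Num.truncn M).+1 => // i /=; rewrite in_itv/= -ler_norml.
  apply: (@le_trans _ _ M); last by apply/ltW; rewrite truncnS_gt.
  by rewrite /M (bigD1 i)//= lerDl sumr_ge0.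
- move=> _ [B [mB ->]]; rewrite lebn_box// image_measureE.
  rewrite (_ : permt s @^-1` box B = box (fun i => B ((s^-1)%g i))).
    rewrite lebn_box//; rewrite [RHS](reindex_inj (@perm_inj _ (s^-1)%g))//=.
  apply/seteqP; split => x /= xB i.
    by have := xB ((s^-1)%g i); rewrite tnth_mktuple permKV.
  by rewrite tnth_mktuple; have := xB (s i); rewrite permK.
- move=> k; rewrite image_measureE.
  rewrite (_ : permt s @^-1` _ = box (fun i : 'I_n => `[- k%:R, k%:R]%classic)).
    rewrite lebn_box// ltey_eq; apply/orP; left.
    apply: (big_ind (fun x : \bar R => x \is a fin_num)) => //.
      by move=> x y xfin yfin; rewrite fin_numM.
    by move=> i _; rewrite lebesgue_measure_itv/=; case: ifP.
  apply/seteqP; split => x /= xB i.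
    by have := xB ((s^-1)%g i); rewrite tnth_mktuple permKV.
  by rewrite tnth_mktuple.
Qed.

Lemma measurable_uniq_tuple (n : nat) :
  measurable_fun setT (fun x : n.-tuple R => uniq x).
Proof.
have mnotin m d (T : measurableType d) (f : T -> R) (g : T -> m.-tuple R) :
    measurable_fun setT f -> measurable_fun setT g ->
    measurable_fun setT (fun z => f z \notin g z : bool).
  move=> mf mg; rewrite (_ : (fun z => _) = (fun z => [forall i, f z != tnth (g z) i])).
    apply: (measurable_fun_bool true); rewrite setTI.
    rewrite (_ : _ @^-1` _ = \bigcap_(i in [set: 'I_m]) [set z | f z != tnth (g z) i]).
      apply: fin_bigcap_measurable => // i _.
      rewrite (_ : [set z | _] = (fun z => f z == tnth (g z) i) @^-1` [set false]).
        rewrite -[X in measurable X]setTI; apply: measurable_fun_eqr => //.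
        exact: (measurableT_comp (@measurable_tnth _ R m i) mg).
      by apply/seteqP; split => z /=; [move/negbTE|move=> ->].
    apply/seteqP; split => z /=; first by move/forallP => fz i _; exact: fz.
    by move=> fz; apply/forallP => i; exact: fz.
  apply/funext => z; apply/idP/forallP => [zg i|zg].
    by apply: contraNneq zg => ->; exact: mem_tnth.
  by apply/negP => /tnthP[i zi]; have := zg i; rewrite zi eqxx.
elim: n => [|n IH].
  rewrite (_ : (fun _ => _) = cst true); first exact: measurable_cst.
  by apply/funext => x; rewrite (tuple0 x).
rewrite (_ : (fun _ => _) = (fun x : n.+1.-tuple R =>
    (thead x \notin [tuple of behead x]) && uniq [tuple of behead x])).
  apply: measurable_and.
    by apply: mnotin; [exact: measurable_tnth|exact: measurable_behead].
  exact: (measurableT_comp IH (@measurable_behead _ _ _)).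
by apply/funext => x; rewrite {1}(tuple_eta x).
Qed.

(** If [t] has no repetition, [x :: t] has one only for the finitely many [x] in [t], a null set;
    Tonelli concludes. Without ties the sorting permutation is unique. *)
Lemma lebn_not_uniq (n : nat) :
  {ae lebn R n, forall x : n.-tuple R, uniq x}.
Proof.
have mN m : measurable [set x : m.-tuple R | ~~ uniq x].
  rewrite (_ : [set x | _] = (fun x : m.-tuple R => uniq x) @^-1` [set false]).
    by rewrite -[X in measurable X]setTI; exact: measurable_uniq_tuple.
  by apply/seteqP; split => z /=; [move/negbTE|move=> ->].
suff N0 : (lebn R n : {measure set _ -> \bar R}) [set x : n.-tuple R | ~~ uniq x] = 0%E.
  by exists [set x : n.-tuple R | ~~ uniq x]; split; [exact: mN|exact: N0|move=> x /negP].
elim: n => [|n IH].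
  by rewrite (_ : [set x | _] = set0)// -subset0 => x /=; rewrite (tuple0 x).
pose f (x : R) (t : n.-tuple R) : \bar R := (\1_[set x : n.+1.-tuple R | ~~ uniq x] [tuple of x :: t])%:E.
have mf : measurable_fun [set: R * n.-tuple R] (fun z => f z.1 z.2).
  apply/measurable_EFinP.
  apply: (@measurableT_comp _ _ _ _ _ _ (\1_[set x : n.+1.-tuple R | ~~ uniq x] : _ -> R)).
    by apply: measurable_indic; exact: mN.
  exact: measurable_tuple_cons.
rewrite -[[set x | _]]setIT -integral_indic//; last exact: mN.
rewrite lebn_recl//; last by apply/measurable_EFinP/measurable_indic; exact: mN.
transitivity (\int[mu]_x \int[lebn R n]_t f x t)%E; first by [].
have f0 x t : (0 <= f x t)%E by rewrite lee_fin.
rewrite lebesgue_tonelli//.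
transitivity (\int[lebn R n]_t (0 : \bar R))%E; last by rewrite integral0.
apply: ge0_ae_eq_integral => //.
- exact: (measurable_fun_integral_fst mf f0).
- by move=> t _; apply: integral_ge0.
exists [set x : n.-tuple R | ~~ uniq x]; split; [exact: mN|exact: IH|].
(* It suffices to show that the inner integral is [0] whenever [t] has no repetition. *)
move=> t /= /not_implyP[_]; apply: contra_notN => ut.
transitivity (\int[mu]_x (\1_[set x | x \in t] x)%:E)%E.
  apply: eq_integral => x _; congr (_%:E); rewrite !indicE; congr (nat_of_bool _)%:R.
  by apply/idP/idP; rewrite !inE /= ut andbT negbK.
have fint : finite_set [set` t] by exact: finite_seq.
rewrite integral_indic//; last first.
  by apply: countable_measurable => //; exact: finite_set_countable.
by rewrite setIT; apply: countable_lebesgue_measure0; exact: finite_set_countable.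
Qed.

Definition sortt (n : nat) (x : n.-tuple R) : n.-tuple R :=
  [tuple of sort (fun a b : R => a <= b) x].

Lemma sortt_permt (n : nat) (s : {perm 'I_n}) (x : n.-tuple R) :
  sortt (permt s x) = sortt x.
Proof.
apply/val_inj => /=; apply/perm_sortP.
- exact: le_total.
- exact: le_trans.
- exact: le_anti.
- by apply/tuple_permP; exists s.
Qed.

Lemma sortt_id (n : nat) (x : n.-tuple R) : sorted <=%R x -> sortt x = x.
Proof. by move=> sx; apply/val_inj => /=; apply/sorted_sort => //; exact: le_trans. Qed.

(** Two permutations that sort [x] give the same sorted tuple, hence agree when the entries are
    distinct. The sum is a partition of unity indexed by permutations. *)
Lemma sum_sorted_permt (n : nat) (x : n.-tuple R) : uniq x ->
  (\sum_(s : {perm 'I_n}) (sorted <=%R (permt s x) : nat) = 1)%N.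
Proof.
move=> ux; have /tuple_permP[s0 xs0] : perm_eq (sort <=%R x) x by rewrite perm_sort.
have ss0 : sorted <=%R (permt s0 x).
  by rewrite /permt -xs0; apply: sort_sorted; exact: le_total.
rewrite (bigD1 s0)//= ss0 big1// => s ns0.
case ss: (sorted _ _) => //; exfalso; move/eqP: ns0; apply.
have ps : permt s x = permt s0 x.
  by rewrite -(@sortt_id _ (permt s x) ss) -(sortt_id ss0) !sortt_permt.
apply/permP => i; have := congr1 (fun t => tnth t i) ps.
rewrite !tnth_mktuple => /eqP; rewrite !(tnth_nth 0) nth_uniq ?size_tuple//.
by move/eqP/val_inj.
Qed.

Lemma measurable_sorted_tuple (n : nat) :
  measurable [set x : n.-tuple R | sorted <=%R x].
Proof.
rewrite (_ : [set x | _] = \bigcap_(i in [set: 'I_n]) \bigcap_(j in [set: 'I_n])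
    [set x : n.-tuple R | (i <= j)%N -> tnth x i <= tnth x j]).
  apply: fin_bigcap_measurable => // i _; apply: fin_bigcap_measurable => // j _.
  case: (leqP i j) => ij; last first.
    by rewrite (_ : [set x | _] = setT)//; apply/seteqP; split.
  rewrite (_ : [set x | _] = (fun x : n.-tuple R => tnth x i <= tnth x j) @^-1` [set true]).
    by rewrite -[X in measurable X]setTI; apply: measurable_fun_ler => //; exact: measurable_tnth.
  by apply/seteqP; split => x /=; [exact|move=> ->].
apply/seteqP; split => x /= sx.
  move=> i _ j _ ij; rewrite !(tnth_nth 0).
  by apply: sorted_leq_nth => //; rewrite ?inE ?size_tuple//; exact: le_trans.
case: n x sx => [|n] x sx; first by rewrite (tuple0 x).
apply/(sortedP 0) => i; rewrite size_tuple => ilt.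
have /= := sx (inord i) I (inord i.+1) I; rewrite !(tnth_nth 0) !inordK//; last exact: ltnW.
exact.
Qed.

(** On each of the finitely many sets where a given permutation sorts the tuple, sorting is that
    permutation. *)
Lemma measurable_sortt (n : nat) : measurable_fun setT (@sortt n).
Proof.
apply/measurable_fun_tnthP => i /=.
apply: measurable_fun_lerP => r.
rewrite (_ : [set x | _] = \bigcup_(s in [set: {perm 'I_n}])
    ([set x | sorted <=%R (permt s x)] `&` [set x | tnth (permt s x) i <= r])).
  apply: fin_bigcup_measurable => [|s _]; first exact: finite_finset.
  apply: measurableI.
    rewrite -[X in measurable X]setTI.
    exact: (measurable_permt s measurableT (@measurable_sorted_tuple n)).
  rewrite -[X in measurable X]setTI.
  apply: (measurable_permt s measurableT (Y := [set x | tnth x i <= r])).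
  rewrite (_ : [set x | _] = (fun x : n.-tuple R => tnth x i <= r) @^-1` [set true])//.
  by rewrite -[X in measurable X]setTI; apply: measurable_fun_ler => //; exact: measurable_tnth.
apply/seteqP; split => x /=.
  have /tuple_permP[s xs] : perm_eq (sort <=%R x) x by rewrite perm_sort.
  have ss : sorted <=%R (permt s x).
    by rewrite /permt -xs; apply: sort_sorted; exact: le_total.
  by move=> xr; exists s => //; split => //=; rewrite -(sortt_id ss) sortt_permt.
by move=> [s _ [/= ss]]; rewrite -(@sortt_id _ (permt s x) ss) sortt_permt.
Qed.

(** Up to ties, space splits into [n!] chambers, one for each order of the coordinates; permutation
    invariance moves every chamber to the sorted one. *)
Lemma ge0_integral_sortt (n : nat) (f : n.-tuple R -> R) :
  (forall x, 0 <= f x) -> measurable_fun setT f ->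
  (\int[lebn R n]_x (f (sortt x))%:E =
   n`!%:R%:E * \int[lebn R n]_x (\1_[set x : n.-tuple R | sorted <=%R x] x * f x)%:E)%E.
Proof.
move=> f0 mf; set S := [set x : n.-tuple R | sorted <=%R x].
have mS : measurable S := @measurable_sorted_tuple n.
have mfs : measurable_fun setT (fun x => f (sortt x)).
  exact: (measurableT_comp mf (@measurable_sortt n)).
pose g (x : n.-tuple R) : \bar R := (\1_S x * f (sortt x))%:E.
have g0 x : (0 <= g x)%E by rewrite lee_fin mulr_ge0.
have mg : measurable_fun setT g by apply/measurable_EFinP/measurable_funM.
transitivity (\int[lebn R n]_x \sum_(s : {perm 'I_n}) g (permt s x))%E.
  apply: ge0_ae_eq_integral => //.
  - exact/measurable_EFinP.
  - apply: emeasurable_sum => s; exact: (measurableT_comp mg (measurable_permt s)).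
  - by move=> x _; rewrite lee_fin.
  - by move=> x _; apply: sume_ge0.
  apply: filterS (@lebn_not_uniq n) => x ux _.
  rewrite sumEFin; congr (_%:E).
  under eq_bigr do rewrite sortt_permt.
  rewrite -mulr_suml -[LHS]mul1r; congr (_ * _).
  rewrite -[LHS]/(1%N%:R) -(sum_sorted_permt ux) natr_sum; apply: eq_bigr => s _.
  by rewrite indicE; congr (nat_of_bool _)%:R; apply/idP/idP; rewrite ?inE.
rewrite ge0_integral_sum//; last first.
  by move=> s; exact: (measurableT_comp mg (measurable_permt s)).
under eq_bigr do rewrite lebn_permt//.
rewrite (_ : (\int[lebn R n]_x (\1_S x * f x)%:E)%E = (\int[lebn R n]_x g x)%E); last first.
  apply: eq_integral => x _; rewrite /g indicE.
  by case: (boolP (x \in S)); rewrite ?mul0r// inE => /sortt_id ->.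
by rewrite sumr_const card_Sn mule_natl.
Qed.

End tuple_symmetry.

(** * Densities of probability measures *)

Section density.
Context d (T : measurableType d) (R : realType).
Variable mu : {sigma_finite_measure set T -> \bar R}.

Definition has_density (P : probability T R) (c : T -> R) : Prop :=
  [/\ forall x, 0 <= c x, measurable_fun setT c &
      forall A, measurable A -> P A = (\int[mu]_(x in A) (c x)%:E)%E].

Section density_probability.
Variable c : T -> R.
Hypotheses (c0 : forall x, 0 <= c x) (mc : measurable_fun setT c).

Let m (A : set T) : \bar R := (\int[mu]_(x in A) (c x)%:E)%E.

Let m0 : m set0 = 0%E.
Proof. exact: integral_set0. Qed.

Let m_ge0 A : (0 <= m A)%E.
Proof. by apply: integral_ge0 => x _; rewrite lee_fin. Qed.

Let m_sigma_additive : semi_sigma_additive m.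
Proof.
move=> /= A mA tA mUA; rewrite /m /= ge0_integral_bigcup//=.
- by apply: is_cvg_ereal_nneg_natsum_cond => n _ _; exact: m_ge0.
- exact/measurable_EFinP/measurable_funTS.
- by move=> x _; rewrite lee_fin.
Qed.

HB.instance Definition _ := isMeasure.Build _ _ _ m m0 m_ge0 m_sigma_additive.

Lemma density_measure : exists m' : {measure set T -> \bar R},
  forall A, m' A = (\int[mu]_(x in A) (c x)%:E)%E.
Proof. by exists m. Qed.

Hypothesis c1 : (\int[mu]_x (c x)%:E = 1)%E.

HB.instance Definition _ := @Measure_isProbability.Build _ _ R m c1.

Lemma density_probability : exists Q : probability T R, has_density Q c.
Proof. by exists m; split. Qed.

End density_probability.

(** Change of variables holds for the Radon-Nikodym derivative, which equals [c] almost everywhere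
    because both have the same integrals over measurable sets. *)
Lemma ge0_integral_density (P : probability T R) (c : T -> R) (phi : T -> \bar R) :
  has_density P c -> (forall x, (0 <= phi x)%E) -> measurable_fun setT phi ->
  (\int[P]_x phi x = \int[mu]_x (phi x * (c x)%:E))%E.
Proof.
move=> [c0 mc Pc] phi0 mphi.
have Pmu : P `<< mu.
  apply/null_content_dominatesP => A mA muA0; rewrite Pc//.
  by apply: null_set_integral => //; exact/measurable_EFinP/measurable_funTS.
rewrite -(Radon_Nikodym_SigmaFinite.change_of_variables Pmu phi0 measurableT mphi).
have mRN : measurable_fun setT (Radon_Nikodym_SigmaFinite.f P mu).
  exact: measurable_int (Radon_Nikodym_SigmaFinite.f_integrable Pmu).
apply: ge0_ae_eq_integral => //.
- exact: emeasurable_funM.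
- by apply: emeasurable_funM => //; exact/measurable_EFinP.
- by move=> x _; rewrite mule_ge0//; exact: Radon_Nikodym_SigmaFinite.f_ge0.
- by move=> x _; rewrite mule_ge0// lee_fin.
have : ae_eq mu setT (Radon_Nikodym_SigmaFinite.f P mu) (EFin \o c).
  apply: integral_ae_eq => //.
  - exact: Radon_Nikodym_SigmaFinite.f_integrable.
  - exact/measurable_EFinP.
  - move=> E _ mE; rewrite -Radon_Nikodym_SigmaFinite.f_integral//.
    exact: Pc.
by apply: filterS => x + _ => ->.
Qed.

Lemma integrable_density (P : probability T R) (c phi : T -> R) :
  has_density P c -> P.-integrable setT (EFin \o phi) ->
  mu.-integrable setT (EFin \o (fun x => phi x * c x)).
Proof.
move=> Pc /integrableP[mphi iphi]; have [c0 mc _] := Pc.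
apply/integrableP; split.
  by apply/measurable_EFinP/measurable_funM => //; exact/measurable_EFinP.
rewrite (ge0_integral_density Pc) in iphi => //; last exact: measurableT_comp.
apply: le_lt_trans iphi; rewrite le_eqVlt; apply/orP; left; apply/eqP.
by apply: eq_integral => x _; rewrite /= normrM (ger0_norm (c0 x)).
Qed.

Lemma integral_density (P : probability T R) (c phi : T -> R) :
  has_density P c -> P.-integrable setT (EFin \o phi) ->
  (\int[P]_x (phi x)%:E = \int[mu]_x (phi x * c x)%:E)%E.
Proof.
move=> Pc iphi; have [c0 mc _] := Pc.
have mphi : measurable_fun setT phi by have /integrableP[/measurable_EFinP] := iphi.
rewrite [LHS]integralE [RHS]integralE; congr (_ - _)%E.
  rewrite (ge0_integral_density Pc)//; last exact/measurable_funepos/measurable_EFinP.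
  apply: eq_integral => x _; rewrite !funeposE -!EFin_max -EFinM; congr (_%:E).
  by rewrite maxr_pMl// mul0r.
rewrite (ge0_integral_density Pc)//; last exact/measurable_funeneg/measurable_EFinP.
apply: eq_integral => x _; rewrite !funenegE -!EFin_max -EFinM; congr (_%:E).
by rewrite maxr_pMl// mul0r mulNr.
Qed.

Lemma has_density_integral (P : probability T R) (c : T -> R) :
  has_density P c -> (\int[mu]_x (c x)%:E = 1)%E.
Proof. by move=> [_ _ Pc]; rewrite -Pc// probability_setT. Qed.

Lemma has_density_integrable (P : probability T R) (c : T -> R) :
  has_density P c -> mu.-integrable setT (EFin \o c).
Proof.
move=> Pc; have [c0 mc _] := Pc; apply/integrableP; split; first exact/measurable_EFinP.
rewrite -[X in (_ < X)%E]/(+oo)%E (le_lt_trans _ (ltry 1))// -(has_density_integral Pc).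
rewrite le_eqVlt; apply/orP; left; apply/eqP.
by apply: eq_integral => x _ /=; rewrite ger0_norm.
Qed.

Lemma density_ae_unique (P : probability T R) (c e : T -> R) :
  has_density P c -> has_density P e -> {ae mu, forall x, c x = e x}.
Proof.
move=> cP eP; have [c0 mc Pc] := cP; have [e0 me Pe] := eP.
have : ae_eq mu setT (EFin \o c) (EFin \o e).
  apply: integral_ae_eq => //.
  - exact: has_density_integrable cP.
  - exact/measurable_EFinP.
  - by move=> E _ mE; rewrite -Pc// -Pe.
by apply: filterS => x /(_ I) [].
Qed.

End density.

(** * Distribution functions and densities on tuples *)

Section tuple_density.
Variable R : realType.
Variable d : nat.
Implicit Types (P : probability (d.-tuple R) R) (c : d.-tuple R -> R).

Definition half_box (u : d.-tuple R) : set (d.-tuple R) :=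
  [set x | forall j, tnth x j <= tnth u j].

Lemma half_boxE (u : d.-tuple R) : half_box u = box (fun j => `]-oo, tnth u j]%classic).
Proof. by apply/seteqP; split => x xu j; have := xu j; rewrite /= in_itv. Qed.

Lemma measurable_half_box u : measurable (half_box u).
Proof. by rewrite half_boxE; apply: measurable_box. Qed.

Lemma half_box_gen : @measurable _ (d.-tuple R) = <<s range half_box >>.
Proof.
apply: tuple_measurable_gen => [_ [u _ <-]|i A mA]; first exact: measurable_half_box.
have : @measurable_fun _ _ (g_sigma_algebraType (range half_box)) R setT (fun x => tnth x i).
  apply: measurable_fun_lerP => r.
  rewrite (_ : [set x | _] = \bigcup_k half_box [tuple if j == i then r else k%:R | j < d]).
    apply: bigcup_measurable => k _; apply: sub_sigma_algebra.
    by exists [tuple if j == i then r else k%:R | j < d].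
  apply/seteqP; split => x /=; last first.
    by move=> [k _ /(_ i)]; rewrite tnth_mktuple eqxx.
  move=> xr; pose M := \sum_(j < d) `|tnth x j|.
  exists (Num.truncn M).+1 => // j; rewrite tnth_mktuple; case: eqP => [->//|_].
  apply: (@le_trans _ _ M); last by apply/ltW; rewrite truncnS_gt.
  by rewrite /M (bigD1 j)//= (le_trans (ler_norm _))// lerDl sumr_ge0.
by move=> /(_ measurableT _ mA); rewrite setTI.
Qed.

Lemma cdf_ofE P u : P (half_box u) = (cdf_of R d P u)%:E.
Proof. by rewrite /cdf_of fineK// fin_num_measure//; exact: measurable_half_box. Qed.

(** Half boxes are closed under intersection, generate the sigma-algebra, and the diagonal ones
    [x <= k] exhaust the space. *)
Lemma half_box_unique (m1 m2 : {measure set (d.-tuple R) -> \bar R}) :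
  (forall u, (m1 (half_box u) < +oo)%E) ->
  (forall u, m1 (half_box u) = m2 (half_box u)) ->
  forall A, measurable A -> m1 A = m2 A.
Proof.
move=> m1oo m12 A mA.
apply: (measure_unique (range half_box) (fun k => half_box [tuple k%:R | j < d])) => //.
- exact: half_box_gen.
- move=> _ _ [u _ <-] [v _ <-]; exists [tuple Num.min (tnth u j) (tnth v j) | j < d] => //.
  apply/seteqP; split => x /=.
    by move=> xuv; split => j; have := xuv j; rewrite tnth_mktuple le_min => /andP[].
  by move=> [xu xv] j; rewrite tnth_mktuple le_min xu xv.
- rewrite -subTset => x _; pose M := \sum_(j < d) `|tnth x j|.
  exists (Num.truncn M).+1 => // j; rewrite tnth_mktuple.
  apply: (@le_trans _ _ M); last by apply/ltW; rewrite truncnS_gt.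
  by rewrite /M (bigD1 j)//= (le_trans (ler_norm _))// lerDl sumr_ge0.
- by move=> _ [u _ <-].
Qed.

Lemma leb_int_half_box c u : (forall x, 0 <= c x) -> measurable_fun setT c ->
  leb_int R d (fun x => (\1_(half_box u) x * c x)%:E) =
  (\int[lebn R d]_(x in half_box u) (c x)%:E)%E.
Proof.
move=> c0 mc; rewrite leb_intE//; last 2 first.
- by move=> x; rewrite lee_fin mulr_ge0.
- apply/measurable_EFinP/measurable_funM => //; apply: measurable_indic.
  exact: measurable_half_box.
rewrite [RHS]integral_mkcond; apply: eq_integral => x _.
by rewrite patchE indicE; case: ifP; rewrite ?mul1r ?mul0r.
Qed.

Lemma has_density_cdf P c : has_density (lebn R d) P c -> is_density R d (cdf_of R d P) c.
Proof.
move=> [c0 mc Pc]; split => // u.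
rewrite (leb_int_half_box u c0 mc) -Pc; first exact/esym/cdf_ofE.
exact: measurable_half_box.
Qed.

(** [is_density] speaks of the distribution function only. The measure with density [c] agrees with
    [P] on half boxes, hence everywhere. *)
Lemma is_density_has_density P c : is_density R d (cdf_of R d P) c ->
  has_density (lebn R d) P c.
Proof.
move=> [c0 mc Pc]; split => //.
have Pu u : P (half_box u) = (\int[lebn R d]_(x in half_box u) (c x)%:E)%E.
  by rewrite cdf_ofE Pc -leb_int_half_box.
have [m mE] := density_measure (lebn R d) c0 mc.
move=> A mA; rewrite -mE; apply: half_box_unique => // u; last by rewrite mE; exact: Pu.
by have := cdf_ofE P u; rewrite /= => ->; exact: ltry.
Qed.

End tuple_density.

(** * Measurability of the derivative of a continuous function *)

Section measurable_derivative.
Variable R : realType.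
Variable f : R -> R.
Hypothesis cf : continuous f.

Let q (h x : R) : R := h^-1 * (f (h + x) - f x).

Let mq h : measurable_fun setT (q h).
Proof.
have mf : measurable_fun setT f by exact: continuous_measurable_fun.
apply: measurable_funM => //; apply: measurable_funB => //.
apply: (measurableT_comp mf); exact: measurable_funD.
Qed.

Let small (m : nat) (h : R) := (`|h| < m.+1%:R^-1) && (h != 0).

(** The points where the difference quotients along rational increments are not Cauchy at [0]. Only
    countable operations occur, so [N] is measurable. *)
Let N : set R := \bigcup_n \bigcap_m \bigcup_(r : rat) \bigcup_(r' : rat)
  [set x | [/\ small m (ratr r), small m (ratr r') &
            n.+1%:R^-1 < `|q (ratr r) x - q (ratr r') x|]].

Let mN : measurable N.
Proof.
apply: bigcup_measurable => n _; apply: bigcap_measurable => [|m _]; first by exists 0%N.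
apply: bigcupT_measurable_rat => r; apply: bigcupT_measurable_rat => r'.
case: (boolP (small m (ratr r) && small m (ratr r'))) => [/andP[sr sr']|nsr]; last first.
  rewrite (_ : [set x | _] = set0)// -subset0 => x /= [sr sr' _].
  by move: nsr; rewrite sr sr'.
rewrite (_ : [set x | _] =
    (fun x => n.+1%:R^-1 < `|q (ratr r) x - q (ratr r') x|) @^-1` [set true]).
  rewrite -[X in measurable X]setTI; apply: measurable_fun_ltr => //.
  by apply: measurableT_comp => //; exact: measurable_funB.
by apply/seteqP; split => x /= => [[]|->].
Qed.

Let small0 (m : nat) : exists r : rat, small m (ratr r).
Proof.
have [r] := @rat_in_itvoo R 0 m.+1%:R^-1 ltac:(by rewrite invr_gt0).
rewrite in_itv/= => /andP[r0 rm]; exists r.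
by rewrite /small gt_eqF// gtr0_norm// rm.
Qed.

Let N_cvg x : ~ N x <-> cvg (q h x @[h --> 0^']).
Proof.
split => [xN|xl]; last first.
  move=> [n _] nN; set l := lim _ in xl.
  have /cvgrPdist_lt/(_ (n.+1%:R^-1 / 2)) := xl.
  rewrite divr_gt0 ?invr_gt0// => /(_ isT).
  move=> /nbhs_ballP[e /= e0 eP].
  have [m me] : exists m : nat, m.+1%:R^-1 < e.
    exists (Num.truncn e^-1); rewrite invf_plt ?posrE// truncnS_gt//.
  have [r _ [r' _ [/andP[sr r0] /andP[sr' r'0]]]] := nN m I.
  rewrite ltNge => /negP; apply.
  have near_l h : `|h| < m.+1%:R^-1 -> h != 0 -> `|l - q h x| < n.+1%:R^-1 / 2.
    move=> hm h0; apply: eP => //=.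
    by rewrite /ball /= sub0r normrN (lt_trans hm).
  rewrite (_ : _ - _ = (l - q (ratr r') x) - (l - q (ratr r) x)); last by ring.
  rewrite (le_trans (ler_normB _ _))// [leRHS]splitr lerD// ltW//; exact: near_l.
apply/cauchy_cvgP/cauchy_exP => e /= e0.
have [n ne] : exists n : nat, n.+1%:R^-1 < e.
  exists (Num.truncn e^-1); rewrite invf_plt ?posrE// truncnS_gt//.
have [m mP] : exists m, forall r r' : rat, small m (ratr r) -> small m (ratr r') ->
    `|q (ratr r) x - q (ratr r') x| <= n.+1%:R^-1.
  apply: contrapT => /forallNP nP; apply: xN; exists n => // m _.
  have /existsNP[r /existsNP[r' /not_implyP[sr /not_implyP[sr' /negP]]]] := nP m.
  by rewrite -ltNge => rr'; exists r => //; exists r' => //; split.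
have [r0 sr0] := small0 m.
exists (q (ratr r0) x); rewrite near_simpl.
(* If the bound failed at a real increment [h], continuity of [q] in [h] away from [0] would make it
   fail at a rational increment nearby. *)
have sm h : small m h -> `|q (ratr r0) x - q h x| < e.
  move=> sh; rewrite (le_lt_trans _ ne)// leNgt; apply/negP => hbig.
  have [/= /andP[hm h0]] := sh.
  have cq : {for h, continuous (fun h => `|q (ratr r0) x - q h x|)}.
    apply: cvg_norm; apply: cvgB; first exact: cvg_cst.
    apply: cvgM; first by apply: cvgV.
    apply: cvgB; last exact: cvg_cst.
    apply: (@cvg_comp _ _ _ (fun h => h + x) f); last exact: cf.
    by apply: cvgD; [exact: cvg_id|exact: cvg_cst].
  have ch : nbhs h [set h' | small m h' /\ n.+1%:R^-1 < `|q (ratr r0) x - q h' x|].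
    near=> h'; split; last first.
      by near: h'; apply: (cvgr_gt _ cq).
    rewrite /small; apply/andP; split; near: h'.
      by apply: (@cvgr_lt _ _ _ _ (fun h => `|h|) _ (@norm_continuous _ _ h)).
    exact: (@cvgr_neq0 _ _ _ _ _ id h).
  move: ch => /nbhs_ballP[e' /= e'0 e'P].
  have [r'] := @rat_in_itvoo R h (h + e') ltac:(by rewrite ltrDl).
  rewrite in_itv/= => /andP[hr rh].
  have [] := e'P (ratr r').
    by rewrite /ball/= ltr_distlC; apply/andP; split; lra.
  move=> sr'; rewrite ltNge => /negP; apply; exact: mP.
exists m.+1%:R^-1 => /=; first by rewrite invr_gt0.
move=> h /=; rewrite sub0r normrN => hm h0; apply: sm; exact/andP.
Unshelve. all: by end_near. Qed.

(** Off [N] the derivative is the limit of the quotients with increments [1 / (n + 1)]. On [N] the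
    limit defining [derive1] diverges, and its default value [0] is matched by the indicator in
    [u]. *)
Lemma measurable_derive1 : measurable_fun setT (derive1 f).
Proof.
pose u (n : nat) (x : R) := \1_(~` N) x * q n.+1%:R^-1 x.
apply: (@measurable_fun_cvg _ _ _ setT u) => //.
  move=> n; apply: measurable_funM => //; apply: measurable_indic; exact: measurableC.
move=> x _; rewrite /u /derive1 indicE.
have [xN|xN] := boolP (x \in ~` N); last first.
  rewrite dvgP; last by move=> /N_cvg xN'; move/negP: xN; apply; rewrite inE.
  under eq_fun do rewrite mul0r; exact: cvg_cst.
under eq_fun do rewrite mul1r.
rewrite inE in xN; move/N_cvg : xN => xN.
apply: (@cvg_comp _ _ _ (fun n : nat => n.+1%:R^-1) (fun h => q h x) _ _ _ _ xN).
move=> A [e /= e0 eA]; near=> n; apply: eA => //=.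
rewrite sub0r normrN gtr0_norm ?invr_gt0//; near: n.
exact: (cvgr_lt _ (@cvg_harmonic R)).
Unshelve. all: by end_near. Qed.

End measurable_derivative.

(** * The fundamental theorem of calculus for Lipschitz functions *)

Section ftc_lipschitz.
Variable R : realType.
Local Notation mu := (@lebesgue_measure R).

Lemma lebesgue_aeS (P Q : R -> Prop) : (forall x, P x -> Q x) ->
  {ae mu, forall x, P x} -> {ae mu, forall x, Q x}.
Proof. by move=> PQ; apply: filterS => //; exact: (ae_filter_ringOfSetsType mu). Qed.

Lemma lebesgue_aeS2 (P Q S : R -> Prop) : (forall x, P x -> Q x -> S x) ->
  {ae mu, forall x, P x} -> {ae mu, forall x, Q x} -> {ae mu, forall x, S x}.
Proof. by move=> PQS; apply: filterS2 => //; exact: (ae_filter_ringOfSetsType mu). Qed.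

Lemma lipschitz_continuous (f : R -> R) (L : R) :
  (forall x y, `|f x - f y| <= L * `|x - y|) -> continuous f.
Proof.
move=> fL x; apply/cvgrPdist_lt => e e0.
have L0 : 0 <= L by have := fL 1 0; rewrite subr0 normr1 mulr1; exact: le_trans.
near=> y; rewrite (le_lt_trans (fL _ _))//.
(* [L] may be [0], whereas [L + 1] can be divided by. *)
rewrite (@le_lt_trans _ _ ((L + 1) * `|x - y|))//.
  by rewrite ler_wpM2r// lerDl.
rewrite -ltr_pdivlMl ?ltr_wpDl//; near: y; apply: cvgr_dist_lt => //.
by rewrite mulr_gt0// invr_gt0 ltr_wpDl.
Unshelve. all: by end_near. Qed.

Lemma is_derive_seq (f : R -> R) (x l : R) : is_derive x 1 f l ->
  n.+1%:R * (f (x + n.+1%:R^-1) - f x) @[n --> \oo] --> l.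
Proof.
move=> /is_derive1_caratheodory[g [fg cg <-]].
rewrite [X in X @ _ --> _](_ : _ = (fun n : nat => g (x + n.+1%:R^-1))).
  have xn : x + n.+1%:R^-1 @[n --> \oo] --> x.
    rewrite -[X in _ --> X]addr0; apply: cvgD; first exact: cvg_cst.
    exact: cvg_harmonic.
  exact: (@cvg_comp _ _ _ (fun n : nat => x + n.+1%:R^-1) g _ _ _ xn cg).
apply/funext => n; rewrite fg addrAC subrr add0r mulrCA mulfV ?mulr1//.
Qed.

(** The difference quotients [phi n] are bounded by [L] and converge to [g] almost everywhere, so
    dominated convergence applies. Their integrals are quotients of a primitive [F] of [f] at [b]
    and at [a], which tend to [f b - f a]. *)
Lemma integral_lipschitz_derive (f g : R -> R) (L a b : R) : a < b ->
  (forall x y, `|f x - f y| <= L * `|x - y|) -> measurable_fun setT g ->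
  {ae mu, forall x, x \in `]a, b[ -> is_derive x 1 f (g x)} ->
  (\int[mu]_(x in `[a, b]) (g x)%:E = (f b - f a)%:E)%E.
Proof.
move=> ab fL mg fg.
have cf := lipschitz_continuous fL.
have mf : measurable_fun setT f by exact: continuous_measurable_fun.
pose phi n x : R := n.+1%:R * (f (x + n.+1%:R^-1) - f x).
have mphi n : measurable_fun setT (phi n).
  apply: measurable_funM => //; apply: measurable_funB => //.
  by apply: (measurableT_comp mf); exact: measurable_funD.
have phiL n x : `|phi n x| <= L.
  rewrite normrM gtr0_norm// -ler_pdivlMl// (le_trans (fL _ _))//.
  by rewrite addrAC subrr add0r gtr0_norm ?invr_gt0// mulrC.
have mE (u : R -> R) : measurable_fun setT u -> measurable_fun `]a, b[ (EFin \o u).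
  by move=> mu'; exact/measurable_funTS/measurable_EFinP.
have cvgphi : {ae mu, forall x, `]a, b[%classic x ->
    (phi n x)%:E @[n --> \oo] --> (g x)%:E}.
  apply: lebesgue_aeS fg => x fgx xab; apply/fine_cvgP; split; first by near=> n.
  exact: is_derive_seq (fgx _).
have intL : mu.-integrable `]a, b[ (EFin \o cst L).
  apply: measurable_bounded_integrable => //.
    by rewrite /= lebesgue_measure_itv/= lte_fin ab -EFinB ltry.
  exact: bounded_cst.
have phiL' : {ae mu, forall x (n : nat), `]a, b[%classic x -> (`|(phi n x)%:E| <= L%:E)%E}.
  by apply: aeW => x n _ /=; rewrite lee_fin.
have [_ _ cvg1] := @dominated_convergence _ _ _ mu `]a, b[%classic (measurable_itv _)
  (fun n x => (phi n x)%:E) (EFin \o g) (EFin \o cst L) (fun n => mE _ (mphi n))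
  (mE _ mg) cvgphi intL phiL'.
(* Starting at [a - 1] makes [F] differentiable on both sides of [a]. *)
pose F x := (\int[mu]_(t in [set` `[a - 1, x]]) (f t))%R.
have dF x : a - 1 < x -> is_derive x 1 F (f x).
  move=> ax.
  have [] := @continuous_FTC1_closed R f (a - 1) x (x + 1) ltac:(by rewrite ltrDl) _ ax (cf x).
    apply: continuous_compact_integrable; first exact: segment_compact.
    exact: continuous_subspaceT.
  by move=> dF <-; rewrite derive1E; exact: DeriveDef.
have intphi n : (\int[mu]_(x in `]a, b[) (phi n x)%:E =
    (n.+1%:R * (F (b + n.+1%:R^-1) - F b) - n.+1%:R * (F (a + n.+1%:R^-1) - F a))%:E)%E.
  set h : R := n.+1%:R^-1; have h0 : 0 < h by rewrite invr_gt0.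
  pose G x := n.+1%:R * (F (x + h) - F x).
  have dG x : a - 1 < x -> is_derive x 1 G (phi n x).
    move=> ax.
    have d1 : is_derive x 1 (fun x => F (x + h)) (f (x + h)).
      have := @is_derive1_comp R F (fun x => x + h) x (f (x + h)) 1.
      rewrite mulr1; apply; first by apply: dF; rewrite (lt_trans ax)// ltrDl.
      by apply: is_derive_eq; rewrite addr0.
    exact: (is_deriveZ n.+1%:R (is_deriveB d1 (dF _ ax))).
  have cG x : a - 1 < x -> {for x, continuous G}.
    move=> ax; apply: differentiable_continuous; apply/derivable1_diffP.
    exact: (@ex_derive _ _ _ _ _ _ _ (dG x ax)).
  have cphi : continuous (phi n).
    move=> x; apply: cvgM; first exact: cvg_cst.
    apply: cvgB; last exact: cf.
    apply: (@cvg_comp _ _ _ (fun x => x + h) f); last exact: cf.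
    by apply: cvgD; [exact: cvg_id|exact: cvg_cst].
  rewrite -(@integral_itv_bndoo _ a b _ true false); last exact: (mE _ (mphi n)).
  rewrite (@continuous_FTC2 R (phi n) G a b ab) ?EFinB//.
  - exact: continuous_subspaceT.
  - have a1 : a - 1 < a by rewrite ltrBlDr ltrDl.
    split.
    + move=> x; rewrite in_itv/= => /andP[ax xb].
      exact: (@ex_derive _ _ _ _ _ _ _ (dG x (lt_trans a1 ax))).
    + exact/cvg_at_right_filter/cG.
    + exact/cvg_at_left_filter/cG/(lt_trans a1).
  - move=> x; rewrite in_itv/= => /andP[ax xb].
    have a1 : a - 1 < a by rewrite ltrBlDr ltrDl.
    by rewrite derive1E; exact: (@derive_val _ _ _ _ _ _ _ (dG x (lt_trans a1 ax))).
have a1 : a - 1 < a by rewrite ltrBlDr ltrDl.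
have cvg2 : (\int[mu]_(x in `]a, b[) (phi n x)%:E)%E @[n --> \oo] --> (f b - f a)%:E.
  under eq_fun do rewrite intphi.
  apply/fine_cvgP; split; first by near=> n.
  by apply: cvgB; apply: is_derive_seq; apply: dF => //; exact: lt_trans ab.
rewrite (@integral_itv_bndoo _ a b _ true false); last exact: (mE _ mg).
exact: (cvg_unique _ cvg1 cvg2).
Unshelve. all: by end_near. Qed.

Lemma expR_lipschitz (B x y : R) : x <= B -> y <= B ->
  `|expR x - expR y| <= expR B * `|x - y|.
Proof.
wlog yx : x y / y <= x => [H xB yB|xB yB].
  by have [/H->//|/ltW/H H'] := leP y x; rewrite distrC [leRHS](_ : _ = expR B * `|y - x|) ?H'// distrC.
rewrite !ger0_norm ?subr_ge0 ?ler_expR//.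
rewrite (_ : expR x - expR y = expR x * (1 - expR (y - x))); last first.
  by rewrite mulrBr mulr1 -expRD subrKC.
rewrite ler_pM ?expR_ge0 ?ler_expR// ?subr_ge0 -?expR0 ?ler_expR ?subr_le0//.
by rewrite expR0 lerBlDr -lerBlDl; have := expR_ge1Dx (y - x); lra.
Qed.

(** The product of [D] and the integrating factor, the exponential of the integral of [h], is
    Lipschitz; the integrand on the left is its derivative almost everywhere. *)
Lemma linear_ode_integral (D D' h : R -> R) (L M M0 s t : R) : s < t ->
  (forall x y, `|D x - D y| <= L * `|x - y|) -> (forall x, `|D x| <= M0) ->
  measurable_fun setT D' -> {ae mu, forall x : R, is_derive x 1 D (D' x)} ->
  measurable_fun setT h -> (forall x, s <= x <= t -> `|h x| <= M) ->
  (\int[mu]_(r in `[s, t])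
      ((D' r + D r * h r) * expR (\int[mu]_(x in `[s, r]) h x)%R)%:E =
   (D t * expR (\int[mu]_(x in `[s, t]) h x)%R - D s)%:E)%E.
Proof.
move=> st DL DM0 mD' dD mh hM.
have M_ge0 : 0 <= M by have := hM s; rewrite lexx ltW// => /(_ isT); exact: le_trans.
have M0_ge0 : 0 <= M0 by have := DM0 s; exact: le_trans.
(* Extending [h] by [0] outside [[s, t]] makes its primitive [k] bounded and Lipschitz on the whole
   line, as the previous theorem requires of [E]. *)
pose g := h \_ `[s, t]; pose k r := (\int[mu]_(x in `]-oo, r]) g x)%R.
have gh x : x \in `[s, t] -> g x = h x by move=> xst; rewrite /g patchE mem_set.
have gM x : `|g x| <= M.
  rewrite /g patchE; case: ifPn => [|_]; last by rewrite normr0.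
  by rewrite inE/= in_itv/=; exact: hM.
have mg : measurable_fun setT g.
  by apply/(measurable_restrictT _ _).1 => //; exact: measurable_funTS.
have ist : mu.-integrable `[s, t] (EFin \o h).
  apply: measurable_bounded_integrable => //.
  - by rewrite /= lebesgue_measure_itv/= lte_fin st -EFinB ltry.
  - exact: measurable_funTS.
  - exists M; split; first exact: num_real.
    move=> N MN x /=; rewrite in_itv/= => xst.
    exact: le_trans (hM _ xst) (ltW MN).
have ig : mu.-integrable setT (EFin \o g).
  rewrite /g -restrict_EFin; apply/integrable_restrict => //=; rewrite setTI//.
have igA (A : set R) : measurable A -> mu.-integrable A (EFin \o g).
  by move=> mA; apply: (integrableS measurableT) ig.
have kB x y : x <= y -> k y - k x = (\int[mu]_(z in `]x, y]) g z)%R.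
  move=> xy; rewrite /k Rintegral_itvB//; exact: igA.
have kL x y : `|k x - k y| <= M * `|x - y|.
  wlog xy : x y / x <= y => [H|].
    by have [/H//|/ltW/H] := leP x y; rewrite distrC (distrC y).
  rewrite distrC kB// (le_trans (le_normr_Rintegral _ _))//; first exact: igA.
  apply: (@le_trans _ _ (\int[mu]_(z in `]x, y]) M)%R).
    apply: le_Rintegral => //.
    - exact/integrable_norm/igA.
    - apply: measurable_bounded_integrable => //; last exact: bounded_cst.
      by rewrite /= lebesgue_measure_itv/=; case: ifP => _; rewrite ?ltry// -EFinB ltry.
  rewrite Rintegral_cst//= lebesgue_measure_itv/= lte_fin distrC ger0_norm ?subr_ge0//.
  by move: xy; rewrite le_eqVlt => /predU1P[->|->]; rewrite ?ltxx ?subrr.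
pose B := (\int[mu]_x `|g x|)%R.
have kBd x : `|k x| <= B.
  rewrite (le_trans (le_normr_Rintegral _ _))//; first exact: igA.
  apply: fine_le.
  - by apply: integrable_fin_num => //; exact/integrable_norm/igA.
  - by apply: integrable_fin_num => //; exact: integrable_norm ig.
  - by apply: ge0_subset_integral => //; exact/measurable_EFinP/measurableT_comp.
have ks r : r \in `[s, t] -> k r = (\int[mu]_(x in `[s, r]) h x)%R.
  rewrite in_itv/= => /andP[sr rt]; rewrite /k Rintegral_mkcond [RHS]Rintegral_mkcond.
  congr Rintegral; apply/funext => x; rewrite /g !patchE.
  have -> : (x \in `[s, r]%classic) = (x \in `]-oo, r]%classic) && (x \in `[s, t]%classic).
    rewrite !mem_setE !in_itv/=; case: (leP x r) => //= xr; rewrite ?andbT ?andbF//.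
    by rewrite (le_trans xr rt) andbT.
  by case: (x \in `]-oo, r]%classic).
have kss : k s = 0 by rewrite ks ?in_itv/= ?lexx ?ltW// set_itv1 Rintegral_set1.
have dk : {ae mu, forall x : R, is_derive x 1 k (g x)}.
  have := @FTC1Ny R g (fun y => igA _ (measurable_itv _)) (integrable_locally (measurable_itv `[s, t]) ist).
  by apply: lebesgue_aeS => x [dx <-]; rewrite derive1E; exact: DeriveDef.
pose E x := D x * expR (k x).
have EL x y : `|E x - E y| <= (L * expR B + M0 * (expR B * M)) * `|x - y|.
  have -> : E x - E y = (D x - D y) * expR (k x) + D y * (expR (k x) - expR (k y)).
    by rewrite /E mulrBl mulrBr addrA subrK.
  rewrite (le_trans (ler_normD _ _))// !normrM mulrDl lerD//.
    rewrite mulrAC ler_pM// gtr0_norm ?expR_gt0// ler_expR.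
    exact: le_trans (ler_norm _) (kBd _).
  rewrite -!mulrA ler_pM//.
  rewrite (le_trans (@expR_lipschitz B _ _ _ _))//.
  - exact: le_trans (ler_norm _) (kBd _).
  - exact: le_trans (ler_norm _) (kBd _).
  - by rewrite ler_wpM2l// expR_ge0.
have mD : measurable_fun setT D by apply: continuous_measurable_fun; exact: lipschitz_continuous DL.
have mk : measurable_fun setT k by apply: continuous_measurable_fun; exact: lipschitz_continuous kL.
have := @integral_lipschitz_derive E (fun x => (D' x + D x * g x) * expR (k x)) _ s t st EL.
rewrite /E kss expR0 mulr1 (ks t) ?in_itv/= ?lexx ?ltW// => <-.
- apply: eq_integral => x; rewrite inE/= => xst; rewrite gh// ks//.
- apply: measurable_funM; last exact: (measurableT_comp (@measurable_expR R) mk).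
  by apply: measurable_funD => //; exact: measurable_funM.
- apply: lebesgue_aeS2 dD dk => x dDx dkx _.
  have := is_deriveM dDx (is_derive1_comp (is_derive_expR (k x)) dkx).
  set l := (X in is_derive _ _ _ X -> _) => dE.
  by have -> : (D' x + D x * g x) * expR (k x) = l by rewrite /l /= /GRing.scale/=; ring.
Qed.

End ftc_lipschitz.

(** * Order statistics and uniform distribution functions *)

Section order_statistics.
Variables (R : realType) (d : nat).
Local Notation X := (ordstat R d).

Lemma ordstat_tnth (x : d.-tuple R) (i : nat) (id : (i.-1 < d)%N) :
  X x i = tnth (sortt x) (Ordinal id).
Proof. by rewrite (tnth_nth 0). Qed.

Lemma measurable_ordstat (i : nat) : measurable_fun setT (fun x => X x i).
Proof.
have [id|id] := ltnP i.-1 d.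
  rewrite (_ : (fun x => _) = (fun x => tnth x (Ordinal id)) \o @sortt R d).
    exact: (measurableT_comp (measurable_tnth _) (@measurable_sortt R d)).
  by apply/funext => x; rewrite ordstat_tnth.
rewrite (_ : (fun x => _) = cst 0); first exact: measurable_cst.
by apply/funext => x; rewrite /ordstat nth_default// size_sort size_tuple.
Qed.

Lemma measurable_tnth_le (j : 'I_d) (t : R) : measurable [set x : d.-tuple R | tnth x j <= t].
Proof.
rewrite -[X in measurable X]setTI.
rewrite (_ : [set x | _] = (fun x => tnth x j) @^-1` `]-oo, t]%classic) ?set_itvE//.
by apply: measurable_tnth => //; rewrite -set_itvE.
Qed.

Lemma ordstat_le (x : d.-tuple R) (i j : nat) : (i <= j <= d)%N -> (0 < j)%N ->
  X x i <= X x j.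
Proof.
move=> /andP[ij jd] j0; apply: (@sorted_leq_nth _ <=%R).
- exact: le_trans.
- exact: lexx.
- by apply: sort_sorted; exact: le_total.
- by rewrite inE size_sort size_tuple; lia.
- by rewrite inE size_sort size_tuple; lia.
- by lia.
Qed.

Lemma ordstat_mem (x : d.-tuple R) (i : nat) : (1 <= i <= d)%N -> exists j, X x i = tnth x j.
Proof.
move=> /andP[i1 id]; have : X x i \in x.
  by rewrite -(mem_sort <=%R) mem_nth// size_sort size_tuple prednK.
by move=> /tnthP[j ->]; exists j.
Qed.

(** Sorting permutes the coordinates, so both sides count those at most [t]. In expectation this is
    the sum rule for multidiagonals. *)
Lemma count_ordstat (x : d.-tuple R) (t : R) :
  (\sum_(1 <= i < d.+1) (X x i <= t)%R = \sum_(j < d) (tnth x j <= t)%R)%N.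
Proof.
rewrite big_add1/= big_mkord.
transitivity (\sum_(a <- sort <=%R x) (a <= t)%R)%N.
  rewrite (big_nth 0) size_sort size_tuple big_mkord; exact: eq_bigr.
rewrite (perm_big x); last by rewrite perm_sort.
by rewrite big_tuple.
Qed.

End order_statistics.

Section lebesgue_cdf.
Variable R : realType.
Local Notation mu := (@lebesgue_measure R).

Lemma half_line_gen : @measurable _ R = <<s range (fun t : R => `]-oo, t]%classic) >>.
Proof.
apply/seteqP; split => [A mA|]; last first.
  apply: smallest_sub; first exact: sigma_algebra_measurable.
  by move=> _ [t _ <-]; exact: measurable_itv.
have mid : @measurable_fun _ _ (g_sigma_algebraType (range (fun t : R => `]-oo, t]%classic))) R setT id.
  apply: measurable_fun_lerP => r; apply: sub_sigma_algebra.
  by exists r => //; rewrite set_itvE.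
by have := mid measurableT _ mA; rewrite setTI preimage_id.
Qed.

Lemma half_line_unique (m1 m2 : {measure set (measurableTypeR R) -> \bar R}) :
  (forall t, (m1 `]-oo, t]%classic < +oo)%E) ->
  (forall t, m1 `]-oo, t]%classic = m2 `]-oo, t]%classic) ->
  forall A, measurable A -> m1 A = m2 A.
Proof.
move=> m1oo m12 A mA.
apply: (@measure_unique _ R (measurableTypeR R) (range (fun t : R => `]-oo, t]%classic))
  (fun k : nat => `]-oo, k%:R]%classic)) => //.
- exact: half_line_gen.
- move=> _ _ [u _ <-] [v _ <-]; exists (Num.min u v) => //.
  apply/seteqP; split => x /=; rewrite !in_itv/= le_min; first by move=> /andP[].
  by move=> [-> ->].
- rewrite -subTset => x _; exists (Num.truncn `|x|).+1 => //=; rewrite in_itv/=.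
  by rewrite (le_trans (ler_norm x))// ltW// truncnS_gt.
- by move=> _ [u _ <-].
Qed.

Definition ucdf (t : R) : R := Num.min (Num.max t 0) 1.

Lemma lebesgue_unit_half_line (t : R) :
  mu (`]-oo, t] `&` `[0, 1]%classic) = (ucdf t)%:E.
Proof.
rewrite /ucdf; have [t0|t0] := ltP t 0.
  rewrite (_ : _ `&` _ = set0) ?measure0; last first.
    rewrite -subset0 => x [/=]; rewrite !in_itv/= => xt /andP[x0 _].
    by have := le_lt_trans xt t0; rewrite ltNge x0.
  by rewrite min_l.
have [t1|t1] := leP t 1.
  rewrite (_ : _ `&` _ = `[0, t]%classic).
    by rewrite /= lebesgue_measure_itv/= lte_fin; case: ltgtP t0 => // [_|<-] _; rewrite -?EFinB ?subr0.
  apply/seteqP; split => x /=; rewrite !in_itv/=.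
    by move=> [-> /andP[-> _]].
  by move=> /andP[x0 xt]; rewrite x0 xt (le_trans xt).
rewrite (_ : _ `&` _ = `[0, 1]%classic).
  by rewrite /= lebesgue_measure_itv/= lte_fin ltr01 -EFinB subr0.
apply/seteqP; split => x /=; rewrite !in_itv/=; first by move=> [].
by move=> /andP[x0 xt]; rewrite x0 xt (le_trans xt)// ltW.
Qed.

Lemma ucdf_lipschitz (s t : R) : s <= t -> ucdf t - ucdf s <= t - s.
Proof.
move=> st; rewrite /ucdf; have [t0|t0] := leP t 0; have [s0|s0] := leP s 0.
- lra.
- lra.
- by rewrite [X in _ - X]min_l//; case: (leP t 1) => ?; lra.
- by case: (leP t 1) => ?; case: (leP s 1) => ?; lra.
Qed.

End lebesgue_cdf.

Section sum_ordstat.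
Variables (R : realType) (d : nat) (P : probability (d.-tuple R) R).
Local Notation X := (ordstat R d).

Lemma measurable_ordstat_le i t : measurable [set x | X x i <= t].
Proof.
rewrite -[X in measurable X]setTI (_ : [set x | _] = (fun x => X x i) @^-1` `]-oo, t]%classic).
  exact: measurable_ordstat.
by rewrite set_itvE.
Qed.

Lemma sum_ordstat_prob t : (\sum_(1 <= i < d.+1) P [set x | (X x i <= t)%R] =
  \sum_(j < d) P [set x | (tnth x j <= t)%R])%E.
Proof.
transitivity (\sum_(1 <= i < d.+1) \int[P]_x ((X x i <= t)%R)%:R%:E)%E.
  apply: eq_bigr => i _; rewrite -[in LHS](setIT [set x | _]) -integral_indic//; last first.
    exact: measurable_ordstat_le.
  apply: eq_integral => x _; rewrite indicE; congr (nat_of_bool _)%:R%:E.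
  by apply/idP/idP; rewrite inE.
have mle i : measurable_fun setT (fun x : d.-tuple R => ((X x i <= t)%R : nat)%:R%:E : \bar R).
  apply/measurable_EFinP.
  rewrite (_ : (fun x => _) = \1_[set x | X x i <= t]).
    by apply: measurable_indic; exact: measurable_ordstat_le.
  by apply/funext => x; rewrite indicE; congr (nat_of_bool _)%:R; apply/idP/idP; rewrite inE.
rewrite -ge0_integral_sum//.
transitivity (\int[P]_x \sum_(j < d) (\1_[set x : d.-tuple R | (tnth x j <= t)%R] x)%:E)%E.
  apply: eq_integral => x _; rewrite !sumEFin; congr (_%:E).
  rewrite -natr_sum count_ordstat natr_sum; apply: eq_bigr => j _.
  by rewrite indicE; congr (nat_of_bool _)%:R; apply/idP/idP; rewrite inE.
rewrite ge0_integral_sum//; last first.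
  by move=> j; apply/measurable_EFinP/measurable_indic; exact: measurable_tnth_le.
by apply: eq_bigr => j _; rewrite integral_indic ?setIT//; exact: measurable_tnth_le.
Qed.

End sum_ordstat.

(** * Multidiagonals and laws of order statistics *)

Section multidiagonal.
Variables (R : realType) (d : nat) (delta : nat -> R -> R).
Variable P : probability (d.-tuple R) R.
Local Notation mu := (@lebesgue_measure R).
Local Notation X := (ordstat R d).

(** The copula is eliminated: one probability carries both the uniform marginals and the
    multidiagonal. *)
Definition realizes : Prop := uniform_marginals R d P /\
  forall i, (1 <= i <= d)%N -> forall t : R, P [set x | X x i <= t] = (delta i t)%:E.

Hypothesis Pdelta : realizes.

Let uP : uniform_marginals R d P := Pdelta.1.
Let oP i : (1 <= i <= d)%N -> forall t : R, P [set x | X x i <= t] = (delta i t)%:E.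
Proof. exact: Pdelta.2. Qed.

Lemma multidiag_nondecreasing i : (1 <= i <= d)%N -> {homo delta i : s t / s <= t}.
Proof.
move=> id s t st; rewrite -lee_fin -!oP//; apply: le_measure; rewrite ?inE//.
- exact: measurable_ordstat_le.
- exact: measurable_ordstat_le.
- by move=> x /=; move/le_trans; exact.
Qed.

Lemma multidiag_ge0 i t : (1 <= i <= d)%N -> 0 <= delta i t.
Proof. by move=> id; rewrite -lee_fin -oP. Qed.

Lemma multidiag_le1 i t : (1 <= i <= d)%N -> delta i t <= 1.
Proof.
by move=> id; rewrite -lee_fin -oP//; apply: probability_le1; exact: measurable_ordstat_le.
Qed.

Lemma multidiag_decr i t : (2 <= i <= d)%N -> delta i t <= delta i.-1 t.
Proof.
move=> id; rewrite -lee_fin -!oP; [|lia..]; apply: le_measure; rewrite ?inE//.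
- exact: measurable_ordstat_le.
- exact: measurable_ordstat_le.
- by move=> x /=; apply: le_trans; apply: ordstat_le; lia.
Qed.

Lemma multidiag_sum t : \sum_(1 <= i < d.+1) delta i t = d%:R * ucdf t.
Proof.
apply: EFin_inj; rewrite -sumEFin.
transitivity (\sum_(1 <= i < d.+1) P [set x | (X x i <= t)%R])%E.
  by apply: eq_big_nat => i id; rewrite oP//; lia.
rewrite sum_ordstat_prob.
transitivity (\sum_(j < d) (ucdf t)%:E)%E; first by apply: eq_bigr => j _; exact: uP.
by rewrite sumEFin sumr_const card_ord mulr_natl.
Qed.

(** The increments of all the [delta i] are nonnegative and add up to [d] times the increment of the
    uniform distribution function, so each is bounded by the total. *)
Lemma multidiag_increment i s t : (1 <= i <= d)%N -> s <= t ->
  0 <= delta i t - delta i s <= d%:R * (ucdf t - ucdf s).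
Proof.
move=> id st; rewrite subr_ge0 multidiag_nondecreasing//= mulrBr -!multidiag_sum.
rewrite -sumrB (big_rem i) ?mem_index_iota//= lerDl big_seq sumr_ge0// => j jI.
rewrite subr_ge0 multidiag_nondecreasing//.
by have := mem_rem jI; rewrite mem_index_iota; lia.
Qed.

Lemma multidiag_lipschitz i : (1 <= i <= d)%N ->
  forall s t, `|delta i s - delta i t| <= d%:R * `|s - t|.
Proof.
move=> id s t; wlog st : s t / s <= t => [H|].
  by have [/H//|/ltW/H] := leP s t; rewrite distrC (distrC t).
have /andP[i0 iL] := multidiag_increment id st.
rewrite distrC (ger0_norm i0) distrC ger0_norm ?subr_ge0//.
by rewrite (le_trans iL)// ler_wpM2l// ucdf_lipschitz.
Qed.

Lemma multidiag_le0 i t : (1 <= i <= d)%N -> t <= 0 -> delta i t = 0.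
Proof.
move=> id t0; apply/eqP; rewrite eq_le multidiag_ge0// andbT.
have := multidiag_sum t; rewrite /ucdf max_r// min_l// mulr0 => <-.
rewrite (big_rem i) ?mem_index_iota//= lerDl big_seq sumr_ge0// => j jI.
by rewrite multidiag_ge0//; have := mem_rem jI; rewrite mem_index_iota; lia.
Qed.

(** The nonnegative numbers [1 - delta j t] add up to [d - d = 0]. *)
Lemma multidiag_ge1 i t : (1 <= i <= d)%N -> 1 <= t -> delta i t = 1.
Proof.
move=> id t1; apply/eqP; rewrite eq_le multidiag_le1//= -subr_le0.
have : \sum_(1 <= j < d.+1) (1 - delta j t) = 0.
  rewrite sumrB multidiag_sum /ucdf max_l ?(le_trans _ t1)// min_r//.
  by rewrite sumr_const_nat subn1/= mulr1 subrr.
move=> <-; rewrite (big_rem i) ?mem_index_iota//= lerDl big_seq sumr_ge0// => j jI.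
by rewrite subr_ge0 multidiag_le1//; have := mem_rem jI; rewrite mem_index_iota; lia.
Qed.

Lemma uniform_marginal_law j A : measurable A ->
  P [set x | A (tnth x j)] = mu (A `&` `[0, 1]%classic).
Proof.
move=> mA.
have mt : measurable_fun setT (fun x : d.-tuple R => tnth x j : measurableTypeR R).
  exact: measurable_tnth.
have mu01 : measurable (`[0, 1]%classic : set (measurableTypeR R)) by [].
pose m2 : {measure set (measurableTypeR R) -> \bar R} := mrestr mu mu01.
have imE t : image_measure P mt `]-oo, t]%classic = (ucdf t)%:E.
  rewrite image_measureE.
  rewrite (_ : _ @^-1` _ = [set x : d.-tuple R | tnth x j <= t]); first exact: uP.
  by rewrite set_itvE.
have := @half_line_unique R (image_measure P mt) m2.
move=> /(_ _ _ A mA); apply => t; rewrite imE; first exact: ltry.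
by rewrite /m2 /= /mrestr lebesgue_unit_half_line.
Qed.

(** An order statistic is always one of the coordinates, so its law is at most the sum of the [d]
    marginals, which are absolutely continuous. *)
Lemma ordstat_law_dominated i A : (1 <= i <= d)%N -> measurable A -> mu A = 0%E ->
  P [set x | A (X x i)] = 0%E.
Proof.
move=> id mA A0; apply/eqP; rewrite eq_le measure_ge0 andbT.
have mAj j : measurable [set x : d.-tuple R | A (tnth x j)].
  by rewrite -[X in measurable X]setTI; apply: measurable_tnth.
have := @content_sub_fsum _ _ _ P _ [set: 'I_d] [set x | A (X x i)]
  (fun j => [set x | A (tnth x j)]) finite_finset.
rewrite fsbig1; last first.
  move=> j _; transitivity (mu (A `&` `[0, 1]%classic)); first exact: uniform_marginal_law.
  apply/eqP; rewrite eq_le measure_ge0 andbT -A0 le_measure// inE//.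
  exact: measurableI.
apply => //.
- by rewrite -[X in measurable X]setTI; exact: measurable_ordstat.
- by move=> x /=; have [j ->] := ordstat_mem x id => Aj; exists j.
Qed.

Local Notation f i := (derive1 (delta i)).

Lemma multidiag_continuous i : (1 <= i <= d)%N -> continuous (delta i).
Proof. by move=> /multidiag_lipschitz; exact: lipschitz_continuous. Qed.

Lemma measurable_multidiag i : (1 <= i <= d)%N -> measurable_fun setT (delta i).
Proof. by move=> id; apply: continuous_measurable_fun; exact: multidiag_continuous. Qed.

Lemma measurable_multidiag_derive i : (1 <= i <= d)%N -> measurable_fun setT (f i).
Proof. by move=> id; apply: measurable_derive1; exact: multidiag_continuous. Qed.

Lemma multidiag_derive_bound i t : (1 <= i <= d)%N -> 0 <= f i t <= d%:R.
Proof.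
move=> id; have [dt|ndt] := pselect (derivable (delta i) t 1); last first.
  (* Where the derivative does not exist, [derive1] has its default value [0]; the bounds therefore
     hold at every point. *)
  have -> : f i t = 0 by rewrite derive1E /derive dvgP.
  by rewrite lexx ler0n.
have ft : is_derive t 1 (delta i) (f i t) by rewrite derive1E; exact: DeriveDef.
have cf := is_derive_seq ft.
have bd n : 0 <= n.+1%:R * (delta i (t + n.+1%:R^-1) - delta i t) <= d%:R.
  have h0 : 0 <= n.+1%:R^-1 :> R by rewrite invr_ge0.
  have tt : t <= t + n.+1%:R^-1 by rewrite lerDl.
  have /andP[i0 iL] := multidiag_increment id tt.
  rewrite mulr_ge0//= -ler_pdivlMl// (le_trans iL)// mulrC ler_wpM2r//.
  by rewrite (le_trans (ucdf_lipschitz tt))// addrAC subrr add0r.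
apply/andP; split.
- by apply: (ler_cvg_to (cvg_cst 0) cf); apply: nearW => n; have /andP[] := bd n.
- by apply: (ler_cvg_to cf (cvg_cst (d%:R : R))); apply: nearW => n; have /andP[] := bd n.
Qed.

Lemma multidiag_derive_ge0 i t : (1 <= i <= d)%N -> 0 <= f i t.
Proof. by move=> /(multidiag_derive_bound t)/andP[]. Qed.

(** The law of [X_i] has a Radon-Nikodym density [h], of which [delta i] is a primitive; Lebesgue
    differentiation identifies [h] with the derivative almost everywhere. *)
Lemma ordstat_law i : (1 <= i <= d)%N ->
  {ae mu, forall t : R, is_derive t 1 (delta i) (f i t)} /\
  forall A, measurable A -> P [set x | A (X x i)] = (\int[mu]_(t in A) (f i t)%:E)%E.
Proof.
move=> id.
have mX : measurable_fun setT (fun x : d.-tuple R => X x i : measurableTypeR R).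
  exact: measurable_ordstat.
have [Q QX] : exists Q : probability (measurableTypeR R) R,
    forall A, Q A = P [set x | A (X x i)].
  pose nu : {measure set (measurableTypeR R) -> \bar R} := image_measure P mX.
  have nu1 : nu setT = 1%E.
    by rewrite /nu image_measureE preimage_setT; exact: probability_setT.
  by exists (HB.pack_for (probability (measurableTypeR R) R) (Measure.sort nu)
    (Measure_isProbability.Build _ _ _ nu nu1)).
have Qmu : Q `<< mu.
  by apply/null_content_dominatesP => A mA A0; rewrite QX; exact: ordstat_law_dominated.
pose h t := fine (Radon_Nikodym_SigmaFinite.f Q mu t).
have hE : EFin \o h = Radon_Nikodym_SigmaFinite.f Q mu.
  by apply/funext => t; rewrite /h /= fineK//; exact: Radon_Nikodym_SigmaFinite.f_fin_num.
have ih : mu.-integrable setT (EFin \o h).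
  by rewrite hE; exact: Radon_Nikodym_SigmaFinite.f_integrable.
have QE A : measurable A -> Q A = (\int[mu]_(t in A) (h t)%:E)%E.
  move=> mA; rewrite (Radon_Nikodym_SigmaFinite.f_integral Qmu)//.
  by apply: eq_integral => t _; rewrite -hE.
have iy y : mu.-integrable `]-oo, y]%classic (EFin \o h) by apply: integrableS ih.
have deltaE : delta i = fun x => (\int[mu]_(t in `]-oo, x]) h t)%R.
  apply/funext => x; apply: EFin_inj; rewrite -oP//.
  rewrite /Rintegral fineK; last first.
    exact: integrable_fin_num (iy x).
  rewrite -QE; last exact: measurable_itv.
  by rewrite QX set_itvE.
have dh : {ae mu, forall t : R, is_derive t 1 (delta i) (h t)}.
  have := @FTC1Ny R h.
  rewrite -deltaE; have lh : locally_integrable setT h.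
    by have := integrable_locally measurableT ih; rewrite patch_setT.
  move=> /(_ iy lh).
  by apply: lebesgue_aeS => x [dx <-]; rewrite derive1E; exact: DeriveDef.
have fh : {ae mu, forall t : R, f i t = h t}.
  by apply: lebesgue_aeS dh => t dt; rewrite derive1E; exact: (@derive_val _ _ _ _ _ _ _ dt).
split; first by apply: lebesgue_aeS2 dh fh => t dt ->.
move=> A mA; rewrite -QX QE//.
apply: ae_eq_integral => //.
- by apply: (measurable_int mu); apply: integrableS ih.
- by apply/measurable_funTS/measurable_EFinP; exact: measurable_multidiag_derive.
- by apply: lebesgue_aeS fh => t + _ => /= ->.
Qed.

Lemma multidiag_is_derive i : (1 <= i <= d)%N ->
  {ae mu, forall t : R, is_derive t 1 (delta i) (f i t)}.
Proof. by move=> /ordstat_law[]. Qed.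

Lemma ge0_integral_ordstat i (phi : R -> \bar R) : (1 <= i <= d)%N ->
  measurable_fun setT phi -> (forall t, (0 <= phi t)%E) ->
  (\int[P]_x phi (X x i) = \int[mu]_t (phi t * (f i t)%:E))%E.
Proof.
move=> id mphi phi0; have [_ PA] := ordstat_law id.
have f1 : (\int[mu]_t (f i t)%:E = 1)%E by rewrite -PA// probability_setT.
have [Q QE] := @density_probability _ (measurableTypeR R) R mu (f i)
  (fun t => multidiag_derive_ge0 t id) (measurable_multidiag_derive id) f1.
rewrite -(ge0_integral_density QE)//.
have mX : measurable_fun setT (fun x : d.-tuple R => X x i : measurableTypeR R).
  exact: measurable_ordstat.
rewrite -(@ge0_integral_image_measure _ _ _ _ _ P _ mX)//.
apply: eq_measure_integral => A mA _.
have [_ _ QA] := QE.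
by transitivity (\int[mu]_(t in A) (f i t)%:E)%E; [exact: PA|exact/esym/QA].
Qed.

Lemma integrable_ordstat i (phi : R -> R) : (1 <= i <= d)%N ->
  measurable_fun setT phi ->
  mu.-integrable setT (fun t => (phi t * f i t)%:E) ->
  P.-integrable setT (fun x => (phi (X x i))%:E) /\
  (\int[P]_x (phi (X x i))%:E = \int[mu]_t (phi t * f i t)%:E)%E.
Proof.
move=> id mphi /integrableP[mphif iphi].
have mEphi : measurable_fun setT (EFin \o phi) by exact/measurable_EFinP.
have mphiX : measurable_fun setT (fun x : d.-tuple R => phi (X x i)).
  exact: (measurableT_comp mphi (@measurable_ordstat R d i)).
split.
  apply/integrableP; split; first exact/measurable_EFinP.
  rewrite (ge0_integral_ordstat (phi := fun t => `|phi t|%:E) id)//; last first.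
    by apply/measurable_EFinP; exact: measurableT_comp.
  apply: le_lt_trans iphi; rewrite le_eqVlt; apply/orP; left; apply/eqP.
  by apply: eq_integral => t _; rewrite /= normrM (ger0_norm (multidiag_derive_ge0 t id)).
rewrite [LHS]integralE [RHS]integralE; congr (_ - _)%E.
  transitivity (\int[P]_x (EFin \o phi)^\+%E (X x i))%E.
    by apply: eq_integral => x _; rewrite !funeposE.
  rewrite ge0_integral_ordstat//; last exact: measurable_funepos.
  apply: eq_integral => t _; rewrite !funeposE -!EFin_max -EFinM; congr (_%:E).
  by rewrite maxr_pMl ?mul0r// multidiag_derive_ge0.
transitivity (\int[P]_x (EFin \o phi)^\-%E (X x i))%E.
  by apply: eq_integral => x _; rewrite !funenegE.
rewrite ge0_integral_ordstat//; last exact: measurable_funeneg.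
apply: eq_integral => t _; rewrite !funenegE -!EFin_max -EFinM; congr (_%:E).
by rewrite maxr_pMl ?mul0r ?mulNr// multidiag_derive_ge0.
Qed.

(** By Tonelli's theorem the weight of [h t] is the probability of [X_(i-1) <= t < X_i], which is
    [delta_(i-1) t - delta_i t]. Although two order statistics are involved jointly, the expectation
    depends on [delta] alone. *)
Lemma ge0_integral_ordstat_gap i (h : R -> R) : (2 <= i <= d)%N ->
  measurable_fun setT h -> (forall t, 0 <= h t) ->
  (\int[P]_x \int[mu]_(t in `[X x i.-1, X x i[) (h t)%:E =
   \int[mu]_t (h t * (delta i.-1 t - delta i t))%:E)%E.
Proof.
move=> id mh h0; have id1 : (1 <= i <= d)%N by lia.
have id2 : (1 <= i.-1 <= d)%N by lia.
have mX j := @measurable_ordstat R d j.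
pose b (t : R) (x : d.-tuple R) := (X x i.-1 <= t) && (t < X x i).
pose F t x : \bar R := (h t * (b t x)%:R)%:E.
have F0 t x : (0 <= F t x)%E by rewrite lee_fin mulr_ge0.
have mF : measurable_fun [set: R * d.-tuple R] (fun z => F z.1 z.2).
  apply/measurable_EFinP/measurable_funM; first exact: measurableT_comp.
  apply: (@measurableT_comp _ _ _ _ _ _ (fun b : bool => b%:R : R) _ (fun z => b z.1 z.2)) => //.
  apply: measurable_and.
    by apply: measurable_fun_ler => //; exact: (measurableT_comp (mX _)).
  by apply: measurable_fun_ltr => //; exact: (measurableT_comp (mX _)).
transitivity (\int[P]_x \int[mu]_t F t x)%E.
  apply: eq_integral => x _; rewrite integral_mkcond; apply: eq_integral => t _.
  rewrite patchE mem_setE in_itv/= /F /b.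
  by case: ifP; rewrite ?mulr1 ?mulr0.
rewrite -(@lebesgue_tonelli _ _ _ P F mF F0); apply: eq_integral => t _.
have bE : [set x | b t x] = [set x | X x i.-1 <= t] `\` [set x | X x i <= t].
  apply/seteqP; split => x /=; rewrite /b.
    by move=> /andP[-> tx]; split => //; apply/negP; rewrite -ltNge.
  by move=> [-> /negP]; rewrite -ltNge.
have mb : measurable [set x | b t x].
  by rewrite bE; apply: measurableD; exact: measurable_ordstat_le.
have Pb : P [set x | b t x] = (delta i.-1 t - delta i t)%:E.
  rewrite bE measureD; [|exact: measurable_ordstat_le..|].
    rewrite setIidr ?EFinB; first by congr (_ - _)%E; exact: oP.
    by move=> x /=; apply: le_trans; apply: ordstat_le; lia.
  by apply: le_lt_trans (ltry (delta i.-1 t)); rewrite -(oP id2).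
transitivity (\int[P]_x ((h t)%:E * (\1_[set x | b t x] x)%:E))%E.
  apply: eq_integral => x _; rewrite /F -EFinM indicE; congr (_ * (nat_of_bool _)%:R)%:E.
  by apply/idP/idP; rewrite inE.
rewrite ge0_integralZl//; last 2 first.
- exact/measurable_EFinP/measurable_indic.
- by rewrite lee_fin.
by rewrite integral_indic// setIT EFinM; congr (_ * _)%E.
Qed.

End multidiagonal.

Lemma measurable_fun_comp2 d1 d2 d3 d4 (T1 : measurableType d1) (T2 : measurableType d2)
    (T3 : measurableType d3) (T4 : measurableType d4) (F : T2 -> T3 -> T4)
    (a : T1 -> T2) (b : T1 -> T3) :
  measurable_fun [set: T2 * T3] (fun z => F z.1 z.2) ->
  measurable_fun setT a -> measurable_fun setT b ->
  measurable_fun setT (fun x => F (a x) (b x)).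
Proof.
by move=> mF ma mb; exact: (measurableT_comp mF (measurable_fun_pair ma mb)).
Qed.

Lemma measurable_nth_tuple (R : realType) n i :
  measurable_fun setT (fun x : n.-tuple R => nth 0 x i).
Proof.
have [id|id] := ltnP i n.
  rewrite (_ : (fun x => _) = (fun x : n.-tuple R => tnth x (Ordinal id))).
    exact: measurable_tnth.
  by apply/funext => x; rewrite (tnth_nth 0).
rewrite (_ : (fun x => _) = cst 0); first exact: measurable_cst.
by apply/funext => x; rewrite nth_default// size_tuple.
Qed.

(** * Densities of inhomogeneous Markov chains *)

Section chain.
Variable R : realType.
Local Notation mu := (@lebesgue_measure R).
Variable k : nat -> R -> R -> R.
Hypothesis k0 : forall j s t, 0 <= k j s t.
Hypothesis mk : forall j, measurable_fun [set: R * R] (fun z => k j z.1 z.2).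

(** The density of a path [x] of a Markov chain in state [s] whose next transition kernel is
    [k j]. *)
Fixpoint chain (j : nat) (s : R) (x : seq R) : R :=
  if x is y :: x' then k j s y * chain j.+1 y x' else 1.

Lemma chain_prod j s x :
  chain j s x = \prod_(i < size x) k (j + i) (nth 0 (s :: x) i) (nth 0 x i).
Proof.
elim: x j s => [|y x IH] j s /=; first by rewrite big_ord0.
rewrite big_ord_recl/= addn0 IH; congr (_ * _); apply: eq_bigr => i _.
by rewrite /= /bump/= add1n addnS.
Qed.

Lemma chain_ge0 j s x : 0 <= chain j s x.
Proof. by elim: x j s => [|y x IH] j s //=; rewrite mulr_ge0. Qed.

Lemma measurable_chain n j :
  measurable_fun [set: R * n.-tuple R] (fun z => chain j z.1 z.2).
Proof.
elim: n j => [|n IH] j.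
  rewrite (_ : (fun z => _) = cst 1); first exact: measurable_cst.
  by apply/funext => -[s x]; rewrite (tuple0 x).
rewrite (_ : (fun z => _) = (fun z : R * n.+1.-tuple R =>
    k j z.1 (thead z.2) * chain j.+1 (thead z.2) [tuple of behead z.2])).
  have mh : measurable_fun [set: R * n.+1.-tuple R] (fun z => thead z.2).
    exact: (measurableT_comp (measurable_tnth _) measurable_snd).
  apply: measurable_funM.
    exact: (measurable_fun_comp2 (mk j)).
  apply: (measurable_fun_comp2 (F := fun s (x : n.-tuple R) => chain j.+1 s x)) => //.
  exact: (measurableT_comp (@measurable_behead _ _ _) measurable_snd).
by apply/funext => -[s x] /=; rewrite {1}(tuple_eta x).
Qed.

Lemma measurable_chainr n j s : measurable_fun setT (fun x : n.-tuple R => chain j s x).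
Proof.
exact: (measurable_fun_comp2 (F := fun s (x : n.-tuple R) => chain j s x)
  (@measurable_chain n j) (measurable_cst s) (@measurable_id _ _ setT)).
Qed.

Lemma integral_chain0 j s : (\int[lebn R 0]_x (chain j s x)%:E = 1)%E.
Proof.
have mc : measurable_fun setT (fun x : 0.-tuple R => (chain j s x)%:E).
  by apply/measurable_EFinP; exact: (@measurable_chainr 0 j s).
by rewrite -leb_intE// => x; rewrite lee_fin chain_ge0.
Qed.

Lemma measurable_kr j s : measurable_fun setT (k j s).
Proof. exact: (measurable_fun_comp2 (mk j) (measurable_cst s)). Qed.

Lemma measurable_kl j t : measurable_fun setT (k j ^~ t).
Proof. exact: (measurable_fun_comp2 (mk j) _ (measurable_cst t)). Qed.

Section chain_step.
Variables (n : nat) (phi : n.-tuple R -> R).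
Hypotheses (phi0 : forall x, 0 <= phi x) (mphi : measurable_fun setT phi).

Lemma measurable_chainM j :
  measurable_fun [set: R * n.-tuple R] (fun z => (chain j z.1 z.2 * phi z.2)%:E).
Proof.
apply/measurable_EFinP/measurable_funM; first exact: measurable_chain.
exact: (measurableT_comp mphi).
Qed.

Lemma measurable_chain_int j :
  measurable_fun setT (fun y => \int[lebn R n]_x (chain j y x * phi x)%:E)%E.
Proof.
apply: (measurable_fun_integral_snd (lebn R n) (measurable_chainM j)) => y x.
by rewrite lee_fin mulr_ge0// chain_ge0.
Qed.

(** Integration over the first coordinate comes last. The test function is a product, so that one
    formula covers an observable of the first coordinate and one of the later coordinates. *)
Lemma integral_chainS j s (psi : R -> R) : (forall y, 0 <= psi y) -> measurable_fun setT psi ->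
  (\int[lebn R n.+1]_x (chain j s x * (psi (thead x) * phi [tuple of behead x]))%:E =
   \int[mu]_y ((k j s y * psi y)%:E * \int[lebn R n]_x (chain j.+1 y x * phi x)%:E))%E.
Proof.
move=> psi0 mpsi; rewrite lebn_recl//; last 2 first.
- by move=> x; rewrite lee_fin !mulr_ge0// chain_ge0.
- apply/measurable_EFinP/measurable_funM.
    exact: measurable_chainr.
  apply: measurable_funM; first exact: (measurableT_comp mpsi (measurable_tnth _)).
  exact: (measurableT_comp mphi (@measurable_behead _ _ _)).
apply: eq_integral => y _; rewrite -ge0_integralZl//.
- apply: eq_integral => x _; rewrite -EFinM; congr (_%:E); rewrite theadE /=.
  have -> : [tuple of behead [tuple of y :: x]] = x :> n.-tuple R by exact/val_inj.
  by ring.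
- exact: (measurable_fun_comp2 (F := fun y (x : n.-tuple R) => (chain j.+1 y x * phi x)%:E)
    (measurable_chainM j.+1) (measurable_cst y) (@measurable_id _ _ setT)).
- by move=> x _; rewrite lee_fin mulr_ge0// chain_ge0.
- by rewrite lee_fin mulr_ge0.
Qed.

End chain_step.

Lemma chain_mass_le n j s : (forall j s, (\int[mu]_t (k j s t)%:E <= 1)%E) ->
  (\int[lebn R n]_x (chain j s x)%:E <= 1)%E.
Proof.
move=> k1; elim: n j s => [|n IH] j s.
  by rewrite integral_chain0.
have := @integral_chainS n (cst 1) ltac:(by []) ltac:(exact: measurable_cst) j s (cst 1)
  ltac:(by []) ltac:(exact: measurable_cst).
under eq_integral do rewrite /= !mulr1.
move=> ->; apply: le_trans (k1 j s).
apply: ge0_le_integral => //.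
- move=> y _; rewrite mule_ge0 ?lee_fin ?mulr1//.
  by apply: integral_ge0 => x _; rewrite lee_fin mulr1 chain_ge0.
- apply: emeasurable_funM; last exact: (@measurable_chain_int n (cst 1)).
  apply/measurable_EFinP; under eq_fun do rewrite mulr1; exact: measurable_kr.
- by apply/measurable_EFinP; exact: measurable_kr.
- move=> y _; rewrite mulr1; under eq_integral do rewrite /= mulr1.
  by rewrite -[leRHS]mule1 lee_wpmul2l// lee_fin.
Qed.

Section chain_marginal.
Variables (d : nat) (p : nat -> R -> R) (S : nat -> set R).
Hypothesis k_mass : forall j s, (0 < j < d)%N -> S j s -> (\int[mu]_t (k j.+1 s t)%:E = 1)%E.
Hypothesis k_supp : forall j s t, (0 < j <= d)%N -> k j s t != 0 -> S j t.
Hypothesis p0 : forall j t, 0 <= p j t.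
Hypothesis mp : forall j, measurable_fun setT (p j).
Hypothesis p_fwd : forall j t, (0 < j < d)%N ->
  (\int[mu]_s (p j s * k j.+1 s t)%:E = (p j.+1 t)%:E)%E.
Hypothesis k_start : forall s t, k 1 s t = p 1 t.

(** [S j] holds the states at time [j] from which the next kernel has full mass. By [k_supp] a
    transition of positive density leads into the next such set, so no mass is lost along the
    path. *)
Lemma chain_mass_eq n j s : (0 < j)%N -> (j + n <= d)%N -> S j s ->
  (\int[lebn R n]_x (chain j.+1 s x)%:E = 1)%E.
Proof.
elim: n j s => [|n IH] j s j0 jd Sj.
  by rewrite integral_chain0.
have := @integral_chainS n (cst 1) ltac:(by []) ltac:(exact: measurable_cst) j.+1 s (cst 1)
  ltac:(by []) ltac:(exact: measurable_cst).
under eq_integral do rewrite /= !mulr1.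
move=> ->; rewrite -(@k_mass j s)//; last lia.
apply: eq_integral => y _; rewrite mulr1; under eq_integral do rewrite /= mulr1.
have [->|ky] := eqVneq (k j.+1 s y) 0; first by rewrite mul0e.
by rewrite IH ?mule1//; [lia|apply: k_supp ky; lia].
Qed.

(** Tonelli's theorem turns the pointwise forward equation [p_fwd] into its form tested against
    [G]. *)
Lemma p_fwd_integral j (G : R -> \bar R) : (0 < j < d)%N ->
  measurable_fun setT G -> (forall y, (0 <= G y)%E) ->
  (\int[mu]_s ((p j s)%:E * \int[mu]_y ((k j.+1 s y)%:E * G y)) =
   \int[mu]_y ((p j.+1 y)%:E * G y))%E.
Proof.
move=> jd mG G0.
have mkG s : measurable_fun setT (fun y => (k j.+1 s y)%:E * G y)%E.
  by apply: emeasurable_funM => //; apply/measurable_EFinP; exact: measurable_kr.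
transitivity (\int[mu]_s \int[mu]_y ((p j s * k j.+1 s y)%:E * G y))%E.
  apply: eq_integral => s _; rewrite -ge0_integralZl//.
  - by apply: eq_integral => y _; rewrite muleA.
  - exact: mkG.
  - by move=> y _; rewrite mule_ge0// lee_fin.
  - by rewrite lee_fin.
rewrite lebesgue_tonelliR; last 2 first.
- apply: emeasurable_funM; last exact: (measurableT_comp mG measurable_snd).
  apply/measurable_EFinP/measurable_funM; last exact: mk.
  exact: (measurableT_comp (mp j) measurable_fst).
- by move=> s y; rewrite mule_ge0// lee_fin mulr_ge0.
apply: eq_integral => y _; rewrite ge0_integralZr//.
- by rewrite p_fwd.
- by apply/measurable_EFinP/measurable_funM; [exact: mp|exact: measurable_kl].
- by move=> s _; rewrite lee_fin mulr_ge0.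
Qed.

(** For the first coordinate the rest of the path integrates to [1]; for a later one, the forward
    equation replaces [p j] by [p j.+1] and the path loses a coordinate. *)
Lemma chain_marginal_from n i j (phi : R -> R) : (forall y, 0 <= phi y) ->
  measurable_fun setT phi -> (0 < j)%N -> (i < n)%N -> (j + n <= d)%N ->
  (\int[mu]_s ((p j s)%:E * \int[lebn R n]_x (chain j.+1 s x * phi (nth 0 x i))%:E) =
   \int[mu]_t (p (j.+1 + i) t * phi t)%:E)%E.
Proof.
move=> phi0 mphi; elim: n i j => [//|n IH] i j j0 iltn jd.
case: i iltn => [|i] iltn.
  rewrite addn0.
  have E s : (\int[lebn R n.+1]_x (chain j.+1 s x * phi (nth 0 x 0))%:E =
      \int[mu]_y ((k j.+1 s y)%:E * (phi y)%:E))%E.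
    have := @integral_chainS n (cst 1) ltac:(by []) ltac:(exact: measurable_cst) j.+1 s phi phi0 mphi.
    under eq_integral => x _.
      rewrite mulr1 (_ : thead x = nth 0 x 0); last by rewrite /thead (tnth_nth 0).
      over.
    move=> ->; apply: eq_integral => y _; rewrite -EFinM.
    have [->|ky] := eqVneq (k j.+1 s y) 0; first by rewrite !mul0r mul0e.
    under eq_integral do rewrite /= mulr1.
    by rewrite (chain_mass_eq (j := j.+1)) ?mule1//; [lia|apply: k_supp ky; lia].
  under eq_integral do rewrite E.
  by rewrite (@p_fwd_integral j (EFin \o phi))//; [lia|exact/measurable_EFinP].
pose psi (x : n.-tuple R) := phi (nth 0 x i).
have mpsi : measurable_fun setT psi.
  exact: (measurableT_comp mphi (@measurable_nth_tuple R n i)).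
have E s : (\int[lebn R n.+1]_x (chain j.+1 s x * phi (nth 0 x i.+1))%:E =
    \int[mu]_y ((k j.+1 s y)%:E * \int[lebn R n]_x (chain j.+2 y x * psi x)%:E))%E.
  have := @integral_chainS n psi (fun x => phi0 _) mpsi j.+1 s (cst 1) ltac:(by []) ltac:(exact: measurable_cst).
  under eq_integral => x _.
    rewrite /= mul1r /psi /= nth_behead.
    over.
  by move=> ->; apply: eq_integral => y _; rewrite mulr1.
under eq_integral do rewrite E.
have jd' : (0 < j < d)%N by lia.
rewrite (p_fwd_integral jd' (measurable_chain_int (fun x => phi0 _) mpsi j.+2)); last first.
  by move=> y; apply: integral_ge0 => x _; rewrite lee_fin mulr_ge0// chain_ge0.
by rewrite IH//; [rewrite addnS|lia].
Qed.

(** By [k_start] the state [s] before the first step is a dummy: the chain starts afresh with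
    density [p 1]. *)
Lemma chain_marginal n i s (phi : R -> R) : (forall y, 0 <= phi y) ->
  measurable_fun setT phi -> (i < n <= d)%N ->
  (\int[lebn R n]_x (chain 1 s x * phi (nth 0 x i))%:E =
   \int[mu]_t (p i.+1 t * phi t)%:E)%E.
Proof.
move=> phi0 mphi.
case: n => [|n] iltn; first by lia.
case: i iltn => [|i] iltn.
  have := @integral_chainS n (cst 1) ltac:(by []) ltac:(exact: measurable_cst) 1 s phi phi0 mphi.
  under eq_integral => x _.
    rewrite mulr1 (_ : thead x = nth 0 x 0); last by rewrite /thead (tnth_nth 0).
    over.
  move=> ->; apply: eq_integral => y _; rewrite k_start.
  have [->|ky] := eqVneq (p 1 y) 0; first by rewrite !mul0r mul0e.
  under eq_integral do rewrite /= mulr1.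
  have Sy : S 1 y by apply: (@k_supp _ s); [lia|rewrite k_start].
  by rewrite (chain_mass_eq (j := 1) _ _ Sy) ?mule1//; lia.
pose psi (x : n.-tuple R) := phi (nth 0 x i).
have mpsi : measurable_fun setT psi.
  exact: (measurableT_comp mphi (@measurable_nth_tuple R n i)).
have := @integral_chainS n psi (fun x => phi0 _) mpsi 1 s (cst 1) ltac:(by []) ltac:(exact: measurable_cst).
under eq_integral => x _.
  rewrite /= mul1r /psi /= nth_behead.
  over.
move=> ->; under eq_integral do rewrite k_start mulr1.
by rewrite chain_marginal_from//; lia.
Qed.

End chain_marginal.
End chain.

(** * Logarithmic inequalities and hazard rates *)

Section elementary.
Variable R : realType.
Local Notation mu := (@lebesgue_measure R).

Lemma ln_le_subr1 (x : R) : 0 < x -> ln x <= x - 1.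
Proof. by move=> x0; have := expR_ge1Dx (ln x); rewrite lnK//; lra. Qed.

Lemma ln_lt_subr1 (x : R) : 0 < x -> x != 1 -> ln x < x - 1.
Proof.
move=> x0 x1; have l0 : ln x != 0 by rewrite ln_eq0.
by have := expR_gt1Dx l0; rewrite lnK//; lra.
Qed.

(** This is [ln y <= y - 1] at [y = m / c], multiplied by [c]. The value [0 * ln 0 = 0] covers
    [c = 0]. *)
Lemma gibbs_pointwise (c m : R) : 0 <= c -> 0 < m ->
  c * ln m + c - m <= c * ln c.
Proof.
move=> c0 m0; have [->|cn0] := eqVneq c 0; first by rewrite !mul0r; lra.
have {}c0 : 0 < c by rewrite lt_neqAle eq_sym cn0.
have := @ln_le_subr1 (m / c); rewrite divr_gt0// => /(_ isT).
rewrite ln_div// => H.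
have : c * (ln m - ln c) <= c * (m / c - 1) by rewrite ler_pM2l.
by rewrite [c * (m / c - 1)]mulrBr mulr1 [c * (m / c)]mulrC divfK// mulrBr; lra.
Qed.

Lemma gibbs_pointwise_eq (c m : R) : 0 <= c -> 0 < m ->
  c * ln m + c - m = c * ln c -> c = m.
Proof.
move=> c0 m0; have [->|cn0] := eqVneq c 0; first by rewrite !mul0r; lra.
have {}c0 : 0 < c by rewrite lt_neqAle eq_sym cn0.
move=> cm; apply: contrapT => ncm.
have := @ln_lt_subr1 (m / c); rewrite divr_gt0// => /(_ isT).
have -> : m / c != 1.
  by apply: contra_notN ncm => /eqP mc1; rewrite -[c]mul1r -mc1 divfK.
move=> /(_ isT); rewrite ln_div// => H.
have : c * (ln m - ln c) < c * (m / c - 1) by rewrite ltr_pM2l.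
by rewrite [c * (m / c - 1)]mulrBr mulr1 [c * (m / c)]mulrC divfK// mulrBr; lra.
Qed.

Lemma xlnx_ge (x : R) : 0 <= x -> -1 <= x * ln x.
Proof. by move=> x0; have := @gibbs_pointwise x 1 x0 ltr01; rewrite ln1; lra. Qed.

Lemma xlnx_le (x M : R) : 0 <= x <= M -> x * ln x <= M ^+ 2.
Proof.
move=> /andP[x0 xM]; have [->|xn0] := eqVneq x 0; first by rewrite mul0r sqr_ge0.
have {}x0 : 0 < x by rewrite lt_neqAle eq_sym xn0.
have := ln_le_subr1 x0 => H.
have : x * ln x <= x * x by rewrite ler_pM2l//; lra.
move/le_trans; apply; rewrite expr2 ler_pM// ltW//.
Qed.

End elementary.

Section hazard.
Variable R : realType.
Local Notation mu := (@lebesgue_measure R).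
Variable h : R -> R.
Hypotheses (h0 : forall t, 0 <= h t) (mh : measurable_fun setT h).

(** A real number even when the integral diverges, in which case it is [0]. Later uses therefore
    bound [h] on the segment or prove the integral finite almost surely. *)
Definition cumul (s t : R) : R := (\int[mu]_(r in `[s, t]) h r)%R.

Lemma cumul_ge0 s t : 0 <= cumul s t.
Proof. by apply: Rintegral_ge0. Qed.

Lemma measurable_cumulE :
  measurable_fun [set: R * R] (fun z => \int[mu]_(r in `[z.1, z.2]) (h r)%:E)%E.
Proof.
pose F (r : R) (z : R * R) : \bar R := (h r * ((z.1 <= r) && (r <= z.2))%:R)%:E.
have mF : measurable_fun [set: R * (R * R)] (fun w => F w.1 w.2).
  apply/measurable_EFinP/measurable_funM; first exact: measurableT_comp.
  apply: (@measurableT_comp _ _ _ _ _ _ (fun b : bool => b%:R : R) _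
    (fun w : R * (R * R) => (w.2.1 <= w.1) && (w.1 <= w.2.2))) => //.
  apply: measurable_and; apply: measurable_fun_ler => //.
  - exact: (measurableT_comp measurable_fst measurable_snd).
  - exact: (measurableT_comp measurable_snd measurable_snd).
have F0 r z : (0 <= F r z)%E by rewrite lee_fin mulr_ge0.
have := measurable_fun_integral_fst mF F0.
rewrite (_ : (fun z => \int[mu]_(r in `[z.1, z.2]) _)%E = (fun z => \int[mu]_r F r z)%E)//.
apply/funext => -[s t].
rewrite integral_mkcond; apply: eq_integral => r _.
by rewrite patchE mem_setE in_itv/= /F/=; case: ifP; rewrite ?mulr1 ?mulr0.
Qed.

Lemma measurable_cumul : measurable_fun [set: R * R] (fun z => cumul z.1 z.2).
Proof. by apply: (measurableT_comp _ measurable_cumulE). Qed.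

(** [expR (- cumul h s t)] is the survival function for the rate [h]. It arises from the linear
    equation with constant solution [1] and coefficient [- h]. *)
Lemma integral_hazard (s t M : R) : s < t -> (forall r, s <= r <= t -> h r <= M) ->
  (\int[mu]_(r in `[s, t]) (h r * expR (- cumul s r))%:E = (1 - expR (- cumul s t))%:E)%E.
Proof.
move=> st hM.
have cumN r : (\int[mu]_(x in `[s, r]) - h x)%R = - cumul s r.
  by rewrite /cumul /Rintegral -fineN -integral_ge0N// => x _; rewrite lee_fin.
have L0 (x y : R) : `|cst 1 x - cst 1 y : R| <= 0 * `|x - y| by rewrite subrr normr0 mul0r.
have B1 (x : R) : `|cst 1 x : R| <= 1 by rewrite normr1.
have d0 : {ae mu, forall x : R, is_derive x 1 (cst 1 : R -> R) (cst 0 x)}.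
  by apply: aeW => x; exact: is_derive_cst.
have hM' x : s <= x <= t -> `|- h x| <= M by move=> xst; rewrite normrN ger0_norm// hM.
have := linear_ode_integral st L0 B1 (measurable_cst (0 : R)) d0 (measurable_funN mh) hM'.
under eq_integral do rewrite cumN add0r mul1r mulNr EFinN.
rewrite integral_ge0N; last by move=> r _; rewrite lee_fin mulr_ge0// expR_ge0.
by rewrite cumN mul1r => /(congr1 -%E); rewrite oppeK -EFinN opprB.
Qed.

End hazard.

Lemma ae_le_integral d (T : measurableType d) (R : realType)
    (m : {measure set T -> \bar R}) (f g : T -> R) :
  m.-integrable setT (EFin \o f) -> m.-integrable setT (EFin \o g) ->
  {ae m, forall x, f x <= g x} -> (\int[m]_x (f x)%:E <= \int[m]_x (g x)%:E)%E.
Proof.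
move=> If Ig fg.
have mgf : measurable_fun setT (fun x => g x - f x).
  apply: measurable_funB; apply/measurable_EFinP.
    exact: measurable_int Ig.
  exact: measurable_int If.
have : (0 <= \int[m]_x (g x - f x)%:E)%E.
  rewrite (@ae_eq_integral _ _ _ _ _ (fun x => `|g x - f x|%:E))//.
  - exact: integral_ge0.
  - exact/measurable_EFinP.
  - by apply/measurable_EFinP; exact: measurableT_comp.
  - by apply: filterS fg => x fgx _; rewrite ger0_norm// subr_ge0.
under eq_integral do rewrite EFinB.
by rewrite integralB_EFin// sube_ge0// (integrable_fin_num measurableT If).
Qed.

(** * Entropy and Gibbs' inequality *)

Section gibbs.
Variables (R : realType) (d : nat) (P : probability (d.-tuple R) R).
Variables c : d.-tuple R -> R.
Local Notation lam := (lebn R d).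
Hypothesis Pc : has_density lam P c.
Hypothesis Pcube : P (cube R d) = 1%E.

Lemma cubeE : cube R d = box (fun _ => `[0, 1]%classic).
Proof. by apply/seteqP; split => x xc j; have := xc j; rewrite /= in_itv. Qed.

Lemma measurable_cube : measurable (cube R d).
Proof. by rewrite cubeE; exact: measurable_box. Qed.

Lemma lebn_cube : (lam : {measure set _ -> \bar R}) (cube R d) = 1%E.
Proof.
rewrite cubeE lebn_box//; apply: big1 => i _.
by rewrite lebesgue_measure_itv/= lte_fin ltr01 -EFinB subr0.
Qed.

Let c0 x : 0 <= c x. Proof. by case: Pc. Qed.
Let mc : measurable_fun setT c. Proof. by case: Pc. Qed.

Lemma measurable_xlnx : measurable_fun setT (fun x => c x * ln (c x)).
Proof. by apply: measurable_funM => //; exact: (measurableT_comp (@measurable_ln R)). Qed.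

Lemma density_null A : measurable A -> P A = 0%E -> {ae lam, forall x, A x -> c x = 0}.
Proof.
move=> mA PA; have [_ _ PE] := Pc; move: PA; rewrite PE// => intA.
have : ae_eq lam A (EFin \o c) (cst 0%E).
  apply/(ae_eq_integral_abs _ mA _).1.
    exact/measurable_funTS/measurable_EFinP.
  rewrite -[RHS]intA; apply: eq_integral => x _.
  by rewrite /= ger0_norm.
by apply: filterS => x + Ax => /(_ Ax)[].
Qed.

Lemma density_out_cube : {ae lam, forall x, ~ cube R d x -> c x = 0}.
Proof.
apply: (@density_null (~` cube R d)); first by apply: measurableC; exact: measurable_cube.
by rewrite probability_setC ?Pcube ?subee//; exact: measurable_cube.
Qed.

Definition entfun (x : d.-tuple R) : R := \1_(cube R d) x * (c x * ln (c x)).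

Lemma measurable_entfun : measurable_fun setT entfun.
Proof.
apply: measurable_funM; last exact: measurable_xlnx.
by apply: measurable_indic; exact: measurable_cube.
Qed.

Lemma ent_of_funeposneg :
  ent_of R d c = (- (\int[lam]_x (EFin \o entfun)^\+ x) + \int[lam]_x (EFin \o entfun)^\- x)%E.
Proof.
rewrite /ent_of; congr (- _ + _)%E; rewrite leb_intE.
- apply: eq_integral => x _; rewrite funeposE -EFin_max; congr EFin; rewrite /entfun.
  by rewrite indicE; case: (_ \in _); rewrite ?mul1r// !mul0r maxxx.
- by move=> x; rewrite lee_fin mulr_ge0// le_max lexx orbT.
- apply/measurable_EFinP/measurable_funM.
    by apply: measurable_indic; exact: measurable_cube.
  by apply: measurable_maxr => //; exact: measurable_xlnx.
- apply: eq_integral => x _; rewrite funenegE -EFinN -EFin_max; congr EFin; rewrite /entfun.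
  by rewrite indicE; case: (_ \in _); rewrite ?mul1r// !mul0r oppr0 maxxx.
- by move=> x; rewrite lee_fin mulr_ge0// le_max lexx orbT.
- apply/measurable_EFinP/measurable_funM.
    by apply: measurable_indic; exact: measurable_cube.
  by apply: measurable_maxr => //; apply: measurable_funN; exact: measurable_xlnx.
Qed.

(** [x ln x >= -1], and the cube has volume [1]. The entropy thus never has the form [oo - oo] and
    is bounded above. *)
Lemma integral_entfun_neg : (\int[lam]_x (EFin \o entfun)^\- x <= 1)%E.
Proof.
have mI : measurable_fun setT (fun x => (\1_(cube R d) x)%:E : \bar R).
  by apply/measurable_EFinP/measurable_indic; exact: measurable_cube.
apply: (@le_trans _ _ (\int[lam]_x (\1_(cube R d) x)%:E)%E).
  apply: ge0_le_integral => //.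
    by apply: measurable_funeneg; apply/measurable_EFinP; exact: measurable_entfun.
  move=> x _; rewrite funenegE -EFinN -EFin_max lee_fin ge_max; apply/andP; split => //.
  rewrite /entfun indicE; case: (_ \in _); rewrite ?mul0r ?oppr0// mul1r.
  by rewrite lerNl xlnx_ge.
rewrite integral_indic//; last exact: measurable_cube.
by rewrite setIT lebn_cube.
Qed.

Lemma ent_of_integrable : lam.-integrable setT (EFin \o entfun) ->
  ent_of R d c = (- \int[lam]_x (entfun x)%:E)%E.
Proof.
move=> ie; rewrite ent_of_funeposneg [in RHS]integralE.
rewrite fin_num_oppeB ?oppeK//.
by apply: integrable_neg_fin_num.
Qed.

Lemma ent_of_Ny : ~ lam.-integrable setT (EFin \o entfun) -> ent_of R d c = -oo%E.
Proof.
move=> nie; rewrite ent_of_funeposneg.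
have mE : measurable_fun setT (EFin \o entfun) by apply/measurable_EFinP; exact: measurable_entfun.
have neg1 := integral_entfun_neg.
suff -> : (\int[lam]_x (EFin \o entfun)^\+ x = +oo)%E by rewrite addNye.
apply: contrapT => /eqP; rewrite -ltey => pos1; apply: nie; apply/integrableP; split => //.
rewrite (eq_integral (fun x => (EFin \o entfun)^\+ x + (EFin \o entfun)^\- x)%E); last first.
  by move=> x _; rewrite -[LHS]/((abse \o (EFin \o entfun)) x) fune_abse.
rewrite ge0_integralD//; first by rewrite lte_add_pinfty// (le_lt_trans neg1 (ltry _)).
- exact: measurable_funepos.
- exact: measurable_funeneg.
Qed.

(** Integrating the pointwise inequality leaves the excess of the mass of [c] over that of [g],
    which is nonnegative. The logarithm of [g] is replaced by [ell] only where [c] does not vanish,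
    up to a null set, so [ell] may be any convenient expression elsewhere. *)
Lemma gibbs_upper (g ell : d.-tuple R -> R) :
  (forall x, 0 <= g x) -> measurable_fun setT g -> (\int[lam]_x (g x)%:E <= 1)%E ->
  {ae lam, forall x, c x != 0 -> 0 < g x /\ ln (g x) = ell x} ->
  P.-integrable setT (EFin \o ell) ->
  (ent_of R d c <= - \int[P]_x (ell x)%:E)%E.
Proof.
move=> g0 mg g1 cg iell.
have [ie|/ent_of_Ny ->] := pselect (lam.-integrable setT (EFin \o entfun)); last exact: leNye.
rewrite ent_of_integrable// leeN2 (integral_density Pc iell).
have iec := integrable_density Pc iell.
have ic := has_density_integrable Pc.
have ig : lam.-integrable setT (EFin \o g).
  apply/integrableP; split; first exact/measurable_EFinP.
  apply: (le_lt_trans _ (ltry 1)); apply: le_trans g1.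
  by rewrite le_eqVlt; apply/orP; left; apply/eqP/eq_integral => x _ /=; rewrite ger0_norm.
apply: (@le_trans _ _ (\int[lam]_x (ell x * c x + (c x - g x))%:E)%E).
  under [leRHS]eq_integral do rewrite EFinD.
  rewrite integralD_EFin//; last exact: (integrableB measurableT ic ig).
  apply: leeDl; rewrite (eq_integral (fun x => (c x)%:E - (g x)%:E)%E)//.
  rewrite integralB_EFin// sube_ge0 ?(has_density_integral Pc)//.
  by rewrite (integrable_fin_num measurableT ig).
apply: ae_le_integral => //.
  apply: (integrableD measurableT iec (integrableB measurableT ic ig)).
apply: filterS2 cg density_out_cube => x cg out.
have [cx0|cxn0] := eqVneq (c x) 0.
  by rewrite /entfun cx0 !mul0r !mulr0; have := g0 x; lra.
have [gx <-] := cg cxn0.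
have cx : cube R d x by apply: contrapT => /out/eqP; apply/negP.
rewrite /entfun indicE mem_set// mul1r.
by have := gibbs_pointwise (c0 x) gx; lra.
Qed.

Lemma ent_of_eq (ell : d.-tuple R -> R) :
  (forall x, c x != 0 -> cube R d x /\ ln (c x) = ell x) ->
  P.-integrable setT (EFin \o ell) ->
  lam.-integrable setT (EFin \o entfun) /\ ent_of R d c = (- \int[P]_x (ell x)%:E)%E.
Proof.
move=> cell iell.
have eE : entfun = fun x => ell x * c x.
  apply/funext => x; rewrite /entfun; have [->|cx] := eqVneq (c x) 0.
    by rewrite !mul0r !mulr0.
  by have [cu ->] := cell _ cx; rewrite indicE mem_set// mul1r mulrC.
have ie : lam.-integrable setT (EFin \o entfun).
  by rewrite eE; exact: (integrable_density Pc iell).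
by split => //; rewrite ent_of_integrable// (integral_density Pc iell) eE.
Qed.

End gibbs.

Section expects.
Context (disp : measure_display) (T : measurableType disp) (R : realType).
Variable P : probability T R.

(** Integrability is bundled with the value so that finite sums can be computed in [R]. *)
Definition expects (g : T -> R) (a : R) : Prop :=
  P.-integrable setT (EFin \o g) /\ (\int[P]_x (g x)%:E = a%:E)%E.

Lemma expects_cst a : expects (cst a) a.
Proof.
split; first exact: finite_measure_integrable_cst.
by rewrite (integral_cst P measurableT a%:E) [X in (_ * X)%E]probability_setT mule1.
Qed.

Lemma expectsD g1 g2 a1 a2 : expects g1 a1 -> expects g2 a2 ->
  expects (fun x => g1 x + g2 x) (a1 + a2).
Proof.
move=> [i1 e1] [i2 e2]; split; first exact: (integrableD measurableT i1 i2).
under eq_integral do rewrite EFinD.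
by rewrite (integralD_EFin measurableT i1 i2) e1 e2 EFinD.
Qed.

Lemma expectsN g a : expects g a -> expects (fun x => - g x) (- a).
Proof.
move=> [ig eg]; split; first exact: (integrableN ig).
under eq_integral do rewrite EFinN.
by rewrite (integralN (integrable_add_def measurableT ig)) eg.
Qed.

Lemma expects_sum (F : nat -> T -> R) (a : nat -> R) m n :
  (forall i, (m <= i < n)%N -> expects (F i) (a i)) ->
  expects (fun x => \sum_(m <= i < n) F i x) (\sum_(m <= i < n) a i).
Proof.
elim: n => [|n IH] Fa.
  rewrite big_geq// (_ : (fun x => _) = cst 0); first exact: expects_cst.
  by apply/funext => x; rewrite big_geq.
have [mn|nm] := leqP m n; last first.
  rewrite big_geq// (_ : (fun x => _) = cst 0); first exact: expects_cst.
  by apply/funext => x; rewrite big_geq.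
rewrite big_nat_recr//= (_ : (fun x => _) = fun x => \sum_(m <= i < n) F i x + F n x).
  by apply: expectsD; [apply: IH => i ?; apply: Fa; lia|apply: Fa; lia].
by apply/funext => x; rewrite big_nat_recr.
Qed.

End expects.

Lemma ln_prod_nat (R : realType) (F : nat -> R) m n :
  (forall i, (m <= i < n)%N -> 0 < F i) ->
  0 < \prod_(m <= i < n) F i /\ ln (\prod_(m <= i < n) F i) = \sum_(m <= i < n) ln (F i).
Proof.
elim: n => [|n IH] F0; first by rewrite !big_geq// ln1.
have [mn|nm] := leqP m n; last by rewrite !big_geq// ln1.
rewrite !big_nat_recr//=; have [|p0 pE] := IH; first by move=> i ?; apply: F0; lia.
have Fn : 0 < F n by apply: F0; lia.
by split; [exact: mulr_gt0|rewrite lnM ?posrE// pE].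
Qed.

Lemma measurable_natr_bool (R : realType) disp (T : measurableType disp) (b : T -> bool) :
  measurable_fun setT b -> measurable_fun setT (fun x => (b x)%:R : R).
Proof. by move=> mb; exact: (@measurableT_comp _ _ _ _ _ _ (fun b : bool => b%:R : R) _ b). Qed.

(** Off the zeros of [g] the inverse is [expR (- ln g)]; at the zeros the convention [0^-1 = 0]
    agrees with the vanishing indicator. *)
Lemma measurable_funV_ge0 (R : realType) disp (T : measurableType disp) (g : T -> R) :
  (forall x, 0 <= g x) -> measurable_fun setT g -> measurable_fun setT (fun x => (g x)^-1).
Proof.
move=> g0 mg; rewrite (_ : (fun x => _) = fun x => (0 < g x)%R%:R * expR (- ln (g x))).
  apply: measurable_funM; first by apply/measurable_natr_bool/measurable_fun_ltr.
  apply: (measurableT_comp (@measurable_expR R)); apply: measurable_funN.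
  exact: (measurableT_comp (@measurable_ln R)).
apply/funext => x; have := g0 x; rewrite le_eqVlt => /predU1P[<-|gx].
  by rewrite ltxx mul0r invr0.
by rewrite gx mul1r expRN lnK.
Qed.

Lemma integrable_bounded_unitI (R : realType) (g : R -> R) (C : R) :
  measurable_fun setT g -> (forall t, `|g t| <= C) -> (forall t, ~ unitI R t -> g t = 0) ->
  (@lebesgue_measure R).-integrable setT (EFin \o g).
Proof.
move=> mg gC gout.
have uE : unitI R = `[0, 1]%classic by apply/seteqP; split => x /=; rewrite in_itv.
have mu1 : measurable (unitI R) by rewrite uE; exact: measurable_itv.
apply: (@le_integrable _ _ _ (@lebesgue_measure R) setT measurableT _ (fun t => C%:E * (\1_(unitI R) t)%:E)%E).
- exact/measurable_EFinP.
- move=> t _; rewrite -EFinM !abse_EFin lee_fin indicE.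
  have [/set_mem ut|/negP nt] := boolP (t \in unitI R).
    by rewrite mulr1 (le_trans (gC t))// ler_norm.
  by rewrite gout ?normr0// => ut; apply: nt; rewrite inE.
- apply: integrableZl => //; apply/integrableP; split.
    by apply/measurable_EFinP; exact: measurable_indic.
  under eq_integral do rewrite gee0_abs ?lee_fin//.
  rewrite integral_indic// setIT uE /= lebesgue_measure_itv/= lte_fin ltr01.
  by rewrite -EFinB ltry.
Qed.

(** * Transition kernels and log-likelihood of a multidiagonal *)

Section likelihood.
Variables (R : realType) (d : nat) (delta : nat -> R -> R).
Local Notation mu := (@lebesgue_measure R).
Local Notation X := (ordstat R d).
Local Notation f i := (derive1 (delta i)).

(** One definition for both uses: [e > 0] gives the truncation, and [e = 0] gives the exact
    difference, which is nonnegative for a multidiagonal. *)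
Definition gap (e : R) i t : R := Num.max (delta i.-1 t - delta i t) e.

Definition haz e i t : R := f i t / gap e i t.

(** [W] is a mask on transitions: always true in the upper bound, and the support of [c_delta] when
    that density is rebuilt as a chain. *)
Definition kern e (W : nat -> R -> R -> bool) j s t : R :=
  ((1 <= j <= d)%N && W j s t)%:R *
  (if j == 1%N then f 1 t
   else (s <= t)%R%:R * (haz e j t * expR (- cumul (haz e j) s t))).

Definition loglik e (x : d.-tuple R) : R :=
  - ln (d`!%:R) + \sum_(1 <= i < d.+1) ln (f i (X x i))
  - \sum_(2 <= i < d.+1) (ln (gap e i (X x i)) + cumul (haz e i) (X x i.-1) (X x i)).

Definition mean_loglik e : R :=
  - ln (d`!%:R) + \sum_(1 <= i < d.+1) (\int[mu]_t (ln (f i t) * f i t))%R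
  - \sum_(2 <= i < d.+1) ((\int[mu]_t (ln (gap e i t) * f i t))%R
      + (\int[mu]_t (haz e i t * (delta i.-1 t - delta i t)))%R).

(** The index [1] is set apart because [X x 0] would read as the first order statistic, [0.-1] being
    [0]; the chain instead receives the dummy start [0]. *)
Lemma chain_sortt (k : nat -> R -> R -> R) (x : d.-tuple R) :
  chain k 1 0 (sortt x) =
  \prod_(1 <= i < d.+1) k i (if i == 1%N then 0 else X x i.-1) (X x i).
Proof.
rewrite chain_prod size_tuple big_add1/= big_mkord; apply: eq_bigr => i _.
by rewrite add1n; congr (k _ _ _); case: i => -[].
Qed.

Variable P : probability (d.-tuple R) R.
Hypothesis Pd : realizes delta P.

Lemma gap_ge0 e i t : (2 <= i <= d)%N -> 0 <= gap e i t.
Proof. by move=> id; rewrite le_max subr_ge0 (multidiag_decr Pd). Qed.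

Lemma haz_ge0 e i t : (2 <= i <= d)%N -> 0 <= haz e i t.
Proof.
by move=> id; rewrite divr_ge0 ?gap_ge0// (multidiag_derive_ge0 Pd)//; lia.
Qed.

Lemma measurable_gap e i : (2 <= i <= d)%N -> measurable_fun setT (gap e i).
Proof.
move=> id; apply: measurable_maxr => //.
by apply: measurable_funB; apply: (measurable_multidiag Pd); lia.
Qed.

Lemma measurable_haz e i : (2 <= i <= d)%N -> measurable_fun setT (haz e i).
Proof.
move=> id; apply: measurable_funM; first by apply: (measurable_multidiag_derive Pd); lia.
by apply: measurable_funV_ge0 => [t|]; [exact: gap_ge0|exact: measurable_gap].
Qed.

Lemma kern_ge0 e W j s t : 0 <= kern e W j s t.
Proof.
rewrite /kern; have [j1|] := boolP (1 <= j <= d)%N; last by rewrite mul0r.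
rewrite mulr_ge0//; case: eqP => [_|j2]; first by rewrite (multidiag_derive_ge0 Pd)//; lia.
by rewrite mulr_ge0// mulr_ge0 ?expR_ge0// haz_ge0//; lia.
Qed.

Lemma measurable_kern e W j : measurable_fun [set: R * R] (fun z => W j z.1 z.2) ->
  measurable_fun [set: R * R] (fun z => kern e W j z.1 z.2).
Proof.
move=> mW; rewrite /kern; have [j1|] := boolP (1 <= j <= d)%N; last first.
  by move=> _ /=; under eq_fun do rewrite mul0r; exact: measurable_cst.
apply: measurable_funM; first exact: measurable_natr_bool.
case: eqP => [_|j2].
  by apply: (measurableT_comp _ measurable_snd); apply: (measurable_multidiag_derive Pd); lia.
apply: measurable_funM; first by apply/measurable_natr_bool/measurable_fun_ler.
have mh : measurable_fun setT (haz e j) by apply: measurable_haz; lia.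
apply: measurable_funM; first exact: (measurableT_comp mh measurable_snd).
apply: (measurableT_comp (@measurable_expR R)); apply: measurable_funN.
by apply: measurable_cumul => // t; apply: haz_ge0; lia.
Qed.

Lemma ln_kern e W j s t : kern e W j s t != 0 ->
  0 < kern e W j s t /\ ln (kern e W j s t) =
  ln (f j t) - (if j == 1%N then 0 else ln (gap e j t) + cumul (haz e j) s t).
Proof.
move=> k0; split; first by rewrite lt_neqAle eq_sym k0 kern_ge0.
move: k0; rewrite /kern; case: (boolP (_ && _)) => [/andP[j1 _]|]; last by rewrite mul0r eqxx.
rewrite !mul1r; have [->|/eqP j2] := eqVneq j 1; first by rewrite subr0.
case: (s <= t); rewrite ?mul0r ?eqxx// mul1r mulf_eq0 negb_or => /andP[h0 _].
have hp : 0 < haz e j t by rewrite lt_neqAle eq_sym h0 haz_ge0//; lia.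
rewrite lnM ?posrE ?expR_gt0// expRK.
move: h0; rewrite /haz mulf_eq0 invr_eq0 negb_or => /andP[f0 g0].
rewrite ln_div ?posrE; first lra.
  by rewrite lt_neqAle eq_sym f0 (multidiag_derive_ge0 Pd).
by rewrite lt_neqAle eq_sym g0 gap_ge0//; lia.
Qed.

(** On the support the mask contributes a factor [1], so the logarithm is the same expression for
    every [W]. *)
Lemma ln_chain_kern e W x : (0 < d)%N -> chain (kern e W) 1 0 (sortt x) != 0 ->
  0 < chain (kern e W) 1 0 (sortt x) /\
  ln ((d`!%:R)^-1 * chain (kern e W) 1 0 (sortt x)) = loglik e x.
Proof.
move=> d0; rewrite chain_sortt prodf_seq_neq0 => /allP H.
have {}H i : (1 <= i < d.+1)%N ->
    kern e W i (if i == 1%N then 0 else X x i.-1) (X x i) != 0.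
  by move=> id; have := H i; rewrite mem_index_iota => /(_ id).
have [p0 pE] := @ln_prod_nat R (fun i => kern e W i (if i == 1%N then 0 else X x i.-1) (X x i))
  1 d.+1 (fun i id => (ln_kern (H i id)).1).
split => //; have f0 : 0 < (d`!%:R : R) by rewrite ltr0n fact_gt0.
rewrite lnM ?posrE ?invr_gt0// lnV ?posrE// pE /loglik -!addrA; congr (_ + _).
transitivity (\sum_(1 <= i < d.+1) (ln (f i (X x i)) -
    (if i == 1%N then 0 else ln (gap e i (X x i)) + cumul (haz e i) (X x i.-1) (X x i)))).
  by apply: eq_big_nat => i id; rewrite (ln_kern (H i id)).2; case: eqP.
rewrite sumrB; congr (_ - _); rewrite big_ltn//= add0r.
by apply: eq_big_nat => i id; case: eqP => //; lia.
Qed.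

Lemma multidiag_derive_out i t : (1 <= i <= d)%N -> ~ unitI R t -> f i t = 0.
Proof.
move=> id nt; rewrite derive1E.
have [t0|t0] := ltP t 0.
  rewrite (@near_eq_derive _ _ _ _ (cst (0 : R))) ?derive_cst//.
  by near=> s; rewrite (multidiag_le0 Pd)// ltW//; near: s; exact: lt_nbhsl.
have t1 : 1 < t by rewrite ltNge; apply/negP => t1; apply: nt; rewrite /unitI/= t0 t1.
rewrite (@near_eq_derive _ _ _ _ (cst (1 : R))) ?derive_cst//.
by near=> s; rewrite (multidiag_ge1 Pd)// ltW//; near: s; exact: lt_nbhsr.
Unshelve. all: by end_near. Qed.

Lemma multidiag_derive_unitI i t : (1 <= i <= d)%N -> f i t != 0 -> 0 <= t <= 1.
Proof.
by move=> id ft; apply: contrapT => /(multidiag_derive_out id) f0; rewrite f0 eqxx in ft.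
Qed.

Lemma realizes_cube : P (cube R d) = 1%E.
Proof.
have mC := @measurable_cube R d.
suff PC0 : P (~` cube R d) = 0%E.
  by rewrite -[cube R d]setCK probability_setC ?PC0 ?sube0//; exact: measurableC.
apply/eqP; rewrite eq_le measure_ge0 andbT.
have mAj j : measurable [set x : d.-tuple R | (~` `[0, 1]%classic) (tnth x j)].
  by rewrite -[X in measurable X]setTI; apply: measurable_tnth => //; apply: measurableC.
have := @content_sub_fsum _ _ _ P _ [set: 'I_d] (~` cube R d)
  (fun j => [set x | (~` `[0, 1]%classic) (tnth x j)]) finite_finset.
rewrite fsbig1; last first.
  move=> j _; transitivity (mu (~` `[0, 1]%classic `&` `[0, 1]%classic)).
    by apply: (uniform_marginal_law Pd); apply: measurableC.
  by rewrite setICl measure0.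
apply => //; first exact: measurableC.
move=> x /= /existsNP[j xj]; exists j => //=; rewrite in_itv/=; exact/negP.
Qed.

(** The derivative [f i] is the density of [X_i], and a density integrates to [0] over its own zero
    set. *)
Lemma ordstat_derive_neq0 i : (1 <= i <= d)%N -> P [set x | f i (X x i) = 0] = 0%E.
Proof.
move=> id; have := (ordstat_law Pd id).2 [set t | f i t = 0].
move=> ->; first by apply: integral0_eq => t /= ->.
rewrite -[X in measurable X]setTI.
rewrite (_ : [set t | _] = (f i) @^-1` [set 0])//.
by apply: (measurable_multidiag_derive Pd id) => //; exact: measurable_set1.
Qed.

Lemma integral_multidiag_derive i : (1 <= i <= d)%N -> (\int[mu]_t (f i t)%:E = 1)%E.
Proof. by move=> id; rewrite -((ordstat_law Pd id).2 setT)// probability_setT. Qed.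

Lemma expects_ordstat i (phi : R -> R) : (1 <= i <= d)%N ->
  measurable_fun setT phi -> mu.-integrable setT (fun t => (phi t * f i t)%:E) ->
  expects P (fun x => phi (X x i)) (\int[mu]_t (phi t * f i t))%R.
Proof.
move=> id mphi iphi; have [i1 e1] := integrable_ordstat Pd id mphi iphi; split => //.
by rewrite e1 /Rintegral fineK//; exact: integrable_fin_num iphi.
Qed.

(** [Z] is the extended-real integral whose finite part is [cumul]. Its expectation is finite, so
    [Z] is finite almost surely and nothing is lost in passing to [cumul]. *)
Lemma expects_cumul i (h : R -> R) : (2 <= i <= d)%N ->
  measurable_fun setT h -> (forall t, 0 <= h t) ->
  (\int[mu]_t (h t * (delta i.-1 t - delta i t))%:E < +oo)%E ->
  expects P (fun x => cumul h (X x i.-1) (X x i))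
    (\int[mu]_t (h t * (delta i.-1 t - delta i t)))%R.
Proof.
move=> id mh h0 hoo.
pose Z (x : d.-tuple R) := (\int[mu]_(r in `[X x i.-1, X x i]) (h r)%:E)%E.
have Z0 x : (0 <= Z x)%E by apply: integral_ge0 => t _; rewrite lee_fin.
have EZ : (\int[P]_x Z x = \int[mu]_t (h t * (delta i.-1 t - delta i t))%:E)%E.
  rewrite -(ge0_integral_ordstat_gap Pd id mh h0); apply: eq_integral => x _.
  rewrite integral_itv_bndo_bndc//; exact/measurable_funTS/measurable_EFinP.
have mZ : measurable_fun setT Z.
  have mXX : measurable_fun setT (fun x : d.-tuple R => (X x i.-1, X x i)).
    by apply: measurable_fun_pair; exact: measurable_ordstat.
  exact: (measurableT_comp (measurable_cumulE h0 mh) mXX).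
have iZ : P.-integrable setT Z.
  apply/integrableP; split => //; under eq_integral do rewrite gee0_abs//.
  by rewrite EZ.
have fZ : {ae P, forall x, Z x \is a fin_num}.
  by apply: filterS (integrable_ae measurableT iZ) => x; exact.
have mf : measurable_fun setT (EFin \o (fun x => cumul h (X x i.-1) (X x i))).
  by apply/measurable_EFinP; apply: (measurableT_comp _ mZ).
split.
  apply: (le_integrable measurableT mf _ iZ) => x _.
  rewrite /= /cumul /Rintegral -/(Z x) (gee0_abs (Z0 x)) ger0_norm ?fine_ge0//.
  by case: (Z x) (Z0 x) => //= r; rewrite ?leey.
transitivity (\int[P]_x Z x)%E; last first.
  by rewrite EZ /Rintegral fineK// ge0_fin_numE// -EZ; exact: integral_ge0.
apply: ae_eq_integral => //.
by apply: filterS fZ => x fZx _; rewrite /= /cumul /Rintegral fineK.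
Qed.

Lemma haz_gap_le e i t : (2 <= i <= d)%N ->
  0 <= haz e i t * (delta i.-1 t - delta i t) <= f i t.
Proof.
move=> id; have D0 : 0 <= delta i.-1 t - delta i t by rewrite subr_ge0 (multidiag_decr Pd).
have f0 : 0 <= f i t by rewrite (multidiag_derive_ge0 Pd)//; lia.
rewrite mulr_ge0 ?haz_ge0//= /haz -mulrA ler_piMr//.
have := gap_ge0 e t id; rewrite le_eqVlt => /predU1P[<-|g0]; first by rewrite invr0 mul0r.
by rewrite mulrC ler_pdivrMr// mul1r le_max lexx.
Qed.

Lemma integral_haz_gap_le e i : (2 <= i <= d)%N ->
  (\int[mu]_t (haz e i t * (delta i.-1 t - delta i t))%:E <= 1)%E.
Proof.
move=> id; rewrite -(@integral_multidiag_derive i); last lia.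
apply: ge0_le_integral => //.
- by move=> t _; rewrite lee_fin; have /andP[] := haz_gap_le e t id.
- apply/measurable_EFinP/measurable_funM; first exact: measurable_haz.
  by apply: measurable_funB; apply: (measurable_multidiag Pd); lia.
- by apply/measurable_EFinP; apply: (measurable_multidiag_derive Pd); lia.
- by move=> t _; rewrite lee_fin; have /andP[] := haz_gap_le e t id.
Qed.

Lemma integrable_xlnx_derive i : (1 <= i <= d)%N ->
  mu.-integrable setT (fun t => (ln (f i t) * f i t)%:E).
Proof.
(* Since [0 <= f i t <= d], the product [f ln f] lies between [-1] and [d ^ 2]. *)
move=> id; apply: (@integrable_bounded_unitI R _ (1 + d%:R ^+ 2)).
- apply: measurable_funM; last exact: (measurable_multidiag_derive Pd).
  by apply: (measurableT_comp (@measurable_ln R)); exact: (measurable_multidiag_derive Pd).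
- move=> t; have fb := multidiag_derive_bound Pd t id; have /andP[f0 _] := fb.
  have := xlnx_ge f0; have := xlnx_le fb; have := sqr_ge0 (d%:R : R).
  by rewrite mulrC ler_norml; lra.
- by move=> t /(multidiag_derive_out id) ->; rewrite mulr0.
Qed.

(** Each term involves one order statistic or one gap between neighbours, so its mean is the same
    for every law with multidiagonal [delta]. *)
Lemma expects_loglik e :
  (forall i, (2 <= i <= d)%N -> mu.-integrable setT (fun t => (ln (gap e i t) * f i t)%:E)) ->
  expects P (loglik e) (mean_loglik e).
Proof.
move=> ig; rewrite /loglik /mean_loglik; apply: expectsD; last apply: expectsN.
  apply: expectsD; first exact: expects_cst.
  apply: expects_sum => i id; apply: (expects_ordstat (phi := fun t => ln (f i t))); first lia.
    apply: (measurableT_comp (@measurable_ln R)); apply: (measurable_multidiag_derive Pd); lia.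
  by apply: integrable_xlnx_derive; lia.
apply: expects_sum => i id; have id' : (2 <= i <= d)%N by lia.
apply: expectsD.
  apply: (expects_ordstat (phi := fun t => ln (gap e i t))); first lia.
    by apply: (measurableT_comp (@measurable_ln R)); exact: measurable_gap.
  exact: ig.
apply: expects_cumul => //; first exact: measurable_haz.
  by move=> t; exact: haz_ge0.
by rewrite (le_lt_trans (integral_haz_gap_le e id'))// ltry.
Qed.

Lemma integrable_ln_gap e i : 0 < e -> e <= 1 -> (2 <= i <= d)%N ->
  mu.-integrable setT (fun t => (ln (gap e i t) * f i t)%:E).
Proof.
move=> e0 e1 id; have id1 : (1 <= i <= d)%N by lia.
(* The truncated gap lies in [[e, 1]], so the absolute value of its logarithm is at most
   [- ln e]. *)
apply: (@integrable_bounded_unitI R _ (- ln e * d%:R)).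
- apply: measurable_funM; last exact: (measurable_multidiag_derive Pd).
  by apply: (measurableT_comp (@measurable_ln R)); exact: measurable_gap.
- move=> t; have /andP[f0 fd] := multidiag_derive_bound Pd t id1.
  have eg : e <= gap e i t by rewrite le_max lexx orbT.
  have g1 : gap e i t <= 1.
    rewrite ge_max e1 andbT lerBlDl (le_trans (multidiag_le1 Pd _ _))//; first lia.
    by rewrite lerDr (multidiag_ge0 Pd).
  have lg : ln e <= ln (gap e i t) by rewrite ler_ln ?posrE// (lt_le_trans e0).
  have l0 : ln (gap e i t) <= 0 by exact: ln_le0.
  by rewrite normrM (ger0_norm f0) ler0_norm// ler_pM// ?oppr_ge0// lerN2.
- by move=> t /(multidiag_derive_out id1) ->; rewrite mulr0.
Qed.

End likelihood.

Lemma measurable_zero_set disp (T : measurableType disp) (R : realType) (g : T -> R) :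
  measurable_fun setT g -> measurable [set x | g x = 0].
Proof.
move=> mg; rewrite -[X in measurable X]setTI (_ : [set x | _] = g @^-1` [set 0])//.
by apply: mg => //; exact: measurable_set1.
Qed.

(** * Exhaustion by segments and normalization of sorted densities *)

Section exhaustion.
Variable R : realType.
Local Notation mu := (@lebesgue_measure R).

Lemma cvg_integral_itv (g : R -> \bar R) (a b : nat -> R) (A : set R) :
  measurable_fun setT g -> (forall t, (0 <= g t)%E) ->
  {homo a : n m / (n <= m)%N >-> m <= n} -> {homo b : n m / (n <= m)%N >-> n <= m} ->
  A = \bigcup_n `[a n, b n]%classic ->
  (\int[mu]_(t in `[a n, b n]) g t)%E @[n --> \oo] --> (\int[mu]_(t in A) g t)%E.
Proof.
move=> mg g0 am bm ->; pose F (n : nat) : set (measurableTypeR R) := `[a n, b n]%classic.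
apply: (@ge0_nondecreasing_set_cvg_integral _ _ _ F g mu) => [n m nm|n|n|n t _] //.
- apply/subsetPset => t; rewrite /F /= !in_itv/= => /andP[at_ tb].
  by rewrite (le_trans (am _ _ nm))// (le_trans tb)// bm.
- exact: measurable_itv.
- exact: measurable_funTS.
Qed.

Variables (h : R -> R) (s : R).
Hypotheses (h0 : forall t, 0 <= h t) (mh : measurable_fun setT h).

Lemma measurable_hazard : measurable_fun setT (fun t => (h t * expR (- cumul h s t))%:E).
Proof.
apply/measurable_EFinP/measurable_funM => //; apply: (measurableT_comp (@measurable_expR R)).
apply: measurable_funN.
exact: (measurable_fun_comp2 (measurable_cumul h0 mh) (measurable_cst s)).
Qed.

(** Over [[s, s + n + 1]] the integral is [1] minus the survival probability, hence at most [1]. *)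
Lemma integral_hazard_le (M : R) : (forall t, h t <= M) ->
  (\int[mu]_t ((s <= t)%R%:R * (h t * expR (- cumul h s t)))%:E <= 1)%E.
Proof.
move=> hM; pose g t : \bar R := (h t * expR (- cumul h s t))%:E.
have g0 t : (0 <= g t)%E by rewrite lee_fin mulr_ge0// expR_ge0.
pose b (n : nat) : R := s + n.+1%:R.
have UF : `[s, +oo[%classic = \bigcup_n `[s, b n]%classic.
  apply/seteqP; split => t /=; last first.
    by move=> [n _ /=]; rewrite !in_itv/= andbT => /andP[].
  rewrite in_itv/= andbT => st; exists (Num.truncn (t - s)) => //=; rewrite in_itv/= st/=.
  by rewrite -lerBlDl ltW// truncnS_gt.
have -> : (\int[mu]_t ((s <= t)%R%:R * (h t * expR (- cumul h s t)))%:E =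
    \int[mu]_(t in `[s, +oo[%classic) g t)%E.
  rewrite [RHS]integral_mkcond; apply: eq_integral => t _.
  by rewrite patchE mem_setE in_itv/= andbT; case: ifP; rewrite ?mul1r ?mul0r.
have cv := @cvg_integral_itv g (fun _ => s) b _ measurable_hazard g0
  (fun _ _ _ => lexx s) _ UF.
have {}cv := cv _.
rewrite -(cvg_lim _ (cv _))//; last by move=> n m nm; rewrite lerD2l ler_nat ltnS.
apply: lime_le; first by apply: cvgP; apply: cv => n m nm; rewrite lerD2l ler_nat ltnS.
apply: nearW => n; rewrite (@integral_hazard _ _ h0 mh _ _ M)//; last by rewrite ltrDl.
by rewrite lee_fin lerBlDr lerDl expR_ge0.
Qed.

End exhaustion.

Section normalized_sort.
Variables (R : realType) (d : nat) (F : d.-tuple R -> R).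
Hypotheses (F0 : forall x, 0 <= F x) (mF : measurable_fun setT F).

Lemma measurable_sorted_mul : measurable_fun setT
  (fun x : d.-tuple R => \1_[set x : d.-tuple R | sorted <=%R x] x * F x).
Proof.
by apply: measurable_funM => //; apply: measurable_indic; exact: measurable_sorted_tuple.
Qed.

(** The factor [1 / d!] compensates for the [d!] orders of the coordinates. *)
Lemma integral_sortt_normalized : (\int[lebn R d]_x ((d`!%:R)^-1 * F (sortt x))%:E =
  \int[lebn R d]_x (\1_[set x : d.-tuple R | sorted <=%R x] x * F x)%:E)%E.
Proof.
have f0 : 0 < (d`!%:R : R) by rewrite ltr0n fact_gt0.
rewrite (ge0_integral_sortt (f := fun x => (d`!%:R)^-1 * F x)); last 2 first.
- by move=> x; rewrite mulr_ge0// invr_ge0 ltW.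
- exact: measurable_funM.
under eq_integral do rewrite mulrCA EFinM.
rewrite ge0_integralZl//; last 2 first.
- by apply/measurable_EFinP; exact: measurable_sorted_mul.
- by move=> x _; rewrite lee_fin mulr_ge0.
by rewrite muleA -EFinM divff ?gt_eqF// mul1e.
Qed.

Lemma integral_sortt_le : (\int[lebn R d]_x (F x)%:E <= 1)%E ->
  (\int[lebn R d]_x ((d`!%:R)^-1 * F (sortt x))%:E <= 1)%E.
Proof.
move=> F1; rewrite integral_sortt_normalized; apply: le_trans F1.
apply: ge0_le_integral => //.
- by move=> x _; rewrite lee_fin mulr_ge0.
- by apply/measurable_EFinP; exact: measurable_sorted_mul.
- exact/measurable_EFinP.
- by move=> x _; rewrite lee_fin ler_piMl// indicE; case: (_ \in _).
Qed.

End normalized_sort.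

(** * The upper bound for the entropy *)

Section upper_bound.
Variables (R : realType) (d : nat) (delta : nat -> R -> R).
Local Notation mu := (@lebesgue_measure R).
Local Notation X := (ordstat R d).
Local Notation f i := (derive1 (delta i)).
Local Notation tt3 := (fun (_ : nat) (_ _ : R) => true).

Variable P : probability (d.-tuple R) R.
Hypothesis Pd : realizes delta P.

(** The numerator of the rate is at most [d] and the truncated gap at least [e], so the rate is
    bounded by [d / e] on the whole line. *)
Lemma integral_kern_le (e : R) j s : 0 < e ->
  (\int[mu]_t (kern d delta e tt3 j s t)%:E <= 1)%E.
Proof.
move=> e0; rewrite /kern; have [j1|_] := boolP (1 <= j <= d)%N; last first.
  by under eq_integral do rewrite mul0r; rewrite integral0.
under eq_integral do rewrite mul1r; case: eqP => [_|j2].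
  by rewrite (integral_multidiag_derive Pd)//; lia.
have id : (2 <= j <= d)%N by lia.
apply: (@integral_hazard_le _ _ _ _ _ (d%:R / e)).
- by move=> t; exact: (haz_ge0 Pd).
- exact: (measurable_haz Pd).
move=> t; have /andP[f0 fd] := multidiag_derive_bound Pd t j1.
have eg : e <= gap delta e j t by rewrite le_max lexx orbT.
have gp : 0 < gap delta e j t by exact: lt_le_trans eg.
by rewrite /haz ler_pM// ?invr_ge0 ?(ltW gp)// lef_pV2 ?posrE.
Qed.

Lemma ent_of_le_mean c (e : R) : (0 < d)%N -> has_density (lebn R d) P c -> 0 < e -> e <= 1 ->
  (ent_of R d c <= (- mean_loglik d delta e)%:E)%E.
Proof.
move=> d0 Pc e0 e1.
have [iell Eell] : expects P (loglik delta e) (mean_loglik d delta e).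
  apply: (expects_loglik Pd) => i id; exact: (integrable_ln_gap Pd).
pose k := kern d delta e tt3.
have k0 j s t : 0 <= k j s t by exact: (kern_ge0 Pd).
have mk j : measurable_fun [set: R * R] (fun z => k j z.1 z.2).
  exact: (measurable_kern Pd).
have mc := @measurable_chainr R k mk d 1 0.
have c0 x : 0 <= chain k 1 0 x by exact: chain_ge0.
rewrite EFinN -Eell.
apply: (gibbs_upper Pc (realizes_cube Pd) (g := fun x => (d`!%:R)^-1 * chain k 1 0 (sortt x))) => //.
- by move=> x; rewrite mulr_ge0// invr_ge0.
- by apply: measurable_funM => //; exact: (measurableT_comp mc (@measurable_sortt R d)).
- apply: (@integral_sortt_le _ _ (fun x : d.-tuple R => chain k 1 0 x)) => //.
  by apply: (chain_mass_le k0 mk) => j s; exact: integral_kern_le.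
(* The chain density could vanish only through some [f i (X x i) = 0], which has probability [0]; so
   up to a null set [c] vanishes there as well. *)
have cf : {ae lebn R d, forall x (i : 'I_d), f i.+1 (X x i.+1) = 0 -> c x = 0}.
  apply: filter_forall => i; have id : (1 <= i.+1 <= d)%N by rewrite ltn_ord.
  have := density_null Pc _ (ordstat_derive_neq0 Pd id); apply.
  apply: measurable_zero_set.
  exact: (measurableT_comp (measurable_multidiag_derive Pd id) (@measurable_ordstat R d _)).
apply: filterS cf => x cf cx; have H : chain k 1 0 (sortt x) != 0.
  rewrite chain_sortt prodf_seq_neq0; apply/allP => i; rewrite mem_index_iota => id /=.
  have f0 : f i (X x i) != 0.
    have id1 : (i.-1 < d)%N by lia.
    apply: contra cx => /eqP f0; apply/eqP; apply: (cf (Ordinal id1)) => /=.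
    by rewrite prednK//; lia.
  have -> : k i (if i == 1%N then 0 else X x i.-1) (X x i) = (if i == 1%N then f 1 (X x i) else
      haz delta e i (X x i) * expR (- cumul (haz delta e i) (X x i.-1) (X x i))).
    rewrite /k /kern (_ : (1 <= i <= d)%N); last lia.
    rewrite mul1r; case: eqP => // i1; rewrite ordstat_le ?mul1r//; lia.
  have [i1|_] := eqVneq i 1%N; first by move: f0; rewrite i1.
  have eg : e <= gap delta e i (X x i) by rewrite le_max lexx orbT.
  apply: mulf_neq0; last by rewrite gt_eqF// expR_gt0.
  by apply: mulf_neq0 => //; rewrite invr_eq0 gt_eqF// (lt_le_trans e0 eg).
have [cp cE] := ln_chain_kern Pd d0 H.
by split => //; rewrite mulr_gt0// invr_gt0 ltr0n fact_gt0.
Qed.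

(** The [d - 1] summands [1] are the values that the mean integrated rates take without truncation,
    namely the integrals of [f i]. The first part is a real number, so the subtraction of [J] is
    always meaningful. *)
Definition ent_max : \bar R :=
  ((ln (d`!%:R) - \sum_(1 <= i < d.+1) (\int[mu]_t (ln (f i t) * f i t))%R
     + \sum_(2 <= i < d.+1) 1)%:E - Jfun R d delta)%E.

(** If the gap is positive, the truncation is eventually inactive. If it is [0], the logarithm is
    [ln (n + 1)], and the two cases of [J_integrand] are the limits for zero and positive
    derivative. *)
Lemma J_integrand_cvg i t : (2 <= i <= d)%N ->
  (- ln (gap delta n.+1%:R^-1 i t) * f i t)%:E @[n --> \oo] --> J_integrand R delta i t.
Proof.
move=> id; have id1 : (1 <= i <= d)%N by lia.
have D0 : 0 <= delta i.-1 t - delta i t by rewrite subr_ge0 (multidiag_decr Pd).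
rewrite /J_integrand; case: ifPn => [Dp|Dn].
  apply: cvg_near_cst; near=> n.
  have -> : gap delta n.+1%:R^-1 i t = delta i.-1 t - delta i t.
    apply: max_l; rewrite invf_ple ?posrE//.
    apply: (@le_trans _ _ n%:R); last by rewrite ler_nat.
    by near: n; exact: nbhs_infty_ger.
  congr (_%:E); rewrite [RHS]mulrC; congr (_ * _); rewrite ler0_norm//; apply: ln_le0.
  by rewrite lerBlDl (le_trans (multidiag_le1 Pd _ _)) ?lerDr ?(multidiag_ge0 Pd)//; lia.
have DE : delta i.-1 t - delta i t = 0 by apply/eqP; rewrite eq_le D0 andbT leNgt.
have gE n : gap delta n.+1%:R^-1 i t = n.+1%:R^-1 by rewrite /gap DE max_r.
have lE n : - ln (gap delta n.+1%:R^-1 i t) = ln (n.+1%:R) by rewrite gE lnV ?posrE// opprK.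
case: eqP => [->|/eqP f0].
  by apply: cvg_near_cst; apply: nearW => n; rewrite mulr0.
have fp : 0 < f i t by rewrite lt_neqAle eq_sym f0 (multidiag_derive_ge0 Pd).
apply/cvgeyPge => A; near=> n; rewrite lee_fin lE -ler_pdivrMr//.
rewrite -[leLHS]expRK ler_ln ?posrE ?expR_gt0//.
apply: (@le_trans _ _ n%:R); last by rewrite ler_nat.
by near: n; exact: nbhs_infty_ger.
Unshelve. all: by end_near. Qed.

Lemma gap_le1 (e : R) i t : e <= 1 -> (2 <= i <= d)%N -> gap delta e i t <= 1.
Proof.
move=> e1 id; rewrite ge_max e1 andbT lerBlDl (le_trans (multidiag_le1 Pd _ _))//; first lia.
by rewrite lerDr (multidiag_ge0 Pd)//; lia.
Qed.

Lemma J_integrand_out i t : (2 <= i <= d)%N -> ~ unitI R t -> J_integrand R delta i t = 0%E.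
Proof.
move=> id nt; rewrite /J_integrand (multidiag_derive_out Pd _ nt); last lia.
by rewrite eqxx mul0r; case: ifP.
Qed.

Lemma J_integrand_integral i : (2 <= i <= d)%N ->
  (\int[mu]_(t in unitI R) J_integrand R delta i t = \int[mu]_t J_integrand R delta i t)%E.
Proof.
move=> id; rewrite integral_mkcond; apply: eq_integral => t _; rewrite patchE.
case: ifPn => // /negP nt; rewrite J_integrand_out// => ut; apply: nt; exact: mem_set.
Qed.

Lemma ln_gap_ge0 n i t : (2 <= i <= d)%N -> 0 <= - ln (gap delta n.+1%:R^-1 i t) * f i t.
Proof.
move=> id; rewrite mulr_ge0//; last by rewrite (multidiag_derive_ge0 Pd)//; lia.
by rewrite oppr_ge0; apply/ln_le0/gap_le1 => //; rewrite invf_le1// ler1n.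
Qed.

Lemma measurable_ln_gap e i : (2 <= i <= d)%N ->
  measurable_fun setT (fun t => (- ln (gap delta e i t) * f i t)%:E).
Proof.
move=> id; apply/measurable_EFinP/measurable_funM; last first.
  by apply: (measurable_multidiag_derive Pd); lia.
apply: measurable_funN; apply: (measurableT_comp (@measurable_ln R)).
exact: (measurable_gap Pd).
Qed.

(** A smaller truncation level gives a smaller gap, all gaps being at most [1]; monotone convergence
    thus holds with an infinite limit allowed. *)
Lemma Jn_cvg i : (2 <= i <= d)%N ->
  (\int[mu]_t (- ln (gap delta n.+1%:R^-1 i t) * f i t)%:E)%E @[n --> \oo] -->
  (\int[mu]_(t in unitI R) J_integrand R delta i t)%E.
Proof.
move=> id; rewrite J_integrand_integral//.
have := @cvg_monotone_convergence _ _ _ mu setT measurableT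
  (fun n t => (- ln (gap delta n.+1%:R^-1 i t) * f i t)%:E).
rewrite (_ : (\int[mu]_t limn _)%E = (\int[mu]_t J_integrand R delta i t)%E); last first.
  by apply: eq_integral => t _; apply: cvg_lim => //; exact: J_integrand_cvg.
apply.
- by move=> n; exact: measurable_ln_gap.
- by move=> n t _; rewrite lee_fin ln_gap_ge0.
- move=> t _ n m nm; rewrite lee_fin ler_wpM2r//.
    by rewrite (multidiag_derive_ge0 Pd)//; lia.
  rewrite lerN2 ler_ln ?posrE ?lt_max ?invr_gt0 ?ltr0n ?orbT//.
  rewrite ge_max !le_max lexx/= lef_pV2 ?posrE//.
  by rewrite ler_nat ltnS nm orbT.
Qed.

Lemma ent_of_le_max c : (0 < d)%N -> has_density (lebn R d) P c ->
  (ent_of R d c <= ent_max)%E.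
Proof.
move=> d0 Pc; rewrite /ent_max; set K := (X in X%:E).
pose Jn n := (\sum_(2 <= i < d.+1)
  \int[mu]_t (- ln (gap delta n.+1%:R^-1 i t) * f i t)%:E)%E.
have Jn0 n : (0 <= Jn n)%E.
  rewrite /Jn big_seq; apply: sume_ge0 => i; rewrite mem_index_iota => id.
  by apply: integral_ge0 => t _; rewrite lee_fin ln_gap_ge0.
have Jc : Jn n @[n --> \oo] --> Jfun R d delta.
  rewrite /Jn /Jfun [X in _ --> X]big_seq; under eq_fun do rewrite big_seq.
  apply: cvg_nnesum => i; rewrite mem_index_iota => id.
    by apply: nearW => n; apply: integral_ge0 => t _; rewrite lee_fin ln_gap_ge0.
  exact: Jn_cvg.
have := lee_cvg_to (cvg_cst (ent_of R d c)) (cvgeB _ (cvg_cst K%:E) Jc).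
apply; first by rewrite fin_num_adde_defr.
apply: nearW => n; have e0 : 0 < n.+1%:R^-1 :> R by rewrite invr_gt0.
have e1 : n.+1%:R^-1 <= 1 :> R by rewrite invf_le1// ler1n.
apply: (le_trans (ent_of_le_mean d0 Pc e0 e1)).
have JE i : (2 <= i <= d)%N -> (\int[mu]_t (- ln (gap delta n.+1%:R^-1 i t) * f i t)%:E =
    (- (\int[mu]_t (ln (gap delta n.+1%:R^-1 i t) * f i t))%R)%:E)%E.
  move=> id; have ig := integrable_ln_gap Pd e0 e1 id.
  under eq_integral do rewrite mulNr EFinN.
  rewrite (integralN (integrable_add_def measurableT ig)) EFinN /Rintegral fineK//.
  exact: integrable_fin_num ig.
have -> : Jn n = (\sum_(2 <= i < d.+1)
    - (\int[mu]_t (ln (gap delta n.+1%:R^-1 i t) * f i t))%R)%:E.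
  rewrite /Jn -sumEFin; apply: eq_big_nat => i id; exact: JE.
rewrite -EFinB lee_fin /mean_loglik /K.
set A := \sum_(1 <= i < d.+1) _; set B := \sum_(2 <= i < d.+1) _.
set C := \sum_(2 <= i < d.+1) - _; set N := \sum_(2 <= i < d.+1) 1.
(* Truncation only lowers the mean integrated rate, so each is at most [1]. *)
suff : B <= N - C by lra.
rewrite -sumrB; apply: ler_sum_nat => i id.
rewrite opprK addrC lerD2r.
have id' : (2 <= i <= d)%N by lia.
have G1 := integral_haz_gap_le Pd n.+1%:R^-1 id'.
rewrite -lee_fin /Rintegral fineK// ge0_fin_numE; first by rewrite (le_lt_trans G1)// ltry.
by apply: integral_ge0 => t _; rewrite lee_fin; have /andP[] := haz_gap_le Pd n.+1%:R^-1 t id'.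
Qed.

End upper_bound.

(** * Connected components of open sets *)

Section components.
Variable R : realType.
Local Notation seg s t := [set r : R | s <= r <= t].

Lemma open_ball_sub (U : set R) s : open U -> U s ->
  exists2 e : R, 0 < e & forall r, `|s - r| < e -> U r.
Proof. by move=> oU Us; have /nbhs_ballP[e e0 He] := open_nbhs_nbhs (conj oU Us); exists e. Qed.

(** Openness excludes the infimum from the component: were it in [U], the segment could be prolonged
    to its left. The point [L] outside [U] bounds the set of left ends, so that the infimum is
    genuine. *)
Lemma comp_loP (U : set R) L t : open U -> L <= t -> ~ U L -> U t ->
  [/\ L <= comp_lo R U t, comp_lo R U t < t, ~ U (comp_lo R U t) &
      forall s, s <= t -> (seg s t `<=` U <-> comp_lo R U t < s)].
Proof.
move=> oU Lt nUL Ut; set A := [set a | seg a t `<=` U].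
have At : A t by move=> r /=; rewrite -eq_le => /eqP <-.
have lbA : lbound A L.
  move=> a Aa; rewrite leNgt; apply/negP => aL; apply: nUL; apply: Aa => /=.
  by rewrite Lt ltW.
have iA : has_inf A by split; [exists t|exists L].
rewrite /comp_lo -/A; set a := inf A.
have La : L <= a by apply: lb_le_inf => //; exists t.
have H s : s <= t -> (seg s t `<=` U <-> a < s).
  move=> st; split => [Us|as_].
    have [e e0 He] := open_ball_sub oU (Us s ltac:(by rewrite /= lexx st)).
    apply: (@le_lt_trans _ _ (s - e / 2)); last by rewrite ltrBlDr ltrDl divr_gt0.
    apply: ge_inf; first by exists L.
    move=> r /= /andP[r1 r2]; have [sr|rs] := leP s r; first by apply: Us; rewrite /= sr r2.
    by apply: He; rewrite ger0_norm ?subr_ge0 ?(ltW rs)//; lra.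
  have sa0 : 0 < s - a by rewrite subr_gt0.
  have [a' Aa'] := inf_adherent sa0 iA; rewrite subrKC => a's.
  by move=> r /= /andP[sr rt]; apply: Aa' => /=; rewrite rt (le_trans _ sr)// ltW.
have at_ : a < t by apply/H.
split => // Ua.
suff : a < a by rewrite ltxx.
apply/H; first exact: ltW.
move=> r /= /andP[]; rewrite le_eqVlt => /predU1P[<-//|ar] rt.
by apply: ((H _ rt).2 ar); rewrite /= lexx rt.
Qed.

(** Reflection at [0] exchanges the two ends, so facts about right ends follow from those about left
    ends. *)
Lemma comp_hi_opp (U : set R) t : comp_hi R U t = - comp_lo R [set r | U (- r)] (- t).
Proof.
rewrite /comp_hi /comp_lo /inf opprK; congr sup; apply/seteqP; split => b /= H.
  exists (- b); last by rewrite opprK.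
  by move=> r /= /andP[r1 r2]; apply: H => /=; rewrite lerNr r2 lerNl r1.
case: H => a H <- r /= /andP[r1 r2]; rewrite -[r]opprK; apply: H => /=.
by rewrite lerNr r2 lerNl opprK r1.
Qed.

Lemma comp_hiP (U : set R) H t : open U -> t <= H -> ~ U H -> U t ->
  [/\ comp_hi R U t <= H, t < comp_hi R U t, ~ U (comp_hi R U t) &
      forall s, t <= s -> (seg t s `<=` U <-> s < comp_hi R U t)].
Proof.
move=> oU tH nUH Ut; pose V := [set r | U (- r)].
have oV : open V.
  by apply: (@open_comp _ _ -%R U) => // r _; exact: opp_continuous.
have := @comp_loP V (- H) (- t) oV; rewrite comp_hi_opp -/V.
move: (comp_lo R V (- t)) => b; rewrite lerN2 /V /= !opprK.
move=> /(_ tH nUH Ut) [c1 c2 c3 c4]; split => //; first by rewrite lerNl.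
  by rewrite ltrNr.
move=> s ts; have := c4 (- s); rewrite lerN2 => /(_ ts) cs; rewrite ltrNr; split.
  move=> sU; apply/cs => r /= /andP[r1 r2]; apply: sU => /=.
  by rewrite lerNr r2 lerNl r1.
move/cs => sV r /= /andP[r1 r2]; rewrite -[r]opprK; apply: sV => /=.
by rewrite !lerN2 r2 r1.
Qed.

Lemma comp_lo_eq (U : set R) s t : s <= t -> seg s t `<=` U -> comp_lo R U s = comp_lo R U t.
Proof.
move=> st stU; congr inf; apply/seteqP; split => a /= aU r /= /andP[ar rt].
  have [rs|sr] := leP r s; first by apply: aU; rewrite /= ar rs.
  by apply: stU; rewrite /= rt (ltW sr).
by apply: aU; rewrite /= ar (le_trans rt).
Qed.

Lemma comp_hi_eq (U : set R) s t : s <= t -> seg s t `<=` U -> comp_hi R U s = comp_hi R U t.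
Proof.
move=> st stU; congr sup; apply/seteqP; split => b /= bU r /= /andP[r1 r2].
  by apply: bU; rewrite /= r2 (le_trans st).
have [rt|tr] := leP r t; first by apply: stU; rewrite /= r1 rt.
by apply: bU; rewrite /= r2 ltW.
Qed.

(** A segment inside an open set can be enlarged to one with rational ends, so the set of pairs is a
    countable union of rectangles, together with the pairs whose segment is empty. *)
Lemma measurable_seg_sub (U : set R) : open U ->
  measurable [set z : R * R | seg z.1 z.2 `<=` U].
Proof.
move=> oU.
have mlt (p q : R) : measurable [set z : R * R | p < z.1 /\ z.2 < q].
  rewrite (_ : [set z | _] = `]p, +oo[%classic `*` `]-oo, q[%classic).
    by apply: measurableX; exact: measurable_itv.
  by apply/seteqP; split => z /=; rewrite !in_itv/= andbT.
rewrite (_ : [set z | _] = [set z : R * R | z.2 < z.1] `|`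
   \bigcup_(p : rat) \bigcup_(q : rat)
   (if `[< seg (ratr p) (ratr q) `<=` U >]
    then [set z : R * R | ratr p < z.1 /\ z.2 < ratr q] else set0)).
  apply: measurableU.
    rewrite -[X in measurable X]setTI.
    by apply: (measurable_fun_ltr (f := snd) (g := fst)) => //.
  by apply: bigcupT_measurable_rat => p; apply: bigcupT_measurable_rat => q; case: ifP.
apply/seteqP; split => -[s t] /=; last first.
  case; first by move=> ts r /= /andP[sr rt]; have := le_lt_trans (le_trans sr rt) ts; rewrite ltxx.
  move=> [p _] [q _]; case: asboolP => //= pqU [ps tq] r /= /andP[sr rt].
  by apply: pqU; rewrite /= (le_trans _ sr) ?(le_trans rt)// ltW.
move=> stU; have [ts|st] := ltP t s; [by left|right].
have [e1 e10 He1] := open_ball_sub oU (stU s ltac:(by rewrite /= lexx st)).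
have [e2 e20 He2] := open_ball_sub oU (stU t ltac:(by rewrite /= lexx st)).
have [p] : exists p : rat, ratr p \in `](s - e1), s[ by apply: rat_in_itvoo; rewrite ltrBlDr ltrDl.
have [q] : exists q : rat, ratr q \in `]t, (t + e2)[ by apply: rat_in_itvoo; rewrite ltrDl.
rewrite !in_itv/= => /andP[tq qt] /andP[sp ps]; exists p => //; exists q => //.
rewrite asboolT//= => r /= /andP[pr rq].
have [rs|sr] := ltP r s; first by apply: He1; rewrite ger0_norm ?subr_ge0 ?ltW//; lra.
have [rt|tr] := leP r t; first by apply: stU; rewrite /= sr rt.
by apply: He2; rewrite distrC ger0_norm ?subr_ge0 ?(ltW tr)//; lra.
Qed.

End components.

Section cumul_additive.
Variable R : realType.
Local Notation mu := (@lebesgue_measure R).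
Variable h : R -> R.
Hypotheses (h0 : forall t, 0 <= h t) (mh : measurable_fun setT h).

Lemma integral_bounded_fin s t M : s <= t -> (forall r, s <= r <= t -> h r <= M) ->
  (\int[mu]_(r in `[s, t]) (h r)%:E)%E \is a fin_num.
Proof.
move=> st hM; rewrite ge0_fin_numE; last by apply: integral_ge0 => r _; rewrite lee_fin.
apply: (@le_lt_trans _ _ (\int[mu]_(r in `[s, t]) (cst M%:E r))%E).
  apply: ge0_le_integral => //; first by move=> r _; rewrite lee_fin.
  exact/measurable_funTS/measurable_EFinP.
rewrite integral_cst//= lebesgue_measure_itv/=; case: ifP => _; last by rewrite mule0 ltry.
by rewrite -EFinB -EFinM ltry.
Qed.

(** The bound [M] keeps the three integrals finite; otherwise the value [0] of an infinite integral
    would break additivity. *)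
Lemma cumulD s r t M : s <= r <= t -> (forall x, s <= x <= t -> h x <= M) ->
  cumul h s t = cumul h s r + cumul h r t.
Proof.
move=> /andP[sr rt] hM; rewrite /cumul /Rintegral -fineD; last 2 first.
- by apply: (integral_bounded_fin (M := M) sr) => x /andP[sx xr]; rewrite hM// sx (le_trans xr).
- by apply: (integral_bounded_fin (M := M) rt) => x /andP[rx xt]; rewrite hM// xt (le_trans sr).
rewrite (_ : `[s, t]%classic = `[s, r]%classic `|` `]r, t]%classic); last first.
  by apply: itv_bndbnd_setU; rewrite bnd_simp.
have mhE A : measurable_fun A (EFin \o h) by exact/measurable_funTS/measurable_EFinP.
rewrite ge0_integral_setU//=.
- by rewrite integral_itv_obnd_cbnd.
- exact: mhE.
- by move=> x _; rewrite lee_fin.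
- apply/disj_setPS => x [] /=; rewrite !in_itv/= => /andP[_ xr] /andP[rx _].
  by have := le_lt_trans xr rx; rewrite ltxx.
Qed.

End cumul_additive.

Lemma is_derive_min_ge0 (R : realType) (g : R -> R) (t v : R) :
  (forall s, g t <= g s) -> is_derive t 1 g v -> 0 <= v.
Proof.
move=> gt gv; have cf := is_derive_seq gv.
by apply: (ler_cvg_to (cvg_cst 0) cf); apply: nearW => n; rewrite mulr_ge0// subr_ge0.
Qed.

Lemma is_derive_min (R : realType) (g : R -> R) (t v : R) :
  (forall s, g t <= g s) -> is_derive t 1 g v -> v = 0.
Proof.
move=> gt gv; apply/eqP; rewrite eq_le (is_derive_min_ge0 gt gv) andbT.
rewrite -oppr_ge0; apply: (@is_derive_min_ge0 _ (g \o -%R) (- t)).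
  by move=> s /=; rewrite opprK.
have gv' : is_derive (- (- t)) 1 g v by rewrite opprK.
have := is_derive1_comp gv' (is_deriveNid (- t) 1).
by rewrite mulrN1.
Qed.

(** * The sets [Psi] and the support of the derivatives *)

Section psi.
Variables (R : realType) (d : nat) (delta : nat -> R -> R).
Variable P : probability (d.-tuple R) R.
Hypotheses (d0 : (0 < d)%N) (Pd : realizes delta P).
Local Notation mu := (@lebesgue_measure R).
Local Notation f i := (derive1 (delta i)).
Local Notation Ps i := (Psi R d delta i).
Local Notation seg s t := [set r : R | s <= r <= t].

(** The boundary values [delta_0 = 1] and [delta_(d+1) = 0] bring the three cases of [Psi] under one
    inequality. *)
Definition deltax i t : R := if i == 0%N then 1 else if i == d.+1 then 0 else delta i t.

Lemma deltaxE i t : (1 <= i <= d)%N -> deltax i t = delta i t.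
Proof. by rewrite /deltax; case: eqP => [|_]; [lia|case: eqP => //; lia]. Qed.

Lemma deltax_continuous i : (i <= d.+1)%N -> continuous (deltax i).
Proof.
move=> id; rewrite /deltax; case: eqP => [_|i0]; first exact: cst_continuous.
by case: eqP => [_|i1]; [exact: cst_continuous|apply: (multidiag_continuous Pd); lia].
Qed.

Lemma gapx_ge0 i t : (1 <= i <= d.+1)%N -> deltax i t <= deltax i.-1 t.
Proof.
move=> id; rewrite /deltax; case: eqP => [|_]; first lia.
case: eqP => [i1|i1].
  case: eqP => [|_]; first by rewrite ler01.
  by case: eqP => [|_]; [lia|apply: (multidiag_ge0 Pd); lia].
case: eqP => [i2|i2]; first by apply: (multidiag_le1 Pd); lia.
by case: eqP => [|_]; [lia|apply: (multidiag_decr Pd); lia].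
Qed.

Lemma PsiP i t : (1 <= i <= d.+1)%N -> Ps i t <-> 0 < t < 1 /\ deltax i t < deltax i.-1 t.
Proof.
move=> id; rewrite /Psi /deltax; have [->|i1] := eqVneq i 1%N.
  rewrite /= (_ : (1 == d.+1)%N = false); last by apply/eqP; lia.
  set E := [set s | _]; have E1 : E 1 by rewrite /E /= ler01 lexx; split => //; exact: (multidiag_ge1 Pd).
  have lbE : has_lbound E by exists 0 => s [/andP[]].
  split=> [/andP[t0 tE]|[/andP[t0 t1] dt]].
    have t1 : t < 1 by apply: (lt_le_trans tE); apply: ge_inf.
    split; first by rewrite t0.
    rewrite lt_neqAle (multidiag_le1 Pd) ?andbT; last lia.
    apply/eqP => dt; have : inf E <= t by apply: ge_inf => //; split => //; rewrite !ltW.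
    by rewrite leNgt tE.
  rewrite t0/=.
  have : \forall s \near t, delta 1%N s < 1.
    have c1 := @multidiag_continuous _ _ _ _ Pd 1%N ltac:(lia) t.
    exact: (cvgr_lt _ c1).
  (* Strict inequality with the infimum needs a point beyond [t] where [delta 1] is still below [1];
     by monotonicity it is a lower bound of [E]. *)
  move=> /nbhs_ballP[e e0 He]; pose t' := t + e / 2.
  have dt' : delta 1%N t' < 1.
    by apply: He; rewrite /ball/= opprD addNKr normrN gtr0_norm ?divr_gt0//; rewrite /= in e0; lra.
  apply: (@lt_le_trans _ _ t'); first by rewrite ltrDl divr_gt0.
  apply: lb_le_inf; first by exists 1.
  move=> s [_ ds]; rewrite leNgt; apply/negP => st'.
  suff : delta 1%N s <= delta 1%N t' by rewrite ds leNgt dt'.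
  by apply: (multidiag_nondecreasing Pd); [lia|exact: ltW].
have [->|id1] := eqVneq i d.+1.
  rewrite /= (_ : (d == 0)%N = false); last by apply/eqP; lia.
  rewrite (_ : (d == d.+1)%N = false); last by apply/eqP; lia.
  set E := [set s | _]; have E0 : E 0 by rewrite /E /= ler01 lexx; split => //; apply: (multidiag_le0 Pd) => //; lia.
  have ubE : has_ubound E by exists 1 => s [/andP[]].
  split=> [/andP[tE t1]|[/andP[t0 t1] dt]].
    have t0 : 0 < t by apply: (le_lt_trans _ tE); apply: ub_le_sup.
    split; first by rewrite t0.
    rewrite lt_neqAle (multidiag_ge0 Pd) ?andbT; last lia.
    apply/eqP => dt; have : t <= sup E by apply: ub_le_sup => //; split => //; rewrite !ltW.
    by rewrite leNgt tE.
  rewrite t1 andbT.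
  have : \forall s \near t, 0 < delta d s.
    have c1 := @multidiag_continuous _ _ _ _ Pd d ltac:(lia) t.
    exact: (cvgr_gt _ c1).
  move=> /nbhs_ballP[e e0 He]; pose t' := t - e / 2.
  have dt' : 0 < delta d t'.
    by apply: He; rewrite /ball/= opprB subrKC gtr0_norm ?divr_gt0//; rewrite /= in e0; lra.
  apply: (@le_lt_trans _ _ t'); last by rewrite ltrBlDr ltrDl divr_gt0.
  apply: ge_sup; first by exists 0.
  move=> s [_ ds]; rewrite leNgt; apply/negP => st'.
  suff : delta d t' <= delta d s by rewrite ds leNgt dt'.
  by apply: (multidiag_nondecreasing Pd); [lia|exact: ltW].
rewrite (_ : (i == 0)%N = false); last by apply/eqP; lia.
rewrite (_ : (i.-1 == 0)%N = false); last by apply/eqP; lia.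
by rewrite (_ : (i.-1 == d.+1)%N = false)//; apply/eqP; lia.
Qed.

Lemma Psi_unit i t : (1 <= i <= d.+1)%N -> Ps i t -> 0 < t < 1.
Proof. by move=> id /(PsiP t id)[]. Qed.

Lemma open_Psi i : (1 <= i <= d.+1)%N -> open (Ps i).
Proof.
move=> id; rewrite (_ : Ps i = `]0, 1[%classic `&`
    (fun t => deltax i.-1 t - deltax i t) @^-1` `]0, +oo[%classic).
  apply: openI; first exact: interval_open.
  apply: open_comp; last exact: interval_open.
  move=> t _; apply: cvgB; apply: deltax_continuous; lia.
apply/seteqP; split => t /=; rewrite !in_itv/= andbT subr_gt0; first by move=> /(PsiP t id).
by move=> H; apply/(PsiP t id).
Qed.

Lemma measurable_Psi i : (1 <= i <= d.+1)%N -> measurable (Ps i).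
Proof. by move=> /open_Psi; exact: open_measurable. Qed.

Lemma ae_neq01 : {ae mu, forall t : R, t != 0 /\ t != 1}.
Proof.
have H (a : R) : {ae mu, forall t : R, t != a}.
  exists [set a]; split; first exact: measurable_set1.
    exact: lebesgue_measure_set1.
  by move=> t /= /negP; rewrite negbK => /eqP.
by apply: lebesgue_aeS2 (H 0) (H 1) => t.
Qed.

Lemma J_integrand_ge0 i t : (2 <= i <= d)%N -> (0 <= J_integrand R delta i t)%E.
Proof.
move=> id; rewrite /J_integrand; case: ifP => _; last by case: ifP.
by rewrite lee_fin mulr_ge0// (multidiag_derive_ge0 Pd)//; lia.
Qed.

Lemma measurable_J_integrand i : (2 <= i <= d)%N -> measurable_fun setT (J_integrand R delta i).
Proof.
move=> id; apply: (emeasurable_fun_cvg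
  (fun n t => (- ln (gap delta n.+1%:R^-1 i t) * f i t)%:E)).
- by move=> n; exact: (measurable_ln_gap Pd).
- by move=> t _; exact: (J_integrand_cvg Pd).
Qed.

Hypothesis Joo : (Jfun R d delta < +oo)%E.

Lemma J_integrand_integrable i : (2 <= i <= d)%N ->
  mu.-integrable setT (J_integrand R delta i).
Proof.
move=> id; apply/integrableP; split; first exact: measurable_J_integrand.
under eq_integral do rewrite gee0_abs ?J_integrand_ge0//.
rewrite -(J_integrand_integral Pd)//; apply: le_lt_trans Joo; rewrite /Jfun.
rewrite (big_rem i) ?mem_index_iota//=.
rewrite leeDl// big_seq sume_ge0// => j jI; apply: integral_ge0 => t _.
by apply: J_integrand_ge0; have := mem_rem jI; rewrite mem_index_iota; lia.
Qed.

(** For [i >= 2] the integrand of [J] is finite almost everywhere, so where the gap vanishes the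
    derivative does too. For [i = 1], the derivative vanishes where [delta 1] attains its maximum
    [1]. *)
Lemma derive_support_lo i : (1 <= i <= d)%N -> {ae mu, forall t : R, f i t != 0 -> Ps i t}.
Proof.
move=> id; have [i1|i1] := eqVneq i 1%N.
  subst i; apply: lebesgue_aeS2 (multidiag_is_derive Pd id) ae_neq01 => t dt [t0 t1] ft.
  have /andP[u0 u1] := multidiag_derive_unitI Pd id ft; apply/PsiP; first lia.
  split; first by rewrite !lt_neqAle u0 u1 eq_sym t0 t1.
  rewrite lt_neqAle gapx_ge0 ?andbT; last lia.
  rewrite deltaxE// /deltax/=; apply: contra ft => /eqP dt1; apply/eqP.
  apply: oppr_inj; rewrite oppr0; apply: (@is_derive_min _ (\- (delta 1%N)) t).
  by move=> s /=; rewrite lerN2 dt1 (multidiag_le1 Pd).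
have id2 : (2 <= i <= d)%N by lia.
have := integrable_ae measurableT (J_integrand_integrable id2).
move=> Jf; apply: lebesgue_aeS2 Jf ae_neq01 => t Jf [t0 t1] ft.
have /andP[u0 u1] := multidiag_derive_unitI Pd id ft; apply/PsiP; first lia.
split; first by rewrite !lt_neqAle u0 u1 eq_sym t0 t1.
rewrite !deltaxE; [|lia..]; have := Jf I; rewrite /J_integrand.
by case: ifP; [rewrite subr_gt0|rewrite (negbTE ft)].
Qed.

(** Where [delta_i - delta_(i+1)] vanishes it is minimal, so the two derivatives agree there, and
    that of [delta_(i+1)] is [0] by the previous lemma. For [i = d], the minimum [0] of [delta d]
    plays this role. *)
Lemma derive_support_hi i : (1 <= i <= d)%N -> {ae mu, forall t : R, f i t != 0 -> Ps i.+1 t}.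
Proof.
move=> id; have [i1|i1] := eqVneq i d.
  apply: lebesgue_aeS2 (multidiag_is_derive Pd id) ae_neq01 => t dt [t0 t1] ft.
  have /andP[u0 u1] := multidiag_derive_unitI Pd id ft; apply/PsiP; first lia.
  split; first by rewrite !lt_neqAle u0 u1 eq_sym t0 t1.
  rewrite lt_neqAle gapx_ge0 ?andbT; last lia.
  rewrite [X in _ != X]deltaxE// /deltax i1 eqxx/= -i1.
  apply: contra ft => /eqP dt1; apply/eqP.
  apply: (@is_derive_min _ (delta i) t) => // s.
  by rewrite -dt1 (multidiag_ge0 Pd).
have id2 : (1 <= i.+1 <= d)%N by lia.
have H1 : {ae mu, forall t : R, is_derive t 1 (delta i) (f i t) /\
    is_derive t 1 (delta i.+1) (f i.+1 t)}.
  by apply: lebesgue_aeS2 (multidiag_is_derive Pd id) (multidiag_is_derive Pd id2) => t.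
have H2 : {ae mu, forall t : R, (t != 0 /\ t != 1) /\ (f i.+1 t != 0 -> Ps i.+1 t)}.
  by apply: lebesgue_aeS2 ae_neq01 (derive_support_lo id2) => t.
apply: lebesgue_aeS2 H1 H2 => t [d1 d2] [[t0 t1] lo] ft.
have [f0|/lo//] := eqVneq (f i.+1 t) 0.
have /andP[u0 u1] := multidiag_derive_unitI Pd id ft; apply/PsiP; first lia.
split; first by rewrite !lt_neqAle u0 u1 eq_sym t0 t1.
rewrite lt_neqAle gapx_ge0 ?andbT; last lia.
rewrite !deltaxE//; apply: contra ft => /eqP dE; apply/eqP.
suff : f i t - f i.+1 t = 0 by rewrite f0 subr0.
apply: (@is_derive_min _ (delta i - delta i.+1) t).
move=> s; rewrite /= !fctE -dE subrr subr_ge0.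
by have := @multidiag_decr _ _ _ _ Pd i.+1 s; apply; lia.
Qed.

Lemma derive_support i : (1 <= i <= d)%N ->
  {ae mu, forall t : R, f i t != 0 -> Ps i t /\ Ps i.+1 t}.
Proof.
move=> id; apply: lebesgue_aeS2 (derive_support_lo id) (derive_support_hi id) => t lo hi ft.
by split; [exact: lo|exact: hi].
Qed.

End psi.

Section approach.
Variable R : realType.

Lemma approach_hi (a b : R) : a < b -> exists u : nat -> R,
  [/\ {homo u : n m / (n <= m)%N >-> n <= m}, forall n, a < u n < b,
      u n @[n --> \oo] --> b & `[a, b[%classic = \bigcup_n `[a, u n]%classic].
Proof.
move=> ab; pose u n : R := b - (b - a) / 2 * n.+1%:R^-1; exists u.
have c0 : 0 < (b - a) / 2 by rewrite divr_gt0// subr_gt0.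
have ub n : a < u n < b.
  have i0 : 0 < n.+1%:R^-1 :> R by rewrite invr_gt0.
  have i1 : n.+1%:R^-1 <= 1 :> R by rewrite invf_le1// ler1n.
  have := ler_wpM2l (ltW c0) i1; have := mulr_gt0 c0 i0; rewrite /u mulr1.
  by move: ((b - a) / 2 * _) => x x0 xb; rewrite ltrBlDr ltrDl x0 andbT; lra.
have cu : u n @[n --> \oo] --> b.
  rewrite -[X in _ --> X](subr0 b) -(mulr0 ((b - a) / 2)).
  apply: cvgB; first exact: cvg_cst.
  by apply: cvgM; [exact: cvg_cst|exact: cvg_harmonic].
split => // [n m nm|].
  by rewrite lerD2l lerN2 ler_pM2l// lef_pV2 ?posrE// ler_nat ltnS.
apply/seteqP; split => t /=; rewrite in_itv/=.
  move=> /andP[at_ tb]; have [n _ /(_ n (leqnn n)) /= tu] := cvgr_gt _ cu _ tb.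
  by exists n => //=; rewrite in_itv/= at_ ltW.
move=> [n _ /=]; rewrite in_itv/= => /andP[-> tu] /=.
by have /andP[_] := ub n; apply: le_lt_trans.
Qed.

Lemma approach_lo (a b : R) : a < b -> exists u : nat -> R,
  [/\ {homo u : n m / (n <= m)%N >-> m <= n}, forall n, a < u n < b,
      u n @[n --> \oo] --> a & `]a, b]%classic = \bigcup_n `[u n, b]%classic].
Proof.
rewrite -ltrN2 => /approach_hi[u [um ub cu Uu]]; exists (fun n => - u n); split.
- by move=> n m nm; rewrite lerN2 um.
- by move=> n; rewrite ltrNr ltrNl andbC.
- by rewrite -[X in _ --> X]opprK; exact: cvgN.
- apply/seteqP; split => t /= H.
    have : `[- b, - a[%classic (- t) by move: H; rewrite /= !in_itv/= lerN2 ltrN2 andbC.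
    by rewrite Uu => -[n _ /= un]; exists n => //=; move: un; rewrite !in_itv/= lerN2 lerNl andbC.
  case: H => n _ /= un.
  have : `[- b, - a[%classic (- t).
    by rewrite Uu; exists n => //=; move: un; rewrite !in_itv/= lerN2 lerNl andbC.
  by rewrite /= !in_itv/= lerN2 ltrN2 andbC.
Qed.

End approach.

(** * The differential equation of the gaps *)

Section hazard_ode.
Variables (R : realType) (d : nat) (delta : nat -> R -> R).
Variable P : probability (d.-tuple R) R.
Hypotheses (d0 : (0 < d)%N) (Pd : realizes delta P).
Local Notation mu := (@lebesgue_measure R).
Local Notation f i := (derive1 (delta i)).
Local Notation Ps i := (Psi R d delta i).
Local Notation h i := (haz delta 0 i).
Local Notation D i t := (delta i.-1 t - delta i t).
Local Notation seg s t := [set r : R | s <= r <= t].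
Variable i : nat.
Hypothesis id : (2 <= i <= d)%N.

Let id1 : (1 <= i <= d)%N. Proof. by lia. Qed.
Let id2 : (1 <= i.-1 <= d)%N. Proof. by lia. Qed.
Let id3 : (1 <= i <= d.+1)%N. Proof. by lia. Qed.
Let h0 t : 0 <= h i t. Proof. exact: (haz_ge0 Pd). Qed.
Let mh : measurable_fun setT (h i). Proof. exact: (measurable_haz Pd). Qed.

Lemma haz0E t : h i t = f i t / D i t.
Proof. by rewrite /haz /gap max_l// subr_ge0 (multidiag_decr Pd). Qed.

Lemma Psi_gap t : Ps i t <-> 0 < t < 1 /\ 0 < D i t.
Proof. by rewrite subr_gt0 -(deltaxE delta d0 t id1) -(deltaxE delta d0 t id2); exact: (PsiP d0 Pd). Qed.

Lemma gap_continuous : continuous (fun t => D i t).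
Proof. by move=> t; apply: cvgB; apply: (multidiag_continuous Pd). Qed.

Lemma gap_cvg (u : nat -> R) (b : R) :
  u n @[n --> \oo] --> b -> D i (u n) @[n --> \oo] --> D i b.
Proof. by move=> cu; apply: cvgB; apply: continuous_cvg => //; apply: (multidiag_continuous Pd). Qed.

Lemma gap_notin_Psi (t : R) : 0 <= t <= 1 -> ~ Ps i t -> D i t = 0.
Proof.
move=> /andP[t0 t1] nP; have [->|tn0] := eqVneq t 0.
  by rewrite !(multidiag_le0 Pd)// subrr.
have [->|tn1] := eqVneq t 1; first by rewrite !(multidiag_ge1 Pd)// subrr.
apply/eqP; rewrite eq_le subr_ge0 (multidiag_decr Pd)// andbT leNgt; apply/negP => Dt.
by apply/nP/Psi_gap; split => //; rewrite !lt_neqAle t0 t1 eq_sym tn0 tn1.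
Qed.

(** The gap is continuous and positive on the compact segment, hence bounded below by its
    minimum. *)
Lemma haz_bounded (x y : R) : x <= y -> seg x y `<=` Ps i ->
  exists M, forall r, x <= r <= y -> h i r <= M.
Proof.
move=> xy xyP; have [c cxy cmin] := EVT_min xy (continuous_subspaceT gap_continuous).
have Dc : 0 < D i c by have /Psi_gap[] : Ps i c by apply: xyP; move: cxy; rewrite in_itv.
exists (d%:R / D i c) => r rxy; have /Psi_gap[_ Dr] := xyP _ rxy.
have /andP[f0 fd] := multidiag_derive_bound Pd r id1.
rewrite haz0E ler_pM ?invr_ge0 ?(ltW Dr)// lef_pV2 ?posrE//.
by apply: cmin; rewrite in_itv.
Qed.

(** As [D' + h D = f_(i-1)] on [Psi_i], this is variation of constants; additivity of [cumul] moves
    the reference point of the integrating factor from [s] to [t]. *)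
Lemma gap_ode (s t : R) : s < t -> seg s t `<=` Ps i ->
  (\int[mu]_(r in `[s, t]) (f i.-1 r * expR (- cumul (h i) r t))%:E =
   (D i t - D i s * expR (- cumul (h i) s t))%:E)%E.
Proof.
move=> st stP; have [M hM] := haz_bounded (ltW st) stP.
have DL (x y : R) : `|D i x - D i y| <= (2 * d%:R) * `|x - y|.
  rewrite (_ : D i x - D i y = (delta i.-1 x - delta i.-1 y) - (delta i x - delta i y)).
    rewrite (le_trans (ler_normB _ _))//.
    have := multidiag_lipschitz Pd id2 x y; have := multidiag_lipschitz Pd id1 x y.
    by rewrite mulr_natl mulr2n mulrDl; lra.
  by lra.
have DM (x : R) : `|D i x| <= 1.
  rewrite ler_norml; have := multidiag_ge0 Pd x id1; have := multidiag_ge0 Pd x id2.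
  by have := multidiag_le1 Pd x id1; have := multidiag_le1 Pd x id2; lra.
have mD' : measurable_fun setT (fun x => f i.-1 x - f i x).
  by apply: measurable_funB; apply: (measurable_multidiag_derive Pd).
have dD : {ae mu, forall x : R, is_derive x 1 (fun t => D i t) (f i.-1 x - f i x)}.
  apply: lebesgue_aeS2 (multidiag_is_derive Pd id2) (multidiag_is_derive Pd id1) => x dx dy.
  exact: is_deriveB.
have hM' x : s <= x <= t -> `|h i x| <= M by move=> xst; rewrite ger0_norm// hM.
have : (\int[mu]_(r in `[s, t]) (f i.-1 r * expR (cumul (h i) s r))%:E =
    (D i t * expR (cumul (h i) s t) - D i s)%:E)%E.
  apply: etrans (linear_ode_integral st DL DM mD' dD mh hM').
  apply: eq_integral => r; rewrite inE /= in_itv/= => rst; congr (_ * _)%:E.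
  have /Psi_gap[_ Dr] := stP _ rst.
  by rewrite haz0E [D i r * _]mulrC divfK ?gt_eqF// subrK.
move=> /(congr1 (fun z => (expR (- cumul (h i) s t))%:E * z)%E).
rewrite -ge0_integralZl//; last 2 first.
- apply/measurable_funTS/measurable_EFinP/measurable_funM.
    exact: (measurable_multidiag_derive Pd).
  apply: (measurableT_comp (@measurable_expR R)).
  exact: (measurable_fun_comp2 (measurable_cumul h0 mh) (measurable_cst s)).
- by move=> r _; rewrite lee_fin mulr_ge0 ?expR_ge0// (multidiag_derive_ge0 Pd).
rewrite -EFinM mulrBr mulrCA -/(cumul (h i) s t) -expRD addNr expR0 mulr1 => H.
rewrite [expR _ * D i s]mulrC in H; rewrite -{}H.
apply: eq_integral => r; rewrite inE /= in_itv/= => rst.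
rewrite -EFinM mulrCA -expRD; congr (_ * expR _)%:E.
by rewrite (@cumulD _ _ h0 mh s r t M rst hM); lra.
Qed.

Lemma gap_expR_le (s t : R) : s < t -> seg s t `<=` Ps i ->
  D i s * expR (- cumul (h i) s t) <= D i t.
Proof.
move=> st stP; rewrite -subr_ge0 -lee_fin -(gap_ode st stP).
apply: integral_ge0 => r _.
by rewrite lee_fin mulr_ge0 ?expR_ge0// (multidiag_derive_ge0 Pd).
Qed.

(** The survival function is at most [D t / D s], and [D] vanishes at the right end of the
    component: the next point almost surely occurs before that end. *)
Lemma hazard_mass s : Ps i s ->
  (\int[mu]_(t in `[s, comp_hi R (Ps i) s[) (h i t * expR (- cumul (h i) s t))%:E = 1)%E.
Proof.
move=> Ps_s; have oU := open_Psi d0 Pd id3.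
have /andP[s0 s1] := Psi_unit d0 Pd id3 Ps_s.
have n1 : ~ Ps i 1 by move=> /(Psi_unit d0 Pd id3); rewrite ltxx andbF.
have [b1 sb nb bP] := comp_hiP oU (ltW s1) n1 Ps_s; set b := comp_hi R (Ps i) s in b1 sb nb bP *.
have Db : D i b = 0 by apply: gap_notin_Psi => //; rewrite b1 (ltW (lt_trans s0 sb)).
have Ds : 0 < D i s by have /Psi_gap[] := Ps_s.
have [u [um ub cu Uu]] := approach_hi sb.
have cv := @cvg_integral_itv R _ (fun _ => s) u _ (measurable_hazard s h0 mh)
  (fun t => ltac:(by rewrite lee_fin mulr_ge0 ?expR_ge0)) (fun _ _ _ => lexx s) um Uu.
apply: (cvg_unique _ cv) => //.
have usP n : seg s (u n) `<=` Ps i by have /andP[su uB] := ub n; apply/bP => //; exact: ltW.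
rewrite (_ : (fun n => _) = (fun n => (1 - expR (- cumul (h i) s (u n)))%:E)); last first.
  apply/funext => n; have /andP[su uB] := ub n; have [M hM] := haz_bounded (ltW su) (usP n).
  exact: (integral_hazard h0 mh su hM).
apply: cvg_EFin; first exact: nearW.
rewrite -[X in _ --> X](subr0 (1 : R)); apply: cvgB; first exact: cvg_cst.
have cD : D i (u n) / D i s @[n --> \oo] --> (0 : R).
  by rewrite -(mul0r (D i s)^-1) -Db; apply: cvgMr_tmp; exact: gap_cvg.
apply: (squeeze_cvgr _ (cvg_cst 0) cD); apply: nearW => n; rewrite expR_ge0/=.
have /andP[su uB] := ub n.
by rewrite ler_pdivlMr// mulrC gap_expR_le.
Qed.

(** The initial term of [gap_ode] disappears because [D] vanishes at the left end of the
    component. *)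
Lemma hazard_forward t : Ps i t ->
  (\int[mu]_(s in `]comp_lo R (Ps i) t, t]) (f i.-1 s * expR (- cumul (h i) s t))%:E =
   (D i t)%:E)%E.
Proof.
move=> Ps_t; have oU := open_Psi d0 Pd id3.
have /andP[t0 t1] := Psi_unit d0 Pd id3 Ps_t.
have n0 : ~ Ps i 0 by move=> /(Psi_unit d0 Pd id3); rewrite ltxx.
have [a0 at_ na aP] := comp_loP oU (ltW t0) n0 Ps_t; set a := comp_lo R (Ps i) t in a0 at_ na aP *.
have Da : D i a = 0 by apply: gap_notin_Psi => //; rewrite a0 (ltW (lt_trans at_ t1)).
have [u [um ub cu Uu]] := approach_lo at_.
have mg : measurable_fun setT (fun s => (f i.-1 s * expR (- cumul (h i) s t))%:E).
  apply/measurable_EFinP/measurable_funM; first exact: (measurable_multidiag_derive Pd).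
  apply: (measurableT_comp (@measurable_expR R)); apply: measurable_funN.
  exact: (measurable_fun_comp2 (measurable_cumul h0 mh) _ (measurable_cst t)).
have cv := @cvg_integral_itv R _ u (fun _ => t) _ mg
  (fun s => ltac:(by rewrite lee_fin mulr_ge0 ?expR_ge0// (multidiag_derive_ge0 Pd))) um
  (fun _ _ _ => lexx t) Uu.
apply: (cvg_unique _ cv) => //.
rewrite (_ : (fun n => _) = (fun n => (D i t - D i (u n) * expR (- cumul (h i) (u n) t))%:E)); last first.
  apply/funext => n; have /andP[su uB] := ub n; apply: gap_ode => //.
  by apply/aP => //; exact: ltW.
apply: cvg_EFin; first exact: nearW.
rewrite -[X in _ --> X](subr0 (D i t)); apply: cvgB; first exact: cvg_cst.
have cD : D i (u n) @[n --> \oo] --> (0 : R) by rewrite -Da; exact: gap_cvg.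
have D0 n : 0 <= D i (u n) by rewrite subr_ge0 (multidiag_decr Pd).
apply: (squeeze_cvgr _ (cvg_cst 0) cD); apply: nearW => n.
rewrite mulr_ge0 ?expR_ge0//= ler_piMr// -expR0 ler_expR oppr_le0.
exact: cumul_ge0.
Qed.

End hazard_ode.

Lemma measurable_asbool disp (T : measurableType disp) (A : set T) :
  measurable A -> measurable_fun setT (fun x => `[< A x >]).
Proof.
move=> mA; apply: (measurable_fun_bool true).
rewrite setTI (_ : _ @^-1` _ = A)//; apply/seteqP; split => x /=; first by move/asboolP.
by move=> Ax; apply/asboolP.
Qed.

(** * [c_delta] as the density of a sorted Markov chain *)

Section cdelta.
Variables (R : realType) (d : nat) (delta : nat -> R -> R).
Variable P : probability (d.-tuple R) R.
Hypotheses (d0 : (0 < d)%N) (Pd : realizes delta P).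
Local Notation mu := (@lebesgue_measure R).
Local Notation X := (ordstat R d).
Local Notation f i := (derive1 (delta i)).
Local Notation Ps i := (Psi R d delta i).
Local Notation h i := (haz delta 0 i).
Local Notation K i t := (Kfun R d delta i t).
Local Notation seg s t := [set r : R | s <= r <= t].

(** For [j >= 2] the closed segment must stay in [Psi_j], so that both ends lie in one component;
    the first state has only its own position to check. *)
Definition segmask j s t : bool :=
  if j == 1%N then `[< Ps 1 t /\ Ps 2 t >] else `[< seg s t `<=` Ps j /\ Ps j.+1 t >].

Local Notation k := (kern d delta 0 segmask).

Let k0 j s t : 0 <= k j s t. Proof. exact: (kern_ge0 Pd). Qed.

Lemma measurable_kern_mask j : measurable_fun [set: R * R] (fun z => k j z.1 z.2).
Proof.
have [j1|jn] := boolP (1 <= j <= d)%N; last first.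
  rewrite (_ : (fun z => _) = cst 0); first exact: measurable_cst.
  by apply/funext => z; rewrite /kern (negbTE jn) mul0r.
have msnd i : (1 <= i <= d.+1)%N -> measurable [set z : R * R | Ps i z.2].
  move=> id; rewrite -[X in measurable X]setTI.
  by apply: (@measurable_snd _ _ R R) => //; exact: (measurable_Psi d0 Pd).
apply: (measurable_kern Pd); rewrite /segmask; case: eqP => [_|j2].
  apply: (measurable_asbool (A := [set z : R * R | Ps 1 z.2] `&` [set z | Ps 2 z.2])).
  by apply: measurableI; apply: msnd; lia.
apply: (measurable_asbool (A := [set z : R * R | seg z.1 z.2 `<=` Ps j] `&` [set z | Ps j.+1 z.2])).
apply: measurableI; last by apply: msnd; lia.
by apply: measurable_seg_sub; apply: (open_Psi d0 Pd); lia.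
Qed.

Lemma Kp_haz i : (2 <= i <= d)%N -> Kp R delta i = h i.
Proof.
move=> id; apply/funext => t; rewrite (haz0E Pd id) /Kp /delta0.
by case: eqP => //; lia.
Qed.

Lemma KfunE i t : (2 <= i <= d)%N ->
  let m := (comp_lo R (Ps i) t + comp_hi R (Ps i) t) / 2 in
  K i t = if m <= t then cumul (h i) m t else - cumul (h i) t m.
Proof.
move=> id m; rewrite /Kfun (_ : (i == d.+1) = false); last by apply/eqP; lia.
rewrite (_ : (i == 1)%N = false); last by apply/eqP; lia.
rewrite (Kp_haz id) /cumul /Rintegral -/m.
have segE a b : [set s : R | a <= s <= b] = `[a, b]%classic.
  by apply/seteqP; split => s /=; rewrite in_itv.
by rewrite !segE.
Qed.

(** Both points have the same component, hence the same midpoint, which cancels. The three cases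
    place it left of, between, or right of the two points. *)
Lemma Kfun_diff i s t : (2 <= i <= d)%N -> s <= t -> seg s t `<=` Ps i ->
  K i t - K i s = cumul (h i) s t.
Proof.
move=> id st stP; rewrite !KfunE// (comp_lo_eq st stP) (comp_hi_eq st stP).
have id3 : (1 <= i <= d.+1)%N by lia.
have oU := open_Psi d0 Pd id3.
have h0 r : 0 <= h i r by exact: (haz_ge0 Pd).
have mh : measurable_fun setT (h i) by exact: (measurable_haz Pd).
have Pt : Ps i t by apply: stP; rewrite /= st lexx.
have Pss : Ps i s by apply: stP; rewrite /= st lexx.
have /andP[t0 t1] := Psi_unit d0 Pd id3 Pt.
have /andP[s0 s1] := Psi_unit d0 Pd id3 Pss.
have n0 : ~ Ps i 0 by move=> /(Psi_unit d0 Pd id3); rewrite ltxx.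
have n1 : ~ Ps i 1 by move=> /(Psi_unit d0 Pd id3); rewrite ltxx andbF.
have [_ at_ _ aP] := comp_loP oU (ltW t0) n0 Pt.
have [_ sb _ bP] := comp_hiP oU (ltW s1) n1 Pss.
have [_ tb _ _] := comp_hiP oU (ltW t1) n1 Pt.
rewrite (comp_hi_eq st stP) in sb bP.
set a := comp_lo R (Ps i) t in at_ aP *; set b := comp_hi R (Ps i) t in tb sb bP *.
have am : a < (a + b) / 2 by lra.
have mb : (a + b) / 2 < b by lra.
set m := (a + b) / 2 in am mb *.
have [ms|sm] := leP m s.
  have mt := le_trans ms st.
  have [M hM] := haz_bounded d0 Pd id mt ((aP _ mt).2 am).
  by rewrite mt (@cumulD _ _ h0 mh m s t M) ?ms// addrAC subrr add0r.
have [mt|tm] := leP m t.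
  have [M hM] := haz_bounded d0 Pd id st stP.
  by rewrite opprK (@cumulD _ _ h0 mh s m t M) ?(ltW sm)// addrC.
have [M hM] := haz_bounded d0 Pd id (ltW sm) ((bP _ (ltW sm)).2 mb).
by rewrite opprK (@cumulD _ _ h0 mh s t m M) ?st ?(ltW tm)// addrC addrK.
Qed.

(** [K_1 = - ln (1 - delta_1)]: the function [1 - delta_1] solves the homogeneous equation with
    coefficient [K_1'], and equals [1] at [0]. *)
Lemma expR_Kfun1 t : Ps 1 t -> Kp R delta 1 t * expR (- K 1 t) = f 1 t.
Proof.
have i1 : (1 <= 1 <= d)%N by lia.
move=> Pt; have /(PsiP d0 Pd t)[] := Pt; first by lia.
rewrite (deltaxE delta d0) // /deltax /= => /andP[t0 t1] dt.
have dlt r : r <= t -> 0 < 1 - delta 1%N r.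
  by move=> rt; rewrite subr_gt0 (le_lt_trans _ dt)// (multidiag_nondecreasing Pd).
have DL (x y : R) : `|(1 - delta 1%N x) - (1 - delta 1%N y)| <= d%:R * `|x - y|.
  rewrite (_ : _ - _ = delta 1%N y - delta 1%N x); last by lra.
  by rewrite [`|x - y|]distrC; exact: (multidiag_lipschitz Pd).
have DM (x : R) : `|1 - delta 1%N x| <= 1.
  rewrite ler_norml; have := multidiag_ge0 Pd x i1; have := multidiag_le1 Pd x i1; lra.
have mf := measurable_multidiag_derive Pd i1.
have mD' : measurable_fun setT (fun x => - f 1 x) by exact: measurable_funN.
have dD : {ae mu, forall x : R, is_derive x 1 (fun t => 1 - delta 1%N t) (- f 1 x)}.
  apply: lebesgue_aeS (multidiag_is_derive Pd i1) => x dx.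
  by rewrite -[X in is_derive _ _ _ X]add0r; exact: is_deriveB.
have mKp : measurable_fun setT (Kp R delta 1).
  rewrite /Kp /delta0/=; apply: measurable_funM => //; apply: measurable_funV_ge0.
    by move=> x; rewrite subr_ge0 (multidiag_le1 Pd).
  by apply: measurable_funB => //; exact: (measurable_multidiag Pd).
have KpM x : 0 <= x <= t -> `|Kp R delta 1 x| <= d%:R / (1 - delta 1%N t).
  move=> /andP[x0 xt]; have /andP[f0 fd] := multidiag_derive_bound Pd x i1.
  rewrite /Kp /delta0/= ger0_norm; last by rewrite divr_ge0// ltW// dlt.
  rewrite ler_pM// ?invr_ge0 ?(ltW (dlt _ xt))// lef_pV2 ?posrE ?dlt//.
  by rewrite lerD2l lerN2 (multidiag_nondecreasing Pd).
have := linear_ode_integral t0 DL DM mD' dD mKp KpM.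
have -> : (\int[mu]_(r in `[0, t]) Kp R delta 1 r)%R = K 1 t.
  rewrite /Kfun (_ : (1 == d.+1)%N = false); last by apply/eqP; lia.
  by rewrite /= (ltW t0) /Rintegral; congr (fine (integral _ _ _)).
rewrite integral0_eq; last first.
  move=> r; rewrite /= in_itv/= => /andP[r0 rt].
  rewrite /Kp /delta0/= [(1 - _) * _]mulrC divfK ?addNr ?mul0r//.
  by rewrite gt_eqF// dlt.
rewrite (multidiag_le0 Pd i1 (lexx 0)) subr0 => -[/esym/eqP]; rewrite subr_eq0 => /eqP eK.
have eV : (expR (K 1 t))^-1 = 1 - delta 1%N t.
  have en : expR (K 1 t) != 0 by rewrite gt_eqF// expR_gt0.
  by rewrite -[RHS](mulfK en) eK mul1r.
rewrite /Kp /delta0/= expRN eV.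
by rewrite divfK// gt_eqF// dlt.
Qed.

Definition good x := forall i, (1 <= i <= d)%N -> Ps i (X x i) /\ Ps i.+1 (X x i).

Lemma good_cube x : good x -> cube R d x.
Proof.
move=> gx j; have : tnth x j \in sort <=%R x by rewrite mem_sort mem_tnth.
move=> /(nthP 0)[n]; rewrite size_sort size_tuple => nd <-.
have id : (1 <= n.+1 <= d)%N by lia.
have [/(Psi_unit d0 Pd) + _] := gx _ id.
by rewrite /ordstat/= => /(_ ltac:(lia))/andP[/ltW -> /ltW ->].
Qed.

Lemma good_seg x i : good x -> Lset R d delta x -> (2 <= i <= d)%N ->
  seg (X x i.-1) (X x i) `<=` Ps i.
Proof.
move=> gx [_ Lx] id r /= /andP[]; rewrite le_eqVlt => /predU1P[<- _|ar].
  have [|_] := gx i.-1; first lia.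
  by rewrite prednK//; lia.
rewrite le_eqVlt => /predU1P[->|rb]; first by have [] := gx i ltac:(lia).
by apply: (Lx i id); rewrite /= ar rb.
Qed.

Lemma chain_neq0_good x : chain k 1 0 (sortt x) != 0 -> good x /\ Lset R d delta x.
Proof.
rewrite chain_sortt prodf_seq_neq0 => /allP H.
have {}H i : (1 <= i <= d)%N -> segmask i (if i == 1%N then 0 else X x i.-1) (X x i).
  move=> id; have := H i; rewrite mem_index_iota => /(_ id) /=.
  by rewrite /kern; case: (segmask _ _ _) => //; rewrite andbF mul0r eqxx.
have gx : good x.
  move=> i id; have := H i id; rewrite /segmask; have [->|/eqP i1] := eqVneq i 1%N.
    by move/asboolP.
  move=> /asboolP[sP Pi]; split => //; apply: sP => /=.
  by rewrite lexx andbT; apply: ordstat_le; lia.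
split => //; split; first exact: good_cube.
move=> i id; have := H i ltac:(lia); rewrite /segmask; case: eqP => [|i1]; first lia.
move=> /asboolP[sP _] r /= /andP[r1 r2]; apply: sP => /=.
by rewrite !ltW.
Qed.

(** The exponents of the [a_i] regroup: [K_(i+1)] at [X_i], from one factor, meets [- K_(i+1)] at
    [X_(i+1)], from the next, and the difference is the integrated rate between the two points. *)
Lemma c_deltaE x : c_delta R d delta x = (d`!%:R)^-1 * chain k 1 0 (sortt x).
Proof.
rewrite /c_delta -mulrA; congr (_ * _).
have [[gx Lx]|nG] := pselect (good x /\ Lset R d delta x); last first.
  transitivity (0 : R); last first.
    by apply/esym; apply: contrapT => /eqP /chain_neq0_good.
  apply: contrapT => /eqP; rewrite mulf_eq0 negb_or => /andP[iL].
  rewrite prodf_seq_neq0 => /allP H; apply: nG; split; last first.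
    by apply: contrapT => nL; move: iL; rewrite indicE memNset ?eqxx.
  move=> i id; have := H i; rewrite mem_index_iota => /(_ id) /=.
  rewrite /afun mulf_eq0 negb_or indicE => /andP[_].
  by have [/set_mem[]//|_] := boolP (_ \in _); rewrite eqxx.
rewrite indicE mem_set// mul1r chain_sortt.
(* The exponential on the right is the half of a pair still waiting for the next factor; at [n = d]
   it is [1] since [K_(d+1) = 0]. *)
suff H n : (n <= d)%N -> \prod_(1 <= i < n.+1) afun R d delta i (X x i) =
    (\prod_(1 <= i < n.+1) k i (if i == 1%N then 0 else X x i.-1) (X x i)) *
    (if n == 0%N then 1 else expR (K n.+1 (X x n))).
  rewrite H// gtn_eqF// /Kfun eqxx expR0 mulr1//.
elim: n => [_|n IH nd]; first by rewrite !big_geq// mulr1.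
rewrite (big_nat_recr n.+1)//= [in RHS](big_nat_recr n.+1)//= IH; last lia.
rewrite -[LHS]mulrA -[RHS]mulrA; congr (_ * _); have id : (1 <= n.+1 <= d)%N by lia.
rewrite /afun indicE mem_set ?mulr1; last exact: (gx _ id).
rewrite eqSS; have [n0|n0] := eqVneq n 0%N.
  subst n; have [P1 P2] := gx 1%N id.
  rewrite /kern id /segmask /= asboolT// !mul1r expRD mulrCA mulrC; congr (_ * _).
  exact: expR_Kfun1.
have id2 : (2 <= n.+1 <= d)%N by lia.
have sg := good_seg gx Lx id2; have [_ P2] := gx n.+1 id.
have st : X x n <= X x n.+1 by apply: ordstat_le; lia.
have -> : k n.+1 (X x n) (X x n.+1) =
    h n.+1 (X x n.+1) * expR (- cumul (h n.+1) (X x n) (X x n.+1)).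
  by rewrite /kern id /segmask eqSS (negbTE n0) asboolT// !mul1r st mul1r.
rewrite (Kp_haz id2).
move: (h n.+1 (X x n.+1)) => hx; rewrite mulrCA -[RHS]mulrA; congr (_ * _).
rewrite -(Kfun_diff id2 st sg) -!expRD; congr expR.
by move: (K n.+1 (X x n)) (K n.+2 (X x n.+1)) (K n.+1 (X x n.+1)) => u v w; lra.
Qed.

End cdelta.

(** * The law with density [c_delta] *)

Section cdelta_law.
Variables (R : realType) (d : nat) (delta : nat -> R -> R).
Variable P : probability (d.-tuple R) R.
Hypotheses (d0 : (0 < d)%N) (Pd : realizes delta P).
Hypothesis Joo : (Jfun R d delta < +oo)%E.
Local Notation mu := (@lebesgue_measure R).
Local Notation X := (ordstat R d).
Local Notation f i := (derive1 (delta i)).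
Local Notation Ps i := (Psi R d delta i).
Local Notation h i := (haz delta 0 i).
Local Notation D i t := (delta i.-1 t - delta i t).
Local Notation k := (kern d delta 0 (segmask d delta)).
Local Notation seg s t := [set r : R | s <= r <= t].
Local Notation cd := (c_delta R d delta).

Let k0 j s t : 0 <= k j s t. Proof. exact: (kern_ge0 Pd). Qed.
Let mk j : measurable_fun [set: R * R] (fun z => k j z.1 z.2).
Proof. exact: (measurable_kern_mask d0 Pd). Qed.

(** Almost everywhere this is [f j]. The indicator makes the forward equation hold at every point,
    since the masked kernels vanish off it. *)
Definition state_density j t : R :=
  ((1 <= j <= d)%N && `[< Ps j t /\ Ps j.+1 t >])%:R * f j t.
Local Notation p := state_density.

Lemma state_density_ge0 j t : 0 <= p j t.
Proof.
rewrite /p; have [j1|] := boolP (1 <= j <= d)%N; last by rewrite mul0r.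
by rewrite mulr_ge0// (multidiag_derive_ge0 Pd).
Qed.

Lemma measurable_state_density j : measurable_fun setT (p j).
Proof.
rewrite /p; have [j1|] := boolP (1 <= j <= d)%N; last first.
  by move=> _; rewrite (_ : (fun t => _) = cst 0) //; apply/funext => t; rewrite mul0r.
apply: measurable_funM; last exact: (measurable_multidiag_derive Pd).
apply: measurable_natr_bool; apply: (measurable_asbool (A := Ps j `&` Ps j.+1)).
by apply: measurableI; apply: (measurable_Psi d0 Pd); lia.
Qed.

Lemma state_density_ae j : (1 <= j <= d)%N -> {ae mu, forall t : R, p j t = f j t}.
Proof.
move=> j1; apply: lebesgue_aeS (derive_support d0 Pd Joo j1) => t H.
rewrite /p j1 /=; have [->|/H Pt] := eqVneq (f j t) 0; first by rewrite mulr0.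
by rewrite asboolT// mul1r.
Qed.

Lemma kern_succE j s t : (0 < j < d)%N ->
  k j.+1 s t = (`[< seg s t `<=` Ps j.+1 /\ Ps j.+2 t >] && (s <= t))%:R *
    (h j.+1 t * expR (- cumul (h j.+1) s t)).
Proof.
move=> jd; rewrite /kern /segmask (_ : (1 <= j.+1 <= d)%N); last lia.
rewrite (_ : (j.+1 == 1)%N = false) /=; last by apply/eqP; lia.
by case: (`[< _ >]); case: (s <= t); rewrite ?mul1r ?mul0r.
Qed.

(** The mask cuts [[s, oo[] down to the rest of the component. It also demands membership in the
    following [Psi], which holds at almost every point where the rate is not [0]. *)
Lemma kern_mass j s : (0 < j < d)%N -> Ps j.+1 s -> (\int[mu]_t (k j.+1 s t)%:E = 1)%E.
Proof.
move=> jd Pss; have id : (2 <= j.+1 <= d)%N by lia.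
have id1 : (1 <= j.+1 <= d)%N by lia.
have id3 : (1 <= j.+1 <= d.+1)%N by lia.
have h0 t : 0 <= h j.+1 t by exact: (haz_ge0 Pd).
have mh : measurable_fun setT (h j.+1) by exact: (measurable_haz Pd).
rewrite -(hazard_mass d0 Pd id Pss) [RHS]integral_mkcond.
have /andP[s0 s1] := Psi_unit d0 Pd id3 Pss.
have n1 : ~ Ps j.+1 1 by move=> /(Psi_unit d0 Pd id3); rewrite ltxx andbF.
have [_ _ _ bP] := comp_hiP (open_Psi d0 Pd id3) (ltW s1) n1 Pss.
apply: ae_eq_integral => //.
- by apply/measurable_EFinP; exact: measurable_kr.
- apply/(measurable_restrictT _ _).1; first exact: measurable_itv.
  exact: (measurable_funTS (measurable_hazard s h0 mh)).
apply: lebesgue_aeS (derive_support_hi d0 Pd Joo id1) => t H _.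
rewrite kern_succE// patchE mem_setE in_itv/=.
have [st|_] := boolP (s <= t); last by rewrite andbF mul0r.
rewrite andbT/=; case: ifPn => [tb|tb]; last first.
  by rewrite asboolF ?mul0r// => -[/(bP _ st) tb' _]; rewrite tb' in tb.
have sP := (bP _ st).2 tb.
have [f0|/H Pt] := eqVneq (f j.+1 t) 0; first by rewrite /haz f0 !mul0r mulr0.
by rewrite asboolT// mul1r.
Qed.

(** The integral over the past equals the gap at [t], by [hazard_forward], and the rate times the
    gap is [f j.+1 t]. *)
Lemma state_density_fwd j t : (0 < j < d)%N ->
  (\int[mu]_s (p j s * k j.+1 s t)%:E = (p j.+1 t)%:E)%E.
Proof.
move=> jd; have id : (2 <= j.+1 <= d)%N by lia.
have id1 : (1 <= j.+1 <= d)%N by lia.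
have jd1 : (1 <= j <= d)%N by lia.
have id3 : (1 <= j.+1 <= d.+1)%N by lia.
have h0 r : 0 <= h j.+1 r by exact: (haz_ge0 Pd).
have mh : measurable_fun setT (h j.+1) by exact: (measurable_haz Pd).
have [[Pt Pt2]|nP] := pselect (Ps j.+1 t /\ Ps j.+2 t); last first.
  have -> : p j.+1 t = 0 by rewrite /p (asboolF nP) andbF mul0r.
  apply: integral0_eq => s _.
  rewrite kern_succE//; case: asboolP => [[sg Pt2]|_]; last by rewrite mul0r mulr0.
  have [st|_] := boolP (s <= t); last by rewrite mul0r mulr0.
  by exfalso; apply: nP; split => //; apply: sg; rewrite /= st lexx.
have mg : measurable_fun setT (fun s => (f j s * expR (- cumul (h j.+1) s t))%:E).
  apply/measurable_EFinP/measurable_funM; first exact: (measurable_multidiag_derive Pd).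
  apply: (measurableT_comp (@measurable_expR R)); apply: measurable_funN.
  exact: (measurable_fun_comp2 (measurable_cumul h0 mh) _ (measurable_cst t)).
have /andP[t0 t1] := Psi_unit d0 Pd id3 Pt.
have n0 : ~ Ps j.+1 0 by move=> /(Psi_unit d0 Pd id3); rewrite ltxx.
have [_ _ _ aP] := comp_loP (open_Psi d0 Pd id3) (ltW t0) n0 Pt.
transitivity (\int[mu]_(s in `]comp_lo R (Ps j.+1) t, t])
    ((h j.+1 t)%:E * (f j s * expR (- cumul (h j.+1) s t))%:E))%E; last first.
  rewrite ge0_integralZl//; last 3 first.
  - exact: measurable_funTS.
  - by move=> s _; rewrite lee_fin mulr_ge0 ?expR_ge0// (multidiag_derive_ge0 Pd).
  - by rewrite lee_fin.
  have := hazard_forward d0 Pd id Pt; rewrite /= => ->.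
  have [_ Dt] := (Psi_gap d0 Pd id t).1 Pt.
  rewrite -EFinM (haz0E Pd id) divfK ?gt_eqF// /p id1 asboolT//=.
  by rewrite mul1r.
rewrite [RHS]integral_mkcond; apply: ae_eq_integral => //.
- apply/measurable_EFinP/measurable_funM; first exact: measurable_state_density.
  exact: measurable_kl.
- apply/(measurable_restrictT _ _).1; first exact: measurable_itv.
  apply: measurable_funTS; apply: emeasurable_funM => //.
apply: lebesgue_aeS (state_density_ae jd1) => s ps _.
rewrite ps kern_succE// patchE mem_setE in_itv/=.
have [st|_] := boolP (s <= t); last by rewrite !andbF mul0r mulr0.
rewrite !andbT; case: ifPn => [as_|as_]; last first.
  by rewrite asboolF ?mul0r ?mulr0// => -[/(aP _ st) as' _]; rewrite as' in as_.
rewrite asboolT; last by split => //; exact: ((aP _ st).2 as_).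
by rewrite mul1r -EFinM mulrCA.
Qed.

Lemma kern_start s t : k 1 s t = p 1 t.
Proof. by rewrite /kern /p /segmask. Qed.

Lemma kern_supp j s t : (0 < j <= d)%N -> k j s t != 0 -> Ps j.+1 t.
Proof.
move=> jd; rewrite /kern; case E : (segmask _ _ _ _ _); last first.
  by rewrite andbF mul0r eqxx.
move=> _; move: E; rewrite /segmask; have [->|_] := eqVneq j 1%N; first by move/asboolP => -[].
by move/asboolP => -[].
Qed.

Lemma chain_sorted s x : chain k 1 s x != 0 -> sorted <=%R x.
Proof.
have H j u y : (1 < j)%N -> chain k j u y != 0 -> path <=%R u y.
  elim: y j u => // z y IH j u j1 /=; rewrite mulf_eq0 negb_or => /andP[kz cz].
  rewrite (IH _ _ _ cz) ?andbT; last lia.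
  move: kz; rewrite /kern gtn_eqF//; case: (u <= z) => //.
  by rewrite mul0r mulr0 eqxx.
case: x => // y x /=; rewrite mulf_eq0 negb_or => /andP[_]; exact: H.
Qed.

Lemma c_delta_ge0 x : 0 <= cd x.
Proof. by rewrite (c_deltaE d0 Pd) mulr_ge0 ?invr_ge0// chain_ge0. Qed.

Lemma measurable_c_delta : measurable_fun setT cd.
Proof.
rewrite (_ : cd = fun x => (d`!%:R)^-1 * chain k 1 0 (sortt x)); last first.
  by apply/funext => x; exact: (c_deltaE d0 Pd).
apply: measurable_funM => //.
exact: (measurableT_comp (@measurable_chainr R k mk d 1 0) (@measurable_sortt R d)).
Qed.

(** The chain density lives on sorted tuples, so the restriction left over from sorting is harmless,
    and the [i]th order statistic becomes the [i]th state of the chain. *)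
Lemma c_delta_ordstat i (phi : R -> R) : (1 <= i <= d)%N -> (forall t, 0 <= phi t) ->
  measurable_fun setT phi ->
  (\int[lebn R d]_x (cd x * phi (X x i))%:E = \int[mu]_t (f i t * phi t)%:E)%E.
Proof.
move=> id phi0 mphi; pose F (y : d.-tuple R) := chain k 1 0 y * phi (nth 0 y i.-1).
have F0 y : 0 <= F y by rewrite mulr_ge0// chain_ge0.
have mF : measurable_fun setT F.
  apply: measurable_funM; first exact: measurable_chainr.
  exact: (measurableT_comp mphi (@measurable_nth_tuple R d _)).
transitivity (\int[lebn R d]_x ((d`!%:R)^-1 * F (sortt x))%:E)%E.
  by apply: eq_integral => x _; rewrite (c_deltaE d0 Pd) /F mulrA.
rewrite integral_sortt_normalized//.
transitivity (\int[lebn R d]_x (F x)%:E)%E.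
  apply: eq_integral => x _; congr (_%:E); rewrite indicE /F.
  have [->|/chain_sorted sx] := eqVneq (chain k 1 0 x) 0; first by rewrite !mul0r mulr0.
  by rewrite mem_set ?mul1r.
have -> := @chain_marginal R k k0 mk d p (fun j => Ps j.+1) kern_mass kern_supp
  state_density_ge0 measurable_state_density state_density_fwd kern_start d i.-1 0 phi phi0 mphi
  ltac:(lia).
rewrite prednK; last lia.
apply: ae_eq_integral => //.
- by apply/measurable_EFinP/measurable_funM => //; exact: measurable_state_density.
- by apply/measurable_EFinP/measurable_funM => //; exact: (measurable_multidiag_derive Pd).
by apply: lebesgue_aeS (state_density_ae id) => t -> _.
Qed.

Lemma c_delta_law : exists Q : probability (d.-tuple R) R,
  has_density (lebn R d) Q cd /\ realizes delta Q.
Proof.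
have i1 : (1 <= 1 <= d)%N by lia.
have c1 : (\int[lebn R d]_x (cd x)%:E = 1)%E.
  have := c_delta_ordstat (phi := cst 1) i1 (fun _ => ler01) (measurable_cst _).
  under eq_integral do rewrite /= mulr1.
  by move=> ->; under eq_integral do rewrite /= mulr1; exact: (integral_multidiag_derive Pd).
have [Q Qc] := density_probability c_delta_ge0 measurable_c_delta c1.
have [_ _ QE] := Qc.
have Qind A : measurable A -> Q A = (\int[lebn R d]_x (cd x * \1_A x)%:E)%E.
  move=> mA; rewrite QE// integral_mkcond; apply: eq_integral => x _.
  by rewrite patchE indicE; case: ifP; rewrite ?mulr1 ?mulr0.
have Qord i t : (1 <= i <= d)%N -> Q [set x | X x i <= t] = (delta i t)%:E.
  move=> id; rewrite Qind; last exact: measurable_ordstat_le.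
  have mI : measurable_fun setT (\1_(`]-oo, t]%classic : set R) : R -> R).
    by apply: measurable_indic; exact: measurable_itv.
  transitivity (\int[lebn R d]_x (cd x * \1_(`]-oo, t]%classic : set R) (X x i))%:E)%E.
    by apply: eq_integral => x _; rewrite !indicE; congr (_ * (nat_of_bool _)%:R)%:E.
  rewrite c_delta_ordstat//.
  rewrite -(Pd.2 i id) (_ : [set x | _] = [set x | `]-oo, t]%classic (X x i)]); last first.
    by rewrite set_itvE.
  have := (ordstat_law Pd id).2 `]-oo, t]%classic (measurable_itv _) => ->.
  rewrite [RHS]integral_mkcond; apply: eq_integral => r _.
  by rewrite patchE indicE; case: ifP; rewrite ?mulr1 ?mulr0.
exists Q; split => //; split; last by move=> i id t; exact: Qord.
have mt := @measurable_tnth_le R d.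
(* [c_delta] depends on the sorted tuple alone, so all marginals coincide. Their distribution
   functions add up to the sum of the [delta i], which is [d] times the uniform one; division by [d]
   follows. *)
have sym j j' t : Q [set x | tnth x j <= t] = Q [set x | tnth x j' <= t].
  rewrite !Qind//; pose s := tperm j j'.
  rewrite -(@lebn_permt R d s (fun x => (cd x * \1_[set x | tnth x j' <= t] x)%:E)); last 2 first.
  - by move=> x; rewrite lee_fin mulr_ge0// c_delta_ge0.
  - apply/measurable_EFinP/measurable_funM; first exact: measurable_c_delta.
    exact: measurable_indic.
  apply: eq_integral => x _; rewrite !(c_deltaE d0 Pd) sortt_permt; congr (_ * _)%:E.
  rewrite !indicE; congr (nat_of_bool _)%:R.
  by apply/idP/idP; rewrite !inE /= /permt tnth_mktuple /s tpermR.
move=> j t; have := sum_ordstat_prob Q t.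
rewrite (eq_big_nat _ _ (F2 := fun i => (delta i t)%:E)); last first.
  by move=> i id; rewrite Qord//; lia.
rewrite sumEFin (multidiag_sum Pd) (eq_bigr (fun _ => Q [set x | tnth x j <= t])); last first.
  by move=> j' _; exact: sym.
have qf : Q [set x | tnth x j <= t] \is a fin_num by exact: fin_num_measure.
have dn0 : d%:R != 0 :> R by rewrite pnatr_eq0 -lt0n.
rewrite -(fineK qf) sumEFin sumr_const card_ord => -[]; rewrite -[RHS]mulr_natl.
by move=> /(mulfI dn0) <-.
Qed.

End cdelta_law.

(** * The entropy of [c_delta] *)

Section cdelta_entropy.
Variables (R : realType) (d : nat) (delta : nat -> R -> R).
Variable P : probability (d.-tuple R) R.
Hypotheses (d0 : (0 < d)%N) (Pd : realizes delta P).
Hypothesis Joo : (Jfun R d delta < +oo)%E.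
Local Notation mu := (@lebesgue_measure R).
Local Notation X := (ordstat R d).
Local Notation f i := (derive1 (delta i)).
Local Notation D i t := (delta i.-1 t - delta i t).
Local Notation cd := (c_delta R d delta).

(** The integrand of [J] dominates. Where the gap is [0] the logarithm has the default value [0],
    which is correct almost everywhere because the derivative vanishes there. *)
Lemma integrable_ln_gap0 i : (2 <= i <= d)%N ->
  mu.-integrable setT (fun t => (ln (gap delta 0 i t) * f i t)%:E) /\
  (\int[mu]_(t in unitI R) J_integrand R delta i t)%E =
  (- (\int[mu]_t (ln (gap delta 0 i t) * f i t))%R)%:E.
Proof.
move=> id; have id1 : (1 <= i <= d)%N by lia.
have D0 t : 0 <= D i t by rewrite subr_ge0 (multidiag_decr Pd).
have gE t : gap delta 0 i t = D i t by exact: max_l.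
have D1 t : D i t <= 1 by rewrite -gE; apply: (gap_le1 Pd).
have mg : measurable_fun setT (fun t => (ln (gap delta 0 i t) * f i t)%:E).
  apply/measurable_EFinP/measurable_funM; last exact: (measurable_multidiag_derive Pd).
  by apply: (measurableT_comp (@measurable_ln R)); exact: (measurable_gap Pd).
have iJ := J_integrand_integrable d0 Pd Joo id.
have ig : mu.-integrable setT (fun t => (ln (gap delta 0 i t) * f i t)%:E).
  apply: (@le_integrable _ _ _ mu setT measurableT _ (J_integrand R delta i)) => // t _.
  rewrite (gee0_abs (J_integrand_ge0 d0 Pd t id)) abse_EFin normrM.
  rewrite (ger0_norm (multidiag_derive_ge0 Pd t id1)) gE /J_integrand.
  case: ifPn => [_|Dn]; first by rewrite mulrC.
  by case: eqP => [->|_]; rewrite ?mulr0 ?leey.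
split => //; rewrite (J_integrand_integral Pd id) /Rintegral EFinN fineK; last first.
  exact: integrable_fin_num ig.
rewrite -(integralN (integrable_add_def measurableT ig)); apply: ae_eq_integral => //.
- exact: (measurable_J_integrand Pd).
- by apply: measurableT_comp mg.
apply: lebesgue_aeS (integrable_ae measurableT iJ) => t /(_ I) + _.
rewrite /J_integrand gE; case: ifPn => [Dp _|Dn].
  by rewrite -EFinN -mulNr mulrC; congr (_ * _)%:E; rewrite ler0_norm// ln_le0.
by case: eqP => [-> _|_ //]; rewrite mulr0 oppe0.
Qed.

(** Without truncation the rate times the gap is [f i] almost everywhere; the inequality of the
    upper bound becomes an equality. *)
Lemma integral_haz0_gap i : (2 <= i <= d)%N ->
  (\int[mu]_t (haz delta 0 i t * D i t))%R = 1.
Proof.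
move=> id; have id1 : (1 <= i <= d)%N by lia.
rewrite /Rintegral -[RHS]/(fine 1%:E) -(integral_multidiag_derive Pd id1); congr fine.
apply: ae_eq_integral => //.
- apply/measurable_EFinP/measurable_funM; first exact: (measurable_haz Pd).
  by apply: measurable_funB; apply: (measurable_multidiag Pd); lia.
- by apply/measurable_EFinP; exact: (measurable_multidiag_derive Pd).
apply: lebesgue_aeS (derive_support_lo d0 Pd Joo id1) => t H _; congr (_%:E).
have [f0|/H Pt] := eqVneq (f i t) 0; first by rewrite /haz f0 !mul0r.
have [_ Dt] := (Psi_gap d0 Pd id t).1 Pt.
by rewrite (haz0E Pd id) divfK// gt_eqF.
Qed.

Lemma mean_loglik0 : (- mean_loglik d delta 0)%:E = ent_max d delta.
Proof.
rewrite /ent_max /Jfun.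
have -> : (\sum_(2 <= i < d.+1) \int[mu]_(t in unitI R) J_integrand R delta i t =
    (\sum_(2 <= i < d.+1) - (\int[mu]_t (ln (gap delta 0 i t) * f i t))%R)%:E)%E.
  rewrite -sumEFin; apply: eq_big_nat => i id.
  by have [] := @integrable_ln_gap0 i ltac:(lia).
rewrite -EFinB /mean_loglik; congr (_%:E).
rewrite (eq_big_nat _ _ (F1 := fun i => _ + (\int[mu]_t (haz delta 0 i t * D i t))%R)
  (F2 := fun i => (\int[mu]_t (ln (gap delta 0 i t) * f i t))%R + 1)); last first.
  by move=> i id; rewrite integral_haz0_gap//; lia.
rewrite big_split/= sumrN.
set A := \sum_(1 <= i < d.+1) _; set N := \sum_(2 <= i < d.+1) 1.
by set B := \sum_(2 <= i < d.+1) _; lra.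
Qed.

Lemma ent_of_c_delta (Q : probability (d.-tuple R) R) :
  has_density (lebn R d) Q cd -> realizes delta Q ->
  (lebn R d).-integrable setT (EFin \o entfun cd) /\ ent_of R d cd = ent_max d delta.
Proof.
move=> Qc Qd.
have [il El] : expects Q (loglik delta 0) (mean_loglik d delta 0).
  by apply: (expects_loglik Qd) => i id; have [] := integrable_ln_gap0 id.
have H x : cd x != 0 -> cube R d x /\ ln (cd x) = loglik delta 0 x.
  rewrite (c_deltaE d0 Pd) mulf_eq0 negb_or => /andP[_ cx].
  have [gx _] := chain_neq0_good d0 Pd cx; split; first exact: (good_cube d0 Pd).
  by have [] := ln_chain_kern Pd d0 cx.
have [ie ->] := ent_of_eq Qc H il.
by split => //; rewrite El -EFinN mean_loglik0.
Qed.

End cdelta_entropy.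

(** * Uniqueness of the maximizer *)

Section uniqueness.
Variables (R : realType) (d : nat) (delta : nat -> R -> R).
Variables P1 P2 : probability (d.-tuple R) R.
Variables c1 c2 : d.-tuple R -> R.
Local Notation lam := (lebn R d).
Hypotheses (P1c : has_density lam P1 c1) (P2c : has_density lam P2 c2).
Hypotheses (P1d : realizes delta P1) (P2d : realizes delta P2).

Let m x : R := (c1 x + c2 x) / 2.
Let c10 x : 0 <= c1 x. Proof. by case: P1c. Qed.
Let c20 x : 0 <= c2 x. Proof. by case: P2c. Qed.
Let m0 x : 0 <= m x. Proof. by rewrite divr_ge0// addr_ge0. Qed.
Let mc1 : measurable_fun setT c1. Proof. by case: P1c. Qed.
Let mc2 : measurable_fun setT c2. Proof. by case: P2c. Qed.
Let mm : measurable_fun setT m.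
Proof. by apply: measurable_funM => //; exact: measurable_funD. Qed.

Lemma integral_mixture A : measurable A ->
  (\int[lam]_(x in A) (m x)%:E = (2^-1)%:E * (P1 A + P2 A))%E.
Proof.
move=> mA; have [_ _ E1] := P1c; have [_ _ E2] := P2c.
rewrite E1// E2// -ge0_integralD//; last 4 first.
- by move=> x _; rewrite lee_fin.
- exact/measurable_funTS/measurable_EFinP.
- by move=> x _; rewrite lee_fin.
- exact/measurable_funTS/measurable_EFinP.
rewrite -ge0_integralZl//; last 2 first.
- by apply: emeasurable_funD; exact/measurable_funTS/measurable_EFinP.
- by move=> x _; rewrite -EFinD lee_fin addr_ge0.
by apply: eq_integral => x _; rewrite -EFinD -EFinM mulrC.
Qed.

(** Uniform marginals and the multidiagonal are linear conditions on the law, so the midpoint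
    satisfies them too. *)
Lemma mixture_law : exists P3 : probability (d.-tuple R) R,
  has_density lam P3 m /\ realizes delta P3.
Proof.
have half (a : R) : ((2^-1)%:E * (a%:E + a%:E) = a%:E)%E.
  by rewrite -EFinD -EFinM; congr (_%:E); lra.
have m1 : (\int[lam]_x (m x)%:E = 1)%E.
  by rewrite integral_mixture// [P1 _]probability_setT [P2 _]probability_setT; exact: (half 1).
have [P3 P3m] := density_probability m0 mm m1; exists P3; split => //.
have [_ _ P3E] := P3m; split => [j t|i id t].
  have mt := @measurable_tnth_le R d j t.
  by rewrite P3E// integral_mixture// P1d.1 P2d.1 half.
have mo := @measurable_ordstat_le R d i t.
by rewrite P3E// integral_mixture// P1d.2// P2d.2// half.
Qed.

(** The sum of the pointwise Gibbs inequalities of [c1] and of [c2] relative to [m], in which the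
    linear terms cancel because [c1 + c2 = 2 m]. *)
Lemma entfun_convex x : 0 <= entfun c1 x + entfun c2 x - 2 * entfun m x.
Proof.
rewrite /entfun indicE; case: (_ \in _); rewrite ?mul0r ?mulr0 ?subr0 ?addr0// !mul1r.
have [mx0|mxn0] := eqVneq (m x) 0.
  have c1x : c1 x = 0 by have := c10 x; have := c20 x; move: mx0; rewrite /m; lra.
  have c2x : c2 x = 0 by have := c10 x; have := c20 x; move: mx0; rewrite /m; lra.
  by rewrite mx0 c1x c2x !mul0r mulr0 subr0 addr0.
have mx : 0 < m x by rewrite lt_neqAle eq_sym mxn0 m0.
have := gibbs_pointwise (c10 x) mx; have := gibbs_pointwise (c20 x) mx.
have -> : 2 * (m x * ln (m x)) = c1 x * ln (m x) + c2 x * ln (m x).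
  by rewrite -mulrDl mulrA; congr (_ * _); rewrite /m; lra.
have -> : c1 x = 2 * m x - c2 x by rewrite /m; lra.
by move: (ln _) (ln _) (ln _) => u v w; lra.
Qed.

Lemma entfun_convex_eq x : cube R d x ->
  entfun c1 x + entfun c2 x - 2 * entfun m x = 0 -> c1 x = c2 x.
Proof.
move=> cx; rewrite /entfun indicE mem_set// !mul1r.
have [mx0 _|mxn0] := eqVneq (m x) 0.
  by have := c10 x; have := c20 x; move: mx0; rewrite /m; lra.
have mx : 0 < m x by rewrite lt_neqAle eq_sym mxn0 m0.
have G1 := gibbs_pointwise (c10 x) mx; have G2 := gibbs_pointwise (c20 x) mx.
have -> : 2 * (m x * ln (m x)) = c1 x * ln (m x) + c2 x * ln (m x).
  by rewrite -mulrDl mulrA; congr (_ * _); rewrite /m; lra.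
have mE : 2 * m x = c1 x + c2 x by rewrite /m; lra.
move=> H.
have -> : c1 x = m x.
  apply: gibbs_pointwise_eq => //; move: G1 G2 H mE.
  move: (c1 x * ln (m x)) (c2 x * ln (m x)) (c1 x * ln (c1 x)) (c2 x * ln (c2 x)).
  by move: (c1 x) (c2 x) (m x) => a b n u v w z G1 G2 H mE; lra.
apply/esym/gibbs_pointwise_eq => //; move: G1 G2 H mE.
move: (c1 x * ln (m x)) (c2 x * ln (m x)) (c1 x * ln (c1 x)) (c2 x * ln (c2 x)).
by move: (c1 x) (c2 x) (m x) => a b n u v w z G1 G2 H mE; lra.
Qed.

(** The midpoint has entropy at most [M], so the nonnegative convexity defect has integral at most
    [0] and vanishes almost everywhere. Equality in both Gibbs inequalities then gives [c1 = m = c2]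
    on the cube, outside of which both densities are [0]. *)
Lemma max_entropy_ae_unique (M : R) :
  lam.-integrable setT (EFin \o entfun c1) -> lam.-integrable setT (EFin \o entfun c2) ->
  ent_of R d c1 = M%:E -> ent_of R d c2 = M%:E ->
  (forall P3 c3, realizes delta P3 -> has_density lam P3 c3 -> (ent_of R d c3 <= M%:E)%E) ->
  {ae lam, forall x, c1 x = c2 x}.
Proof.
move=> i1 i2 e1 e2 eM; have [P3 [P3m P3d]] := mixture_law.
have mI := @measurable_cube R d.
have iI : lam.-integrable setT (EFin \o \1_(cube R d)).
  apply/integrableP; split; first by apply/measurable_EFinP; exact: measurable_indic.
  rewrite (eq_integral (fun x => (\1_(cube R d) x)%:E)); last first.
    by move=> x _; rewrite /= ger0_norm.
  rewrite integral_indic// setIT; have := lebn_cube R d; rewrite /= => ->.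
  exact: ltry.
have im : lam.-integrable setT (EFin \o entfun m).
  (* Convexity bounds [entfun m] from above by the average of the other two; [x ln x >= -1] bounds
     it from below by minus the indicator of the cube. *)
  apply: (@le_integrable _ _ _ lam setT measurableT _
      (fun x => (`|entfun c1 x| + `|entfun c2 x| + \1_(cube R d) x)%:E)).
  - by apply/measurable_EFinP; exact: (measurable_entfun P3m).
  - move=> x _; rewrite !abse_EFin lee_fin.
    have g := entfun_convex x.
    have lb : - \1_(cube R d) x <= entfun m x.
      rewrite /entfun indicE; case: (_ \in _); rewrite ?mul0r ?oppr0// mul1r.
      by rewrite xlnx_ge.
    have I0 : 0 <= \1_(cube R d) x :> R by rewrite indicE.
    have n1 := normr_ge0 (entfun c1 x); have n2 := normr_ge0 (entfun c2 x).
    have l1 := ler_norm (entfun c1 x); have l2 := ler_norm (entfun c2 x).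
    by rewrite [leRHS]ger0_norm ?addr_ge0// ler_norml; lra.
  - exact: (integrableD measurableT (integrableD measurableT (integrable_abse i1)
      (integrable_abse i2)) iI).
have E1 : (\int[lam]_x (entfun c1 x)%:E = (- M)%:E)%E.
  by rewrite -[LHS]oppeK -(ent_of_integrable P1c i1) e1.
have E2 : (\int[lam]_x (entfun c2 x)%:E = (- M)%:E)%E.
  by rewrite -[LHS]oppeK -(ent_of_integrable P2c i2) e2.
have Em : ((- M)%:E <= \int[lam]_x (entfun m x)%:E)%E.
  rewrite -[leRHS]oppeK -(ent_of_integrable P3m im) EFinN leeN2.
  exact: eM P3d P3m.
pose g x := entfun c1 x + entfun c2 x - 2 * entfun m x.
have i12 := integrableD measurableT i1 i2.
have i2m := integrableZl measurableT 2 im.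
have mg : measurable_fun setT (EFin \o g).
  exact: (measurable_int lam (integrableB measurableT i12 i2m)).
have g0 : (\int[lam]_x (g x)%:E = 0)%E.
  apply/eqP; rewrite eq_le; apply/andP; split; last first.
    by apply: integral_ge0 => x _; rewrite lee_fin entfun_convex.
  have -> : (\int[lam]_x (g x)%:E = \int[lam]_x (((EFin \o entfun c1) \+ (EFin \o entfun c2)) x
    - 2%:E * (EFin \o entfun m) x))%E by [].
  rewrite (integralB measurableT i12 i2m) (integralD measurableT i1 i2).
  rewrite (integralZl measurableT im) [X in (X + _ - _)%E]E1 [X in (_ + X - _)%E]E2.
  have [b Eb] : exists b : R, (\int[lam]_x (entfun m x)%:E = b%:E)%E.
    by exists (fine (\int[lam]_x (entfun m x)%:E)%E); rewrite fineK// (integrable_fin_num measurableT im).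
  rewrite [X in (_ - _ * X)%E]Eb.
  suff : - M + - M - 2 * b <= 0 by rewrite -lee_fin.
  by move: Em; rewrite Eb lee_fin; lra.
have gae : ae_eq lam setT (EFin \o g) (cst 0%E).
  apply/(ae_eq_integral_abs _ measurableT _).1 => //.
  rewrite -[RHS]g0; apply: eq_integral => x _.
  by rewrite /= ger0_norm// entfun_convex.
apply: filterS3 gae (density_out_cube P1c (realizes_cube P1d))
  (density_out_cube P2c (realizes_cube P2d)) => x gx o1 o2.
have [cx|ncx] := pselect (cube R d x); last by rewrite o1// o2.
by apply: entfun_convex_eq => //; have [] := gx I.
Qed.

End uniqueness.

(** * From densities to copulas *)

Section entropy_density.
Variables (R : realType) (d : nat) (P : probability (d.-tuple R) R).
Local Notation lam := (lebn R d).

Lemma ent_of_ae_eq c c' : has_density lam P c -> has_density lam P c' ->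
  ent_of R d c = ent_of R d c'.
Proof.
move=> Pc Pc'; rewrite (ent_of_funeposneg Pc) (ent_of_funeposneg Pc').
have mE := measurable_entfun Pc; have mE' := measurable_entfun Pc'.
have cc := density_ae_unique Pc Pc'.
congr (- _ + _)%E; apply: ae_eq_integral => //.
- by apply: measurable_funepos; apply/measurable_EFinP.
- by apply: measurable_funepos; apply/measurable_EFinP.
- by apply: filterS cc => x cx _; rewrite !funeposE /= /entfun cx.
- by apply: measurable_funeneg; apply/measurable_EFinP.
- by apply: measurable_funeneg; apply/measurable_EFinP.
- by apply: filterS cc => x cx _; rewrite !funenegE /= /entfun cx.
Qed.

(** [entropy] picks some density by choice; two densities of one law agree almost everywhere and
    have the same entropy integral. *)
Lemma entropyE c : has_density lam P c -> entropy R d (cdf_of R d P) = ent_of R d c.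
Proof.
move=> Pc; rewrite /entropy; case: pselect => [h|[]]; last first.
  by exists c; exact: has_density_cdf.
by apply: ent_of_ae_eq => //; apply: is_density_has_density; case: (cid h).
Qed.

Lemma entropy_density : entropy R d (cdf_of R d P) != -oo%E -> exists c, has_density lam P c.
Proof.
rewrite /entropy; case: pselect => [[c cC] _|]; last by rewrite eqxx.
by exists c; exact: is_density_has_density.
Qed.

End entropy_density.

Lemma Cset_realizes (R : realType) (d : nat) (delta : nat -> R -> R) C :
  Cset R d delta C <->
  exists P : probability (d.-tuple R) R, realizes delta P /\ C = cdf_of R d P.
Proof.
split=> [[_ [P [uP CP oP]]]|[P [[uP oP] CP]]]; first by exists P.
by split; exists P.
Qed.

Theorem mainTheorem2 (R : realType) (d : nat) (delta : nat -> R -> R) :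
  (0 < d)%N -> in_D R d delta ->
  (Jfun R d delta = +oo%E ->
     forall C, Cset R d delta C -> entropy R d C = -oo%E) /\
  ((Jfun R d delta < +oo)%E ->
     [/\ in_D0 R d delta,
         (-oo < ereal_sup [set entropy R d C | C in Cset R d delta])%E &
         exists Cd : d.-tuple R -> R,
           [/\ is_density R d Cd (c_delta R d delta),
               Cset R d delta Cd,
               (forall C, Cset R d delta C -> (entropy R d C <= entropy R d Cd)%E) &
               (forall C, Cset R d delta C -> entropy R d C = entropy R d Cd -> C = Cd)]]).
Proof.
move=> d0 [C0 /Cset_realizes[P0 [P0d _]]].
have upper C : Cset R d delta C -> (entropy R d C <= ent_max d delta)%E.
  move=> /Cset_realizes[P [Pd ->]].
  have [->|/entropy_density[c Pc]] := eqVneq (entropy R d (cdf_of R d P)) -oo%E.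
    exact: leNye.
  by rewrite (entropyE Pc); exact: (ent_of_le_max Pd).
split=> [Joo C CC|Joo].
  (* An infinite [J] makes the upper bound itself [-oo]. *)
  apply/eqP; rewrite -leeNy_eq (le_trans (upper C CC))// /ent_max Joo.
  by rewrite addeNy.
have [Q [Qc Qd]] := c_delta_law d0 P0d Joo.
have [iQ EQ] := ent_of_c_delta d0 P0d Joo Qc Qd.
have CQ : Cset R d delta (cdf_of R d Q) by apply/Cset_realizes; exists Q.
have dQ := has_density_cdf Qc.
have EQd := entropyE Qc; rewrite EQ in EQd.
have [M EM] : exists M, ent_max d delta = M%:E.
  by eexists; rewrite -(mean_loglik0 d0 P0d Joo).
split.
- by exists (cdf_of R d Q); split => //; exists (c_delta R d delta).
- apply: (@lt_le_trans _ _ (entropy R d (cdf_of R d Q))).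
    by rewrite EQd EM ltNyr.
  by apply: ereal_sup_ubound; exists (cdf_of R d Q).
exists (cdf_of R d Q); split => // C.
  by move=> /upper; rewrite EQd.
move=> /Cset_realizes[P [Pd ->]]; rewrite EQd EM => EP.
have [|c Pc] := @entropy_density R d P; first by rewrite EP.
have Ec : ent_of R d c = M%:E by rewrite -(entropyE Pc).
(* The entropy is finite here, whereas a non-integrable [entfun] would force it to be [-oo]. *)
have ic : (lebn R d).-integrable setT (EFin \o entfun c).
  by apply: contrapT => /(ent_of_Ny Pc); rewrite Ec.
have cE : {ae lebn R d, forall x, c x = c_delta R d delta x}.
  apply: (max_entropy_ae_unique Pc Qc Pd Qd ic iQ Ec) => [|P3 c3 P3d P3c].
    by rewrite EQ.
  by rewrite -EM; exact: (ent_of_le_max P3d).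
(* Densities that agree almost everywhere give half boxes the same probability, so the two copulas
   coincide at every point. *)
have [_ mc PE] := Pc; have [_ mcd QE] := Qc.
apply/funext => u; apply: EFin_inj; rewrite -!cdf_ofE.
rewrite PE ?QE; [|exact: measurable_half_box..].
apply: ae_eq_integral => //.
- exact: measurable_half_box.
- exact/measurable_funTS/measurable_EFinP.
- exact/measurable_funTS/measurable_EFinP.
- by apply: filterS cE => x -> _.
Qed.
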